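(* Let $\mathcal T$ be a complete, subsequential, finally connected, finally aperiodic transducer. Then $$\mathbb E(\mathsf{Input}(X_n))=e_1n,\quad \mathbb E(\mathsf{Output}(X_n))=e_2n+\mathcal O(1),$$ $$\mathbb V(\mathsf{Input}(X_n))=v_1n,\quad \mathbb V(\mathsf{Output}(X_n))=v_2n+\mathcal O(1),\quad \mathrm{Cov}(\mathsf{Input}(X_n),\mathsf{Output}(X_n))=cn+\mathcal O(1),$$ where the constants are $$e_1=\frac{\varepsilon(\mathcal D_1)}{\mathds 1(\mathcal D_1)},\qquad e_2=\frac{\delta(\mathcal D_1)}{\mathds 1(\mathcal D_1)},$$ $$v_1=\frac1{\mathds 1(\mathcal D_1)}\big((\varepsilon-e_1\mathds 1)(\varepsilon-e_1\mathds 1)(\mathcal D_1)-(\varepsilon-e_1\mathds 1)(\varepsilon-e_1\mathds 1)(\mathcal D_2)\big),$$ $$v_2=\frac1{\mathds 1(\mathcal D_1)}\big((\delta-e_2\mathds 1)(\delta-e_2\mathds 1)(\mathcal D_1)-(\delta-e_2\mathds 1)(\delta-e_2\mathds 1)(\mathcal D_2)\big),$$ $$c=\frac1{\mathds 1(\mathcal D_1)}\big((\varepsilon-e_1\mathds 1)(\delta-e_2\mathds 1)(\mathcal D_1)-(\varepsilon-e_1\mathds 1)(\delta-e_2\mathds 1)(\mathcal D_2)\big).$$ The transducer $\mathcal T$ is independent if and only if $$(\varepsilon-e_1\mathds 1)(\delta-e_2\mathds 1)(\mathcal D_1)=(\varepsilon-e_1\mathds 1)(\delta-e_2\mathds 1)(\mathcal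 D_2).$$
   Context: A transducer consists of a finite set of states $\{1,\dots,S\}$, a finite input alphabet $\mathcal A_I\subseteq\mathbb R$ (with at least two elements), an output alphabet $\mathcal A_O\subseteq\mathbb R$, a set of transitions $\mathcal E\subseteq\{1,\dots,S\}^2\times\mathcal A_I$, output labels $\delta\colon\mathcal E\to\mathcal A_O$, and the initial state $1$. A transition $e=(s,t,\varepsilon)$ goes from $s$ to $t$ and has input label $\varepsilon(e)=\varepsilon$ and output label $\delta(e)$. The underlying graph is the directed multigraph (loops and parallel edges allowed) whose vertices are the states and whose edges are the transitions. The transducer is deterministic if for every state $s$ and $\varepsilon\in\mathcal A_I$ there is at most one $t$ with $(s,t,\varepsilon)\in\mathcal E$; complete if for every $s$ and $\varepsilon$ there is some such $t$; subsequential if it is deterministic, every state is final, and it has a final output $a\colon\{1,\dots,S\}\to\mathcal A_O$. It is finally connected if some state can be reached from every other state; its final component is then the transducer induced by the set of all states which can be reached from every other state. A finally connected transducer is finally aperiodic if the underlying graph of the final component is aperiodic (the gcd of the lengths of all closed walks starting and ending at a given vertex is $1$). The output of the transducer on an input word is the sequence of output labels along the unique path starting at state $1$ whose input labels are the word (read in a fixed direction, from right to left), together with the final output label of the last state of this path. $X_n$ is uniformly distributed on $\mathcal A_I^n$; $\mathsf{Input}(X_n)$ is the sum of the letters of $X_n$ and $\mathsf{Output}(X_n)$ is the sum of its output sequence. The transducer is independent if the standardized vector $\big((\mathsf{Input}(X_n),\mathsf{Output}(X_n))^t-(e_1,e_2)^tn\big)/\sqrt n$ converges in distribution to a random vector with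 two independent components (a degenerate, i.e. almost surely constant, random variable is independent of any other random variable). A functional digraph is a digraph all of whose vertices have out-degree $1$; each of its (weakly connected) components consists of a directed cycle (possibly a loop) and some trees rooted at vertices of the cycle. For a functional digraph $D$, $\mathcal C_D$ is the set of all cycles of $D$. $\mathcal D_1$ and $\mathcal D_2$ are the sets of all spanning subgraphs of the (underlying graph of the) final component which are functional digraphs with one and with two components, respectively. For functions $g,h\colon\mathcal E\to\mathbb R$ and a cycle $C$, $g(C)=\sum_{e\in C}g(e)$, and $$g(\mathcal D_1)=\sum_{D\in\mathcal D_1}\sum_{C\in\mathcal C_D}g(C),\qquad gh(\mathcal D_1)=\sum_{D\in\mathcal D_1}\sum_{C\in\mathcal C_D}g(C)h(C),$$ $$gh(\mathcal D_2)=\sum_{D\in\mathcal D_2}\sum_{C_1\in\mathcal C_D}\sum_{C_2\in\mathcal C_D,\,C_2\ne C_1}g(C_1)h(C_2).$$ Here $\mathds 1$ is the constant function $1$, and $\varepsilon,\delta$ are the input and output labels of transitions. *)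

(* Defs.v *)
From HB Require Import structures.
From mathcomp Require Import all_boot all_order all_algebra finmap.
From mathcomp Require Import all_classical all_reals all_analysis.
Set Implicit Arguments.
Unset Strict Implicit.
Unset Printing Implicit Defensive.
Import Order.TTheory GRing.Theory Num.Theory.
Import numFieldNormedType.Exports.
Local Open Scope classical_set_scope.
Local Open Scope ring_scope.

(* The states 1, ..., S are the ordinals 0, ..., S - 1 of 'I_tsize.+1, where
   tsize = S - 1; the initial state is ord0. A transition is a triple
   ((s, t), eps). The values of [outlab] outside [trans] are irrelevant. *)
Record transducer (R : realType) := Transducer {
  tsize : nat;
  alphI : {fset R};
  alphI_gt1 : (1 < #|` alphI|)%N;
  alphO : set R;
  trans : {set 'I_tsize.+1 * 'I_tsize.+1 * alphI};
  outlab : 'I_tsize.+1 * 'I_tsize.+1 * alphI -> R;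
  outlab_alphO : forall e, e \in trans -> alphO (outlab e);
  final : {set 'I_tsize.+1}
}.

Section Graph.
Variables (R : realType) (T : transducer R).

Definition state : finType := 'I_(tsize T).+1.
Definition edge : finType := (state * state * alphI T)%type.

Definition src (e : edge) : state := e.1.1.
Definition tgt (e : edge) : state := e.1.2.
Definition letter (e : edge) : alphI T := e.2.
Definition inlab (e : edge) : R := val (letter e).

Fixpoint walk (D : {set edge}) (s : state) (p : seq edge) (t : state) : bool :=
  if p is e :: p' then [&& e \in D, src e == s & walk D (tgt e) p' t]
  else s == t.

Definition adj (D : {set edge}) : rel state :=
  fun s t => [exists e in D, (src e == s) && (tgt e == t)].

Definition reachable : rel state := connect (adj (trans T)).

Definition deterministic : Prop :=
  forall (s : state) (eps : alphI T) (t t' : state),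
    (s, t, eps) \in trans T -> (s, t', eps) \in trans T -> t = t'.

Definition complete : Prop :=
  forall (s : state) (eps : alphI T), exists t : state, (s, t, eps) \in trans T.

(* [a] is the final output function. *)
Definition subsequential (a : state -> R) : Prop :=
  [/\ deterministic, final T = [set: state]%SET & forall s, alphO T (a s)].

Definition finally_connected : Prop :=
  exists s : state, forall t : state, reachable t s.

Definition final_states : {set state} :=
  [set s : state | [forall t : state, reachable t s]]%SET.

Definition final_edges : {set edge} :=
  [set e in trans T | (src e \in final_states) && (tgt e \in final_states)]%SET.

Definition is_gcd (L : set nat) (g : nat) : Prop :=
  forall d : nat, (d %| g)%N <-> (forall n, L n -> (d %| n)%N).

Definition finally_aperiodic : Prop :=
  forall s, s \in final_states ->
    is_gcd [set n | exists2 p, walk final_edges s p s & size p = n] 1.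

Definition weak_adj (D : {set edge}) : rel state :=
  fun s t => adj D s t || adj D t s.

(* Spanning subgraphs are given by their edge sets, their vertex set being
   [final_states]. *)
Definition functional_subgraphs (k : nat) : {set {set edge}} :=
  [set D : {set edge} |
    [&& D \subset final_edges,
        [forall s in final_states, #|[set e in D | src e == s]%SET| == 1%N]
      & n_comp (weak_adj D) final_states == k]]%SET.

Definition calD1 : {set {set edge}} := functional_subgraphs 1.
Definition calD2 : {set {set edge}} := functional_subgraphs 2.

(* Directed cycles, identified with their edge sets. *)
Definition cycles (D : {set edge}) : {set {set edge}} :=
  [set C : {set edge} | `[< exists (s : state) (p : seq edge),
    [/\ p != [::], walk D s p s, uniq (map src p)
      & C = [set e in p]%SET] >]]%SET.

Definition csum (g : edge -> R) (C : {set edge}) : R := \sum_(e in C) g e.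

Definition sumD1 (g : edge -> R) : R :=
  \sum_(D in calD1) \sum_(C in cycles D) csum g C.

Definition prodD1 (g h : edge -> R) : R :=
  \sum_(D in calD1) \sum_(C in cycles D) csum g C * csum h C.

Definition prodD2 (g h : edge -> R) : R :=
  \sum_(D in calD2) \sum_(C1 in cycles D) \sum_(C2 in cycles D | C2 != C1)
    csum g C1 * csum h C2.

Definition one_lab (e : edge) : R := 1.

Definition const_e1 : R := sumD1 inlab / sumD1 one_lab.
Definition const_e2 : R := sumD1 (@outlab R T) / sumD1 one_lab.

Definition inlab_c (e : edge) : R := inlab e - const_e1 * one_lab e.
Definition outlab_c (e : edge) : R := outlab e - const_e2 * one_lab e.

Definition const_v1 : R :=
  (sumD1 one_lab)^-1 * (prodD1 inlab_c inlab_c - prodD2 inlab_c inlab_c).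
Definition const_v2 : R :=
  (sumD1 one_lab)^-1 * (prodD1 outlab_c outlab_c - prodD2 outlab_c outlab_c).
Definition const_c : R :=
  (sumD1 one_lab)^-1 * (prodD1 inlab_c outlab_c - prodD2 inlab_c outlab_c).

End Graph.

Definition word (R : realType) (T : transducer R) (n : nat) : Type :=
  n.-tuple (alphI T).

HB.instance Definition _ (R : realType) (T : transducer R) (n : nat) :=
  Finite.on (word T n).

Lemma alphI_inhabited (R : realType) (T : transducer R) :
  exists eps : alphI T, true.
Proof.
have : (0 < #|` alphI T|)%N by apply: ltn_trans (alphI_gt1 T).
by rewrite cardfE => /card_gt0P[eps _]; exists eps.
Qed.

HB.instance Definition _ (R : realType) (T : transducer R) (n : nat) :=
  isPointed.Build (word T n) [tuple of nseq n (xchoose (alphI_inhabited T))].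

HB.instance Definition _ (R : realType) (T : transducer R) (n : nat) :=
  @isMeasurable.Build default_measure_display (word T n)
    (@discrete_measurable (word T n)) (@discrete_measurable0 _)
    (@discrete_measurableC _) (@discrete_measurableU _).

(* The law of X_n: the normalized counting measure on words of length n (the
   last argument of [mnormalize] is an unused default, see [unifE]). *)
Definition unif (R : realType) (T : transducer R) (n : nat) :
  probability (word T n) R :=
  mnormalize (@counting (word T n) R) (dirac point).

Lemma unifE (R : realType) (T : transducer R) (n : nat) (x : word T n) :
  unif T n [set x] = ((#|` alphI T| ^ n)%:R^-1)%:E.
Proof.
have cT : @counting (word T n) R [set: word T n] = (#|` alphI T| ^ n)%:R%:E.
  have finT : finite_set [set: word T n] by exact: finite_finset.
  rewrite /counting asboolT//; congr (_%:R%:E).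
  rewrite [RHS](_ : _ = #|{: word T n}|); last by rewrite card_tuple cardfE.
  rewrite cardE; apply/perm_size/uniq_perm; rewrite ?fset_uniq ?enum_uniq//.
  by move=> y; rewrite mem_enum inE in_fset_set// in_setT.
have c1 : @counting (word T n) R [set x] = 1%:E.
  by rewrite /counting asboolT// fset_set1 cardfs1.
have n0 : (#|` alphI T| ^ n)%:R != 0 :> R.
  by rewrite pnatr_eq0 -lt0n expn_gt0 (ltn_trans _ (alphI_gt1 T)).
have unifM (mu : {measure set word T n -> \bar R}) P r :
    mu [set: word T n] = r%:E -> r != 0 -> mu [set x] = 1%:E ->
    mnormalize mu P [set x] = r^-1%:E.
  move=> muT r0 mu1; rewrite /mnormalize muT orbF eqe (negbTE r0) mu1.
  by rewrite mul1e.
exact: unifM cT n0 c1.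
Qed.

Section Output.
Variables (R : realType) (T : transducer R).

(* Words are read from right to left. *)
Definition is_run (n : nat) (x : word T n) (p : n.-tuple (edge T)) : bool :=
  [exists t : state T, walk (trans T) (ord0 : state T) p t]
  && (map (@letter R T) p == rev x).

Definition Input (n : nat) (x : word T n) : R := \sum_(eps <- x) val eps.

(* The sum of the output labels along the run, plus the final output of its
   last state; the default 0 is not used if T is complete, and the run is unique if T is
   deterministic. *)
Definition Output (a : state T -> R) (n : nat) (x : word T n) : R :=
  if [pick p | is_run x p] is Some p then
    (\sum_(e <- p) outlab e) + a (last (ord0 : state T) (map (@tgt R T) p))
  else 0.

End Output.

(* u_n = k n + O(1), for a sequence u of extended reals *)
Definition linear_up_to_O1 (R : realType) (u : nat -> \bar R) (k : R) : Prop :=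
  exists2 r : nat -> R, r =O_\oo (fun=> 1 : R) &
    forall n, u n = (k * n%:R + r n)%:E.

Definition independent_RV d (Om : measurableType d) (R : realType)
    (P : probability Om R) (Y1 Y2 : {RV P >-> R}) : Prop :=
  forall A B : set R, measurable A -> measurable B ->
    P (Y1 @^-1` A `&` Y2 @^-1` B) = (P (Y1 @^-1` A) * P (Y2 @^-1` B))%E.

(* Convergence in distribution, as weak convergence: expectations of bounded
   continuous functions converge. *)
Definition cvg_in_distribution (R : realType) (V : topologicalType)
    d (Om : nat -> measurableType d) (P : forall n, probability (Om n) R)
    (Z : forall n, Om n -> V)
    d' (Om' : measurableType d') (Q : probability Om' R) (Y : Om' -> V) : Prop :=
  forall f : V -> R, continuous f -> (exists M : R, forall z, `|f z| <= M) ->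
    ('E_(P n)[f \o Z n] @[n --> \oo] --> 'E_Q[f \o Y])%E.

Definition standardized (R : realType) (T : transducer R) (a : state T -> R)
    (n : nat) (x : word T n) : R * R :=
  ((Input x - const_e1 T * n%:R) / Num.sqrt n%:R,
   (Output a x - const_e2 T * n%:R) / Num.sqrt n%:R).

Definition independent (R : realType) (T : transducer R) (a : state T -> R) :
    Prop :=
  exists (d : measure_display) (Om : measurableType d) (Q : probability Om R)
    (Y1 Y2 : {RV Q >-> R}),
    independent_RV Y1 Y2 /\
    cvg_in_distribution (unif T) (@standardized R T a)
      Q (fun w => (Y1 w, Y2 w)).

(* Main.v *)
Require Import Defs.
From HB Require Import structures.
From mathcomp Require Import all_boot all_order all_algebra.
From mathcomp Require Import all_classical all_reals all_analysis.
From mathcomp Require Import finmap measurable_realfun ring lra zify.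
Import Order.TTheory GRing.Theory Num.Theory.
Import numFieldNormedType.Exports.
Local Open Scope ring_scope.

Set Implicit Arguments.
Unset Strict Implicit.
Unset Printing Implicit Defensive.

(* An element of D_1 with a vertex s marked on its cycle is a spanning tree
   rooted at s together with an edge out of s. By the Markov chain tree theorem,
   sums over D_1 are therefore averages for the stationary distribution of the
   chain of states: g(D_1) / 1(D_1) is the stationary mean of g.

   Adding a coboundary u(tgt e) - u(src e) to a label changes no cycle sum, and
   changes the sum of the labels along a run by a bounded amount only. A solution
   u of the Poisson equation makes the centred output label balanced: its sum
   over the edges out of any given state vanishes. The centred input label is
   balanced already. For balanced g and h, all pairs of distinct vertices cancel
   in gh(D_1) - gh(D_2), so that this is 1(D_1) times the stationary mean of g h;
   and the sums of g and h along the run are martingales, whose covariance is the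
   expected sum of g h. Aperiodicity enters only to bound the correlation between
   the output martingale and the last state.

   For the equivalence, a second order Taylor expansion of the characteristic
   function of the martingale gives convergence of all joint characteristic
   functions of the standardized vector to Gaussian ones with covariance c. If
   the limit has independent components, comparing E cos(Y1 + Y2) with E cos Y1
   and E cos Y2 forces c = 0. Conversely, if c = 0 the limit is a pair of
   independent normal variables; convergence of the expectations of bounded
   continuous functions follows from that of the trigonometric ones, since the
   first absolute moments are bounded and continuous functions are uniformly
   approximated on squares by Bernstein polynomials in trigonometric functions. *)

(** * Functional digraphs *)

(** By completeness and determinism the edges out of a state are the letters. A functional subgraph
    of the final component is thus a function from final states to letters, and averaging over the
    edge out of one state, all others being kept, is reading one uniform letter. This ties the graph
    sums to the chain. The initial state may lie outside the final component, so the Poisson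
    equation is solved on all states, although the stationary distribution charges only the final
    ones; this rests on the maximum principle and on a state that is reachable from everywhere. For
    the input, the zero function solves both Poisson equations involved, the labels out of every
    state being the whole alphabet; hence mean and variance have no error term. Complex numbers are
    avoided: one argument about a pair ([F], [D]), used for cosine and for sine, gives real and
    imaginary parts of the characteristic functions. *)

Lemma fconnect_ind (V : finType) (f : V -> V) (P : V -> Prop) x y :
  (forall z, P z -> P (f z)) -> fconnect f x y -> P x -> P y.
Proof.
move=> Pf /iter_findex <- Px; elim: (findex f x y) => //= n; exact: Pf.
Qed.

Section FunctionalGraphs.
Variables (R : realFieldType) (V L : finType) (nx : V -> L -> V).
Implicit Types (phi : {ffun V -> L}) (s t x y : V).

Definition fmap phi x : V := nx x (phi x).

Definition upd phi s (l : L) : {ffun V -> L} :=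
  [ffun x => if x == s then l else phi x].

(** Exchanging [l] with [phi s] is an involution of the pairs ([phi], [l]). This is the averaging
    over the edge out of [s] with all other edges kept. *)
Lemma sum_upd (G : {ffun V -> L} -> R) s :
  \sum_phi \sum_l G (upd phi s l) = #|L|%:R * \sum_phi G phi.
Proof.
rewrite pair_big /=.
pose sw (p : {ffun V -> L} * L) := (upd p.1 s p.2, p.1 s).
have swK : involutive sw.
  case=> phi l; congr pair; last by rewrite ffunE eqxx.
  by apply/ffunP => x; rewrite !ffunE; case: eqP => // ->.
rewrite (reindex_inj (inv_inj swK)) /=.
rewrite (eq_bigr (fun p => G p.1)); last first.
  by move=> [phi l] _ /=; have /(congr1 fst) /= -> := swK (phi, l).
rewrite -(pair_big xpredT xpredT (fun phi l => G phi)) /= mulr_sumr.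
by apply: eq_bigr => phi _; rewrite sumr_const mulr_natl.
Qed.

(** As [fmap phi s] also reaches [s], the digraph has one component and [s] lies on its cycle;
    without the edge out of [s] it is a spanning tree rooted at [s]. *)
Definition rooted phi s := [forall x, fconnect (fmap phi) x s].

Definition same_cycle phi s t := rooted phi s && fconnect (fmap phi) s t.

Definition two_cycles phi s t :=
  [&& [forall x, fconnect (fmap phi) x s || fconnect (fmap phi) x t],
      fconnect (fmap phi) (fmap phi s) s, fconnect (fmap phi) (fmap phi t) t,
      ~~ fconnect (fmap phi) s t & ~~ fconnect (fmap phi) t s].

Section Stopped.
Variables (s t : V) (st : s != t).

(** Making [s] and [t] fixed points deletes their outgoing edges; what remains does not depend on
    [phi s] and [phi t], and consists of two trees as soon as [covered] holds. *)
Definition stopped phi x := if (x == s) || (x == t) then x else fmap phi x.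

Lemma stopped_upds phi l : stopped (upd phi s l) =1 stopped phi.
Proof.
move=> x; rewrite /stopped /fmap ffunE.
by case: (altP (x =P s)).
Qed.

Lemma stopped_updt phi l : stopped (upd phi t l) =1 stopped phi.
Proof.
move=> x; rewrite /stopped /fmap ffunE orbC.
by case: (altP (x =P t)).
Qed.

Variable phi : {ffun V -> L}.
Let f := fmap phi.
Let f' := stopped phi.
Definition covered := [forall x, fconnect f' x s || fconnect f' x t].

Let f's : f' s = s. Proof. by rewrite /f' /stopped eqxx. Qed.
Let f't : f' t = t. Proof. by rewrite /f' /stopped eqxx orbT. Qed.

(** The root that the orbit of [x] meets first absorbs it. *)
Lemma stopped_excl x : fconnect f' x s -> fconnect f' x t = false.
Proof.
move=> xs; apply/negP => xt.
have fixC u v : f' u = u -> fconnect f' u v -> v = u.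
  by move=> fu /(fconnect_ind (P := fun z => z = u)); apply => // z ->.
suff : fconnect f' s t || fconnect f' t s.
  by case/orP=> [/(fixC _ _ f's)/esym|/(fixC _ _ f't)] /eqP; apply/negP.
move: (iter_findex xs) (iter_findex xt).
set m := findex _ _ _; set n := findex _ _ _.
move=> Es Et; case: (leqP m n) => mn.
  by rewrite -Es -Et -(subnK mn) iterD fconnect_iter.
by rewrite -Es -Et -(subnK (ltnW mn)) iterD fconnect_iter orbT.
Qed.

Lemma stopped_connect x u : fconnect f' x u -> fconnect f x u.
Proof.
move=> /(fconnect_ind (P := fun z => fconnect f x z)); apply=> // z xz.
rewrite /f' /stopped; case: ifP => // _.
exact: connect_trans xz (fconnect1 _ _).
Qed.

Lemma covered_of_connect x :
  fconnect f x s || fconnect f x t -> fconnect f' x s || fconnect f' x t.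
Proof.
have H n : (iter n f x == s) || (iter n f x == t) ->
    fconnect f' x s || fconnect f' x t.
  elim: n x => [|n IH] {}x /=.
    by case/orP=> /eqP ->; rewrite connect0 ?orbT.
  rewrite -iterS iterSr => /IH.
  case: (boolP ((x == s) || (x == t))) => [|xst].
    by case/orP=> /eqP ->; rewrite connect0 ?orbT.
  have xfx : fconnect f' x (f x).
    by have := fconnect1 f' x; rewrite {2}/f' /stopped (negbTE xst).
  by case/orP=> c; rewrite (connect_trans xfx c) ?orbT.
case/orP=> c; first by apply: (H (findex f x s)); rewrite (iter_findex c) eqxx.
by apply: (H (findex f x t)); rewrite (iter_findex c) eqxx orbT.
Qed.

Lemma basin_closed u x : (u == s) || (u == t) -> fconnect f' (f u) u ->
  fconnect f' x u -> fconnect f' (f x) u.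
Proof.
move=> ust fu xu; have [-> //|xNu] := eqVneq x u.
have xNst : ~~ ((x == s) || (x == t)).
  apply: contra xNu => xst.
  have fx : f' x = x by rewrite /f' /stopped xst.
  by apply/eqP/esym; apply: (fconnect_ind (P := fun z => z = x) _ xu) => // z ->.
have -> : f x = f' x by rewrite /f' /stopped (negbTE xNst).
rewrite -(iter_findex xu); move: (iter_findex xu).
case: (findex _ _ _) => [|n]; first by move=> /= /eqP; rewrite (negbTE xNu).
by move=> _; rewrite iterSr fconnect_iter.
Qed.

Lemma basin_s_trap x : fconnect f' (f s) s -> fconnect f s x -> fconnect f' x s.
Proof.
move=> fs sx; apply: (fconnect_ind (P := fun z => fconnect f' z s) _ sx) => //.
by move=> z; apply: basin_closed; rewrite ?eqxx.
Qed.

Lemma basin_t_trap x : fconnect f' (f t) t -> fconnect f t x -> fconnect f' x t.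
Proof.
move=> fs sx; apply: (fconnect_ind (P := fun z => fconnect f' z t) _ sx) => //.
by move=> z; apply: basin_closed; rewrite ?eqxx ?orbT.
Qed.

Let f's_t : fconnect f' t s = false.
Proof. by apply/negP => /stopped_excl; rewrite connect0. Qed.
Let f't_s : fconnect f' s t = false.
Proof. by rewrite stopped_excl. Qed.

(** An edge from a root back into its own tree would make that tree a trap for [fmap phi], and the
    other root could not be reached from there. *)
Lemma same_cycleE :
  same_cycle phi s t = [&& covered, fconnect f' (f s) t & fconnect f' (f t) s].
Proof.
apply/andP/and3P => [[/forallP xs stc]|[/forallP cov fs ft]].
- have cov x : fconnect f' x s || fconnect f' x t.
    by apply: covered_of_connect; rewrite xs.
  split; first by apply/forallP.
  + have /orP[c|//] := cov (f s).
    by have := basin_s_trap c stc; rewrite f's_t.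
  + have /orP[//|c] := cov (f t).
    by have := basin_t_trap c (xs t); rewrite f't_s.
have stc : fconnect f s t.
  exact: connect_trans (fconnect1 _ _) (stopped_connect fs).
have tsc : fconnect f t s.
  exact: connect_trans (fconnect1 _ _) (stopped_connect ft).
split=> //; apply/forallP => x; have /orP[] := cov x => /stopped_connect //.
by move/connect_trans; apply.
Qed.

(** An edge from one root into the other tree would connect the roots; edges back into the own trees
    make both trees traps. *)
Lemma two_cyclesE :
  two_cycles phi s t = [&& covered, fconnect f' (f s) s & fconnect f' (f t) t].
Proof.
apply/and5P/and3P => [[/forallP xst ss tt sNt tNs]|[/forallP cov fs ft]].
- have cov x : fconnect f' x s || fconnect f' x t.
    by apply: covered_of_connect.
  split; first by apply/forallP.
  + have /orP[//|c] := cov (f s); case/negP: sNt.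
    exact: connect_trans (fconnect1 _ _) (stopped_connect c).
  + have /orP[c|//] := cov (f t); case/negP: tNs.
    exact: connect_trans (fconnect1 _ _) (stopped_connect c).
split; [|exact: stopped_connect|exact: stopped_connect| |].
- apply/forallP => x.
  by case/orP: (cov x) => /stopped_connect -> //; rewrite orbT.
- by apply/negP => /(basin_s_trap fs); rewrite f's_t.
- by apply/negP => /(basin_t_trap ft); rewrite f't_s.
Qed.

End Stopped.

Lemma fconnect_eqf (f f' : V -> V) : f =1 f' -> fconnect f =2 fconnect f'.
Proof. by move=> e x y; apply: eq_fconnect. Qed.

Lemma coveredE s t phi psi : stopped s t phi =1 stopped s t psi ->
  covered s t phi = covered s t psi.
Proof.
by move=> e; apply: eq_forallb => x; rewrite !(fconnect_eqf e).
Qed.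

(* Removing the edges out of s and t leaves the same pair of trees, rooted at
   s and t, in both cases: the new edges exchange the trees for a common cycle
   and stay inside them for two cycles. The total weight of the edges from s
   into one tree is opposite to that into the other one, and likewise for t. *)
Lemma offdiag_sum (g h : V -> L -> R) s t : s != t ->
  (forall x, \sum_l g x l = 0) -> (forall x, \sum_l h x l = 0) ->
  \sum_(phi | same_cycle phi s t) g s (phi s) * h t (phi t) =
  \sum_(phi | two_cycles phi s t) g s (phi s) * h t (phi t).
Proof.
move=> st g0 h0; have ts : t != s by rewrite eq_sym.
(* The averaging below cancels factors [#|L|]. If [L] is empty, no [phi] exists, since [phi s] would
   be an element of [L]. *)
have [/eqP|L0] := eqVneq #|L|%:R (0 : R).
  rewrite pnatr_eq0 => /eqP L0; have noL (l : L) : False.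
    by have := fintype0 l L0.
  by rewrite !big1 // => phi _; case: (noL (phi s)).
apply/eqP; rewrite -subr_eq0 big_mkcond [X in _ - X]big_mkcond -sumrB.
pose G phi := (if same_cycle phi s t then g s (phi s) * h t (phi t) else 0) -
  (if two_cycles phi s t then g s (phi s) * h t (phi t) else 0).
rewrite -[X in X == 0]/(\sum_phi G phi).
rewrite -(mulrI_eq0 _ (mulfI L0)) -(sum_upd G s).
rewrite -(mulrI_eq0 _ (mulfI L0)) -(sum_upd _ t); apply/eqP.
rewrite big1// => phi _; set f' := stopped s t phi.
pose A x : R := (fconnect f' x s)%:R; pose B x : R := (fconnect f' x t)%:R.
have updE m l : G (upd (upd phi t m) s l) = (covered s t phi)%:R *
    ((g s l * B (nx s l)) * (h t m * A (nx t m)) -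
     (g s l * A (nx s l)) * (h t m * B (nx t m))).
  set psi := upd _ _ _.
  have psiE : stopped s t psi =1 f'.
    by move=> x; rewrite stopped_upds stopped_updt.
  have fs : fmap psi s = nx s l by rewrite /fmap /psi /upd ffunE eqxx.
  have ft : fmap psi t = nx t m.
    by rewrite /fmap /psi /upd !ffunE (negbTE ts) eqxx.
  have ps : psi s = l by rewrite ffunE eqxx.
  have pt : psi t = m by rewrite !ffunE (negbTE ts) eqxx.
  rewrite /G same_cycleE// two_cyclesE// (coveredE psiE).
  rewrite !(fconnect_eqf psiE) fs ft ps pt /A /B.
  case: covered; case: (fconnect f' (nx s l) s); case: (fconnect f' (nx s l) t);
  case: (fconnect f' (nx t m) s); case: (fconnect f' (nx t m) t) => /=; ring.
have [cov|ncov] := boolP (covered s t phi); last first.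
  rewrite big1 // => m _; rewrite big1 // => l _.
  by rewrite updE (negbTE ncov) mul0r.
have ABE x : A x = 1 - B x.
  rewrite /A /B; have := forallP cov x; rewrite -/f'.
  case: (boolP (fconnect f' x s)) => [/(stopped_excl st) ->|_ /= ->].
    by rewrite subr0.
  by rewrite subrr.
have gA (k : V -> L -> R) x : \sum_l k x l = 0 ->
    \sum_l k x l * A (nx x l) = - \sum_l k x l * B (nx x l).
  move=> k0; under eq_bigr => l _ do rewrite ABE mulrBr mulr1.
  by rewrite sumrB k0 sub0r.
under eq_bigr => m _ do under eq_bigr => l _ do rewrite updE cov mul1r.
under eq_bigr => m _ do rewrite sumrB -!mulr_suml.
by rewrite sumrB -!mulr_sumr (gA g)// (gA h)// mulrN mulNr subrr.
Qed.

Definition nrooted s : R := \sum_phi (rooted phi s)%:R.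

Lemma rooted_upd phi s l : rooted (upd phi s l) s = rooted phi s.
Proof.
suff H (psi psi' : {ffun V -> L}) : (forall x, x != s -> psi x = psi' x) ->
    rooted psi s -> rooted psi' s.
  by apply/idP/idP; apply: H => x xs; rewrite ?/upd ?ffunE ?(negbTE xs).
move=> e /forallP r; apply/forallP => x.
have := iter_findex (r x); move: (findex _ _ _) => n.
elim: n x => [|n IH] x; first by move=> /= ->.
have [-> //|xs] := eqVneq x s.
rewrite iterSr => /IH; apply: connect_trans.
by rewrite /fmap (e _ xs); exact: fconnect1.
Qed.

(** Whether [phi] is rooted at [s] does not depend on the letter [phi s], which therefore averages
    out on its own. *)
Lemma diag_sum (G : V -> L -> R) s : #|L|%:R *
  \sum_(phi | rooted phi s) G s (phi s) = nrooted s * \sum_l G s l.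
Proof.
rewrite big_mkcond /=.
rewrite -(sum_upd (fun phi => if rooted phi s then G s (phi s) else 0) s).
rewrite mulr_suml; apply: eq_bigr => phi _; rewrite mulr_sumr.
apply: eq_bigr => l _; rewrite rooted_upd ffunE eqxx.
by case: rooted; rewrite ?mul1r ?mul0r.
Qed.

(* The paper's $gh(\mathcal D_1) - gh(\mathcal D_2)$, summed over pairs of
   vertices on cycles. *)
Lemma cycle_pairs_sum (g h : V -> L -> R) :
  (forall x, \sum_l g x l = 0) -> (forall x, \sum_l h x l = 0) ->
  #|L|%:R * (\sum_phi \sum_s \sum_(t | same_cycle phi s t)
       g s (phi s) * h t (phi t) -
     \sum_phi \sum_s \sum_(t | two_cycles phi s t) g s (phi s) * h t (phi t)) =
  \sum_s nrooted s * \sum_l g s l * h s l.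
Proof.
move=> g0 h0; rewrite exchange_big [X in _ - X]exchange_big -sumrB mulr_sumr.
apply: eq_bigr => s _; rewrite -(diag_sum (fun s l => g s l * h s l)).
congr (_ * _).
under eq_bigr => phi _ do rewrite big_mkcond.
rewrite exchange_big (bigD1 s) //=.
under [X in _ - X]eq_bigr => phi _ do rewrite big_mkcond.
rewrite [X in _ - X]exchange_big /= [X in _ - X](bigD1 s) //=.
rewrite [X in _ - (X + _)]big1 => [|phi _]; last first.
  by rewrite /two_cycles connect0 !andbF.
(* Off the diagonal the pairs on a common cycle and those on two cycles cancel; on it only the first
   kind occurs. *)
rewrite add0r -addrA (_ : _ - _ = 0) ?addr0; last first.
  rewrite -sumrB big1// => t ts; rewrite -!big_mkcond /=.
  by rewrite offdiag_sum ?subrr// eq_sym.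
rewrite -big_mkcond; apply: eq_bigl => phi.
by rewrite /same_cycle connect0 andbT.
Qed.

End FunctionalGraphs.

(** * Sums over the functional subgraphs of the final component *)

Lemma n_comp_imset (V : finType) (e : rel V) (a : {set V}) :
  connect_sym e -> fingraph.closed e a ->
  n_comp e a = #|[set fingraph.root e x | x in a]%SET|.
Proof.
move=> sym_e cl_a; rewrite /n_comp_mem; apply: eq_card => x; rewrite inE /=.
apply/andP/imsetP => [[/eqP xr xa]|[y ya ->]]; first by exists x.
split; first exact: roots_root.
by rewrite -(closed_connect cl_a (connect_root e y)).
Qed.

Section Bridge.
Variables (R : realType) (T : transducer R).
Hypotheses (hcomplete : complete T) (hdet : deterministic T).

Definition next (s : state T) (l : alphI T) : state T := xchoose (hcomplete s l).

Definition edge_at (s : state T) (l : alphI T) : edge T := (s, next s l, l).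

Lemma edge_at_trans s l : edge_at s l \in trans T.
Proof. exact: (xchooseP (hcomplete s l)). Qed.

Lemma transE e : e \in trans T -> e = edge_at (src e) (letter e).
Proof.
case: e => [[s t] l] eT; rewrite /edge_at /src /letter /=; congr (_, _, _).
exact: hdet eT (edge_at_trans s l).
Qed.

Lemma reachable_foldl s w : reachable s (foldl next s w).
Proof.
elim: w s => [|l w IH] s /=; first exact: connect0.
apply: connect_trans (IH _); apply: connect1.
by apply/existsP; exists (edge_at s l); rewrite edge_at_trans !eqxx.
Qed.

Lemma reachable_word s t : reachable s t -> exists w, foldl next s w = t.
Proof.
case/connectP=> p; elim: p s => [|u p IH] s /=; first by move=> _ ->; exists [::].
case/andP=> /existsP[e]; case/and3P=> eT /eqP se /eqP te pu tu.
have [w wt] := IH _ pu tu.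
exists (letter e :: w) => /=; suff -> : next s (letter e) = u by [].
by rewrite -te [in RHS](transE eT) -se.
Qed.

Lemma final_statesP s :
  reflect (forall t, reachable t s) (s \in final_states T).
Proof.
by apply: (iffP idP); rewrite inE => H; [apply/forallP|apply/forallP].
Qed.

Lemma next_final s l : s \in final_states T -> next s l \in final_states T.
Proof.
move=> /final_statesP fs; apply/final_statesP => t.
exact: connect_trans (fs t) (reachable_foldl s [:: l]).
Qed.

Definition fstate : finType := {s : state T | s \in final_states T}.

Definition fnext (x : fstate) (l : alphI T) : fstate :=
  exist _ (next (val x) l) (next_final l (valP x)).

Implicit Types (phi : {ffun fstate -> alphI T}) (x y z : fstate).

Lemma fstate_final x : val x \in final_states T.
Proof. exact: valP. Qed.

Definition fedge phi x : edge T := edge_at (val x) (phi x).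

Definition digraph phi : {set edge T} := [set fedge phi x | x : fstate]%SET.

Lemma fedge_inj phi : injective (fedge phi).
Proof. by move=> x y [/val_inj]. Qed.

Lemma mem_digraph phi x : fedge phi x \in digraph phi.
Proof. exact: imset_f. Qed.

Lemma digraph_inj : injective digraph.
Proof.
move=> phi psi e; apply/ffunP => x.
have := mem_digraph phi x; rewrite e => /imsetP[y _ []].
by move=> /val_inj -> _ ->.
Qed.

Lemma digraph_out phi x :
  [set e in digraph phi | src e == val x]%SET = [set fedge phi x]%SET.
Proof.
apply/setP => e; rewrite !inE; apply/andP/eqP => [[/imsetP[y _ ->]]|->].
  by move=> /eqP /val_inj ->.
by rewrite mem_digraph.
Qed.

(** The edges out of a final state correspond to the letters by [transE] and never leave the final
    component by [next_final]; so one outgoing edge per state is one letter per state. *)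
Lemma functional_subgraphsE k : functional_subgraphs T k =
  [set digraph phi | phi : {ffun fstate -> alphI T}
     & n_comp (weak_adj (digraph phi)) (final_states T) == k]%SET.
Proof.
apply/setP => D; apply/idP/imsetP => [|[phi]].
  rewrite inE => /and3P[/fintype.subsetP DF /forallP out nk].
  have outx (x : fstate) : exists e, [set e in D | src e == val x]%SET == [set e]%SET.
    suff /cards1P[e ->] : #|[set e in D | src e == val x]%SET| == 1%N by exists e.
    by have /implyP := out (val x); apply; apply: valP.
  pose phi := [ffun x : fstate => letter (xchoose (outx x))].
  have outE x : [set e in D | src e == val x]%SET = [set fedge phi x]%SET.
    have /eqP := xchooseP (outx x); set e := xchoose _ => De.
    have : e \in [set e in D | src e == val x]%SET by rewrite De set11.
    rewrite inE => /andP[/DF]; rewrite inE => /and3P[eT _ _] /eqP se.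
    by rewrite De /fedge ffunE -/e -se -transE.
  suff DE : D = digraph phi by exists phi => //; rewrite inE -DE.
  apply/setP => e; apply/idP/imsetP => [eD|[x _ ->]]; last first.
    by have := set11 (fedge phi x); rewrite -outE inE => /andP[].
  have := DF _ eD; rewrite inE => /and3P[eT sF _].
  exists (exist _ (src e) sF) => //; apply/set1P; rewrite -outE inE eD.
  by rewrite eqxx.
rewrite inE => nk ->; rewrite inE nk andbT; apply/andP; split.
  apply/fintype.subsetP => _ /imsetP[x _ ->]; rewrite inE edge_at_trans (valP x).
  by rewrite /tgt /= next_final ?(valP x).
apply/forallP => s; apply/implyP => sF.
by rewrite -[s]/(val (exist (fun s => s \in final_states T) s sF)) digraph_out cards1.
Qed.

Lemma sum_functional_subgraphs k (F : {set edge T} -> R) :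
  \sum_(D in functional_subgraphs T k) F D =
  \sum_(phi | n_comp (weak_adj (digraph phi)) (final_states T) == k)
    F (digraph phi).
Proof.
rewrite functional_subgraphsE big_imset /=; last by move=> *; apply: digraph_inj.
by apply: eq_bigl => phi; rewrite inE.
Qed.

Section OneDigraph.
Variable phi : {ffun fstate -> alphI T}.
Let f := fmap fnext phi.
Let w := weak_adj (digraph phi).

Lemma adjP s t :
  reflect (exists x, s = val x /\ t = val (f x)) (adj (digraph phi) s t).
Proof.
apply: (iffP existsP) => [[e /and3P[/imsetP[x _ ->] /eqP<- /eqP<-]]|[x [-> ->]]].
  by exists x.
by exists (fedge phi x); rewrite mem_digraph !eqxx.
Qed.

Lemma weak_adj_sym : connect_sym w.
Proof. by apply: sym_connect_sym => s t; rewrite /w /weak_adj orbC. Qed.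

Lemma weak_adj_closed   : fingraph.closed w (final_states T).
Proof.
by move=> s t /orP[/adjP[x [-> ->]]|/adjP[x [-> ->]]]; rewrite !fstate_final.
Qed.

Lemma fconnect_weak x y : fconnect f x y -> connect w (val x) (val y).
Proof.
move=> /(fconnect_ind (P := fun z => connect w (val x) (val z))); apply=> // z.
move=> /connect_trans; apply; apply: connect1; apply/orP; left.
by apply/adjP; exists z.
Qed.

(** Orbits merge: a step along an edge only shifts an orbit, and a step against an edge moves the
    meeting point on by one. *)
Lemma weak_fconnect x y : connect w (val x) (val y) ->
  exists2 z, fconnect f x z & fconnect f y z.
Proof.
case/connectP=> p; elim: p x => [|t p IH] x /=.
  by move=> _ /val_inj ->; exists x.
case/andP=> /orP[/adjP[x' [/val_inj <- ->]]|/adjP[x' [-> /val_inj]]].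
  move=> xp yp; have [z xz yz] := IH _ xp yp; exists z => //.
  exact: connect_trans (fconnect1 _ _) xz.
move=> x'x pp yp; have [z xz yz] := IH _ pp yp.
exists (f z); last exact: connect_trans yz (fconnect1 _ _).
rewrite x'x -(iter_findex xz) -iterS iterSr; exact: fconnect_iter.
Qed.

(** [fconnect] is reflexive, hence the start at [f x] instead of [x]. *)
Definition on_cycle x := fconnect f (f x) x.

Lemma on_cycle_back x y : on_cycle x -> fconnect f x y -> fconnect f y x.
Proof.
move=> xx; move/(fconnect_ind (P := fun z => fconnect f z x)); apply=> // z.
move=> zx; have [->//|zNx] := eqVneq z x.
have := iter_findex zx; case: (findex _ _ _) => [/=/eqP|n].
  by rewrite (negbTE zNx).
by rewrite iterSr => <-; apply: fconnect_iter.
Qed.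

Lemma on_cycle_connect x y : on_cycle x -> fconnect f x y -> on_cycle y.
Proof.
move=> xx xy; apply: connect_trans (xy).
by apply: on_cycle_back => //; apply: connect_trans (xy) (fconnect1 _ _).
Qed.

Lemma weak_on_cycle x s : on_cycle s -> connect w (val x) (val s) ->
  fconnect f x s.
Proof.
move=> ss /weak_fconnect[z xz sz]; apply: connect_trans xz _.
exact: on_cycle_back.
Qed.

Let n_compE : n_comp w (final_states T) =
  #|[set fingraph.root w (val x) | x : fstate]%SET|.
Proof.
rewrite (n_comp_imset weak_adj_sym weak_adj_closed); congr #|pred_of_set _|.
apply/setP => u; apply/imsetP/imsetP => [[s sF ->]|[x _ ->]].
  by exists (exist _ s sF).
by exists (val x) => //; apply: valP.
Qed.

(** A component contains exactly one cycle, on which all its orbits end; with a single component a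
    cyclic vertex is therefore reached from everywhere. *)
Lemma one_comp_on_cycle s :
  (n_comp w (final_states T) == 1%N) && on_cycle s = rooted fnext phi s.
Proof.
apply/andP/forallP => [[]|rs].
  rewrite n_compE => /cards1P[u ru] ss x; apply: weak_on_cycle => //.
  apply/(fingraph.rootP weak_adj_sym).
  have H y : fingraph.root w (val y) = u by apply/set1P; rewrite -ru; apply/imsetP; exists y.
  by rewrite !H.
split; last exact: rs.
rewrite n_compE; apply/cards1P; exists (fingraph.root w (val s)).
apply/setP => u; apply/imsetP/set1P => [[x _ ->]|->].
  by apply/(fingraph.rootP weak_adj_sym)/fconnect_weak/rs.
by exists s.
Qed.

(** Cyclic vertices of the same component reach each other, so [s] and [t] represent different
    components; if there are only two, every vertex reaches one of them. *)
Lemma two_comp_on_cycle s t :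
  [&& n_comp w (final_states T) == 2%N, on_cycle s, on_cycle t
    & ~~ fconnect f s t] = two_cycles fnext phi s t.
Proof.
have neq_root : on_cycle t -> ~~ fconnect f s t ->
    fingraph.root w (val s) != fingraph.root w (val t).
  move=> tt; apply: contraNN => /eqP/(fingraph.rootP weak_adj_sym).
  exact: weak_on_cycle.
apply/and4P/and5P => [[]|[/forallP cov ss tt st ts]]; rewrite n_compE.
  move=> /cards2P[u [v [uv E]]] ss tt st; split=> //; last first.
    by apply: contra st; apply: on_cycle_back.
  have H y : fingraph.root w (val y) \in [set u; v]%SET by rewrite -E; apply/imsetP; exists y.
  apply/forallP => x.
  suff /orP[/eqP|/eqP] : (fingraph.root w (val x) == fingraph.root w (val s)) ||
      (fingraph.root w (val x) == fingraph.root w (val t)).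
  - by move/(fingraph.rootP weak_adj_sym)/weak_on_cycle => ->.
  - by move/(fingraph.rootP weak_adj_sym)/weak_on_cycle => ->; rewrite ?orbT.
  move: (H s) (H t) (H x) (neq_root tt st); rewrite !inE.
  by do 3!case/orP=> /eqP ->; rewrite ?eqxx ?orbT.
split=> //; apply/cards2P.
exists (fingraph.root w (val s)), (fingraph.root w (val t)).
split; first exact: neq_root.
apply/setP => u; rewrite !inE; apply/imsetP/orP => [[x _ ->]|].
  by case/orP: (cov x) => /fconnect_weak/(fingraph.rootP weak_adj_sym) ->;
    rewrite eqxx; [left|right].
by case=> /eqP ->; [exists s|exists t].
Qed.

Definition cycle_of x : {set edge T} :=
  [set fedge phi y | y in fconnect f x]%SET.

Lemma walk_digraph x p t : walk (digraph phi) (val x) p t ->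
  p = map (fedge phi) (traject f x (size p)) /\ t = val (iter (size p) f x).
Proof.
elim: p x => [|e p IH] x /=; first by move/eqP ->.
case/and3P=> /imsetP[y _ ->] /eqP /val_inj -> /(IH (f x))[<- ->].
by rewrite -iterSr.
Qed.

Lemma walk_traject x n :
  walk (digraph phi) (val x) (map (fedge phi) (traject f x n))
    (val (iter n f x)).
Proof.
elim: n x => [|n IH] x; first exact: eqxx.
rewrite iterSr; apply/and3P; split; [exact: mem_digraph|exact: eqxx|exact: IH].
Qed.

Lemma src_fedge (s : seq fstate) : map (@src R T) (map (fedge phi) s) = map val s.
Proof. by rewrite -map_comp. Qed.

(** A walk in a functional digraph is an orbit segment, and a nonempty closed one covers the whole
    orbit. For the converse, [orbit] lists a cycle without repetition. *)
Lemma cyclesE :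
  cycles (digraph phi) = [set cycle_of x | x : fstate & on_cycle x]%SET.
Proof.
apply/setP => C; rewrite inE; apply/asboolP/imsetP => [|[x]].
  move=> [s [p [p0 wp up ->]]].
  have [x sE] : exists x, s = val x.
    by case: p p0 wp {up} => //= e p _ /and3P[/imsetP[x _ ->] /eqP <- _]; exists x.
  move: wp; rewrite sE => /walk_digraph[pE /val_inj fx].
  have fxx : on_cycle x.
    case: (size p) fx (size_eq0 p) => [|n]; first by rewrite (negbTE p0).
    by rewrite iterSr /on_cycle => {2}-> _; apply: fconnect_iter.
  exists x; rewrite ?inE//; apply/setP => e; rewrite inE {1}pE.
  apply/mapP/imsetP => [[y /trajectP[i _ ->] ->]|[y xy ->]].
    by exists (iter i f x) => //; apply: fconnect_iter.
  exists y => //; rewrite -(iter_findex xy); apply/loopingP.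
  rewrite /looping -fx; case: (p) p0 => //= *; exact: mem_head.
rewrite inE => fxx ->; exists (val x), (map (fedge phi) (fingraph.orbit f x)).
have ox : iter (order f x) f x = x by apply/(orbitPcycle 2 4).
split.
- by rewrite -size_eq0 size_map size_orbit -lt0n order_gt0.
- by have := walk_traject x (order f x); rewrite ox.
- by rewrite src_fedge map_inj_uniq ?orbit_uniq//; apply: val_inj.
apply/setP => e; rewrite inE; apply/imsetP/mapP => [[y xy ->]|[y xy ->]].
  by exists y; rewrite // -fconnect_orbit.
by exists y; rewrite // inE fconnect_orbit.
Qed.

Lemma csum_cycle_of (g : edge T -> R) x :
  csum g (cycle_of x) = \sum_(y | fconnect f x y) g (fedge phi y).
Proof. by rewrite /csum big_imset //= => y z _ _; apply: fedge_inj. Qed.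

Lemma cycle_of_eq x y : on_cycle x ->
  (cycle_of x == cycle_of y) = on_cycle y && fconnect f x y.
Proof.
move=> xx; apply/eqP/andP => [E|[yy xy]].
  have : fedge phi x \in cycle_of y by rewrite -E imset_f ?inE.
  case/imsetP=> z yz /fedge_inj zx; subst z.
  have : fedge phi y \in cycle_of x by rewrite E imset_f ?inE.
  case/imsetP=> z xz /fedge_inj zy; subst z.
  by split=> //; apply: on_cycle_connect xz.
have yx : fconnect f y x by exact: on_cycle_back.
apply/setP => e; apply/imsetP/imsetP => -[z]; rewrite inE => cz ->; exists z;
  rewrite // inE; exact: connect_trans cz.
Qed.

(** Distinct cycles are disjoint and an edge is determined by its source, so the pairs of a cycle
    and one of its edges are the cyclic vertices. [F] sees the cycle because the second factor in
    the product sums depends on it. *)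
Lemma sum_cycles (F : {set edge T} -> edge T -> R) :
  \sum_(C in cycles (digraph phi)) \sum_(e in C) F C e =
  \sum_(x | on_cycle x) F (cycle_of x) (fedge phi x).
Proof.
rewrite (partition_big cycle_of (mem (cycles (digraph phi)))) /=; last first.
  by move=> x xx; rewrite cyclesE imset_f ?inE.
apply: eq_bigr => C; rewrite cyclesE => /imsetP[x]; rewrite inE => xx ->.
rewrite big_imset /=; last by move=> y z _ _; apply: fedge_inj.
apply: eq_big => [y|y xy].
  rewrite eq_sym cycle_of_eq// inE; case: (boolP (fconnect f x y)).
    by move=> xy; rewrite (on_cycle_connect xx xy).
  by rewrite !andbF.
rewrite inE in xy; congr F; apply/eqP; rewrite cycle_of_eq// xy andbT.
exact: on_cycle_connect xy.
Qed.

End OneDigraph.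

Let f phi := fmap fnext phi.

Lemma sumD1E g :
  sumD1 g = \sum_phi \sum_(x | rooted fnext phi x) g (fedge phi x).
Proof.
rewrite /sumD1 sum_functional_subgraphs big_mkcond; apply: eq_bigr => phi _.
rewrite (sum_cycles phi (fun _ e => g e)).
rewrite -(eq_bigl _ _ (one_comp_on_cycle phi)).
by case: eqP => //= _; rewrite big_pred0.
Qed.

Lemma prodD1E g h : prodD1 g h = \sum_phi \sum_x
  \sum_(y | same_cycle fnext phi x y) g (fedge phi x) * h (fedge phi y).
Proof.
rewrite /prodD1 sum_functional_subgraphs big_mkcond; apply: eq_bigr => phi _.
under eq_bigr => C _ do rewrite mulr_suml.
rewrite (sum_cycles phi (fun C e => g e * csum h C)).
under [RHS]eq_bigr => x _ do under eq_bigl => y do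
  rewrite /same_cycle -(one_comp_on_cycle phi).
case: eqP => /= _; last by rewrite big1// => x _; rewrite big_pred0.
rewrite big_mkcond; apply: eq_bigr => x _.
case: on_cycle => /=; last by rewrite big_pred0.
by rewrite csum_cycle_of mulr_sumr.
Qed.

Lemma prodD2E g h : prodD2 g h = \sum_phi \sum_x
  \sum_(y | two_cycles fnext phi x y) g (fedge phi x) * h (fedge phi y).
Proof.
rewrite /prodD2 sum_functional_subgraphs big_mkcond; apply: eq_bigr => phi _.
under [RHS]eq_bigr => x _ do under eq_bigl => y do
  rewrite -(two_comp_on_cycle phi).
case: eqP => /= _; last by rewrite big1// => x _; rewrite big_pred0.
transitivity (\sum_(C1 in cycles (digraph phi)) \sum_(e in C1)
    g e * \sum_(C2 in cycles (digraph phi) | C2 != C1) csum h C2).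
  by apply: eq_bigr => C1 _; rewrite -mulr_suml mulr_sumr.
rewrite (sum_cycles phi (fun C e =>
   g e * \sum_(C2 in cycles (digraph phi) | C2 != C) csum h C2)).
rewrite big_mkcond; apply: eq_bigr => x _.
case: (boolP (on_cycle phi x)) => xx /=; last by rewrite big_pred0.
(* The condition on the second cycle goes into the summand, so that [sum_cycles] applies again; a
   different cycle then means a cyclic vertex not reached from [x]. *)
rewrite -mulr_sumr; congr (_ * _); rewrite big_mkcondr /=.
transitivity (\sum_(C2 in cycles (digraph phi)) \sum_(e in C2)
    (if C2 != cycle_of phi x then h e else 0)).
  by apply: eq_bigr => C2 _; case: ifP => // _; rewrite big1.
rewrite (sum_cycles phi (fun C e => if C != cycle_of phi x then h e else 0)).
rewrite -big_mkcondr; apply: eq_bigl => y.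
by rewrite eq_sym cycle_of_eq//; case: on_cycle.
Qed.

Notation K := (#|{: alphI T}|%:R : R).

(** Each term marks a vertex [x] on the cycle; by [diag_sum] its outgoing edge is independent of the
    tree rooted at [x]. The factor [K] stands for the free letter at [x] that [nrooted] counts as
    well. *)
Lemma sumD1_nrooted g : K * sumD1 g =
  \sum_(x : fstate) nrooted R fnext x * \sum_l g (edge_at (val x) l).
Proof.
rewrite sumD1E; under eq_bigr => phi _ do rewrite big_mkcond.
rewrite exchange_big mulr_sumr; apply: eq_bigr => x _.
rewrite -big_mkcond -(diag_sum fnext (fun x l => g (edge_at (val x) l))).
by [].
Qed.

Lemma prodD_nrooted g h :
  (forall s, \sum_l g (edge_at s l) = 0) ->
  (forall s, \sum_l h (edge_at s l) = 0) ->
  K * (prodD1 g h - prodD2 g h) =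
  \sum_(x : fstate) nrooted R fnext x *
    \sum_l g (edge_at (val x) l) * h (edge_at (val x) l).
Proof.
move=> g0 h0; rewrite prodD1E prodD2E.
exact: (cycle_pairs_sum fnext (g := fun x l => g (edge_at (val x) l))
  (h := fun x l => h (edge_at (val x) l)) (fun x => g0 (val x))
  (fun x => h0 (val x))).
Qed.

End Bridge.

(** * Invariance of cycle sums under coboundaries *)

Section Gauge.
Variables (R : realType) (T : transducer R).

Definition coboundary (u : state T -> R) (e : edge T) : R := u (tgt e) - u (src e).

Lemma walk_coboundary D u s p t : @walk R T D s p t ->
  \sum_(e <- p) coboundary u e = u t - u s.
Proof.
elim: p s => [|e p IH] s /=; first by move=> /eqP ->; rewrite big_nil subrr.
case/and3P=> _ /eqP <- /IH; rewrite big_cons => ->.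
by rewrite /coboundary addrC subrKA.
Qed.

Lemma csum_gauge D C (g : edge T -> R) u : C \in cycles D ->
  csum (fun e => g e + coboundary u e) C = csum g C.
Proof.
rewrite inE => /asboolP[s [p [_ wp up ->]]].
rewrite /csum big_split /= [X in _ + X](_ : _ = 0) ?addr0//.
(* The sources along a cycle are distinct, hence so are its edges, and the sum over the set is the
   sum along the closed walk, which telescopes. *)
have -> : \sum_(e in [set e in p]%SET) coboundary u e = \sum_(e <- p) coboundary u e.
  rewrite big_uniq ?(map_uniq up)//; by apply: eq_bigl => e; rewrite inE.
by rewrite (walk_coboundary u wp) subrr.
Qed.

Lemma sumD1_gauge (g : edge T -> R) u :
  sumD1 (fun e => g e + coboundary u e) = sumD1 g.
Proof.
by apply: eq_bigr => D _; apply: eq_bigr => C CD; rewrite (csum_gauge _ _ CD).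
Qed.

Lemma prodD1_gauge (g h : edge T -> R) u v :
  prodD1 (fun e => g e + coboundary u e) (fun e => h e + coboundary v e) =
  prodD1 g h.
Proof.
by apply: eq_bigr => D _; apply: eq_bigr => C CD; rewrite !(csum_gauge _ _ CD).
Qed.

Lemma prodD2_gauge (g h : edge T -> R) u v :
  prodD2 (fun e => g e + coboundary u e) (fun e => h e + coboundary v e) =
  prodD2 g h.
Proof.
apply: eq_bigr => D _; apply: eq_bigr => C CD; apply: eq_bigr => C' /andP[CD' _].
by rewrite (csum_gauge _ _ CD) (csum_gauge _ _ CD').
Qed.

End Gauge.

(** * Additive functionals of a finite chain *)

Section FiniteChain.
Variables (R : realType) (L : finType) (n : nat) (nx : 'I_n -> L -> 'I_n).
Hypothesis L_gt0 : (0 < #|L|)%N.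
Notation K := (#|L|%:R : R).
Implicit Types (g h : 'I_n -> L -> R) (u v r : 'I_n -> R) (s : 'I_n).

Let K_gt0 : 0 < K. Proof. by rewrite ltr0n. Qed.
Let K_neq0 : K != 0. Proof. by rewrite gt_eqF. Qed.

Let sum_cst c : \sum_(l : L) c = K * c.
Proof. by rewrite sumr_const mulr_natl. Qed.

(** * The Poisson equation *)

Section Poisson.
Variable z : 'I_n.
Hypothesis reach : forall s, exists w, foldl nx s w = z.

(** Maximum principle: at a maximum of [v] the differences to the successors have one sign and sum
    0, so every successor is a maximum too; a word leads from there to [z]. *)
Lemma harmonic_le v : (forall s, \sum_l (v (nx s l) - v s) = 0) ->
  forall s, v s <= v z.
Proof.
move=> hv; pose m := [arg max_(i > z) v i]%O.
have vm s : v s <= v m by rewrite /m; case: arg_maxP => // i _; apply.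
suff -> : v z = v m by [].
have [w <-] := reach m.
have : v m = v m by []; move: {1 3}m; elim: w => //= l w IH s vs.
apply: IH; apply/eqP; rewrite -subr_eq0 -oppr_eq0 opprB -vs; apply/eqP.
have := hv s; move/eqP; rewrite -oppr_eq0 -sumrN psumr_eq0 => [|l' _].
  by move=> /allP/(_ l (mem_index_enum _)) /eqP; rewrite opprB.
by rewrite opprB vs subr_ge0.
Qed.

Lemma harmonic_const v : (forall s, \sum_l (v (nx s l) - v s) = 0) ->
  forall s, v s = v z.
Proof.
move=> hv s; apply/eqP; rewrite eq_le harmonic_le//= -lerN2.
apply: (harmonic_le (v := fun s => - v s)) => {}s.
by under eq_bigr do rewrite opprK addrC -opprB; rewrite sumrN hv oppr0.
Qed.

Variable rho : 'I_n -> R.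
Hypothesis rho1 : \sum_s rho s = 1.
Hypothesis rho_stat : forall u, \sum_s rho s * \sum_l (u (nx s l) - u s) = 0.

(** The matrix [A] is the unnormalized generator plus the rank one map given by the [rho]-average,
    and it preserves [rho]-averages. A kernel vector thus has average 0, so it is harmonic, hence
    constant, hence 0. The preimage of [- r] has average 0 as well, and the rank one part drops
    out. *)
Lemma poisson_solution r : \sum_s rho s * r s = 0 ->
  exists u, forall s, r s + \sum_l (u (nx s l) - u s) = 0.
Proof.
pose A : 'M[R]_n :=
  \matrix_(j, i) (\sum_l ((nx i l == j)%:R - (i == j)%:R) + rho j).
have AE (v : 'rV[R]_n) i : (v *m A) 0 i =
    \sum_l (v 0 (nx i l) - v 0 i) + \sum_j rho j * v 0 j.
  rewrite mxE; under eq_bigr do rewrite mxE mulrDr.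
  rewrite big_split /=; congr (_ + _); last by apply: eq_bigr => *; rewrite mulrC.
  under eq_bigr do rewrite mulr_sumr; rewrite exchange_big; apply: eq_bigr => l _.
  have pick k : \sum_j v 0 j * (k == j)%:R = v 0 k.
    rewrite (bigD1 k)//= eqxx mulr1 big1 ?addr0// => j jk.
    by rewrite eq_sym (negbTE jk) mulr0.
  by under eq_bigr do rewrite mulrBr; rewrite sumrB !pick.
have avgA (v : 'rV[R]_n) : \sum_i rho i * (v *m A) 0 i = \sum_j rho j * v 0 j.
  under eq_bigr do rewrite AE mulrDr.
  by rewrite big_split /= rho_stat add0r -mulr_suml rho1 mul1r.
have Au : A \in unitmx.
  rewrite -row_free_unit; apply: inj_row_free => v vA0.
  have c0 : \sum_j rho j * v 0 j = 0.
    by rewrite -avgA vA0; apply: big1 => i _; rewrite mxE mulr0.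
  have vz i : v 0 i = v 0 z.
    apply: (harmonic_const (v := fun i => v 0 i)) => {}i.
    by have := AE v i; rewrite vA0 c0 mxE addr0.
  apply/rowP => i; rewrite mxE vz -[LHS]mul1r -rho1 mulr_suml -[RHS]c0.
  by apply: eq_bigr => j _; rewrite vz.
move=> r0; pose v : 'rV[R]_n := (\row_i - r i) *m invmx A.
have vA : v *m A = \row_i - r i by rewrite /v mulmxKV.
exists (fun i => v 0 i) => s; have := AE v s; rewrite -avgA vA.
under [X in _ + X]eq_bigr do rewrite mxE mulrN.
by rewrite sumrN r0 oppr0 addr0 mxE => <-; rewrite subrr.
Qed.

End Poisson.

Variable s0 : 'I_n.

(* Words are read from right to left: the head of w is the last letter read. *)
Definition state_after (w : seq L) : 'I_n := foldr (fun l s => nx s l) s0 w.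

Fixpoint asum g (w : seq L) : R :=
  if w is l :: w' then asum g w' + g (state_after w') l else 0.

(** The head of a word is read last: unfolding averages over the last letter, conditionally on the
    letters before it. *)
Fixpoint avg (m : nat) (F : seq L -> R) : R :=
  if m is m'.+1 then avg m' (fun w => K^-1 * \sum_l F (l :: w)) else F [::].

Lemma eq_avg m F G : F =1 G -> avg m F = avg m G.
Proof.
elim: m F G => [|m IH] F G FG /=; first exact: FG.
by apply: IH => w; under eq_bigr do rewrite FG.
Qed.

Lemma eq_in_avg m F G : (forall w, size w = m -> F w = G w) ->
  avg m F = avg m G.
Proof.
elim: m F G => [|m IH] F G FG /=; first exact: FG.
apply: IH => w wm; congr (_ * _); apply: eq_bigr => l _.
by apply: FG; rewrite /= wm.
Qed.

Lemma avgD m F G : avg m (fun w => F w + G w) = avg m F + avg m G.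
Proof.
elim: m F G => //= m IH F G; rewrite -IH; apply: eq_avg => w.
by rewrite big_split mulrDr.
Qed.

Lemma avgZ m c F : avg m (fun w => c * F w) = c * avg m F.
Proof.
elim: m F => //= m IH F; rewrite -IH; apply: eq_avg => w.
by rewrite -mulr_sumr mulrCA.
Qed.

Lemma avg_cst m c : avg m (fun=> c) = c.
Proof.
elim: m => //= m IH; rewrite -[RHS]IH; apply: eq_avg => w.
by rewrite sum_cst mulKf.
Qed.

Lemma avgB m F G : avg m (fun w => F w - G w) = avg m F - avg m G.
Proof.
under eq_avg do rewrite -mulN1r.
by rewrite avgD avgZ mulN1r.
Qed.

Lemma ler_avg m F G : (forall w, size w = m -> F w <= G w) ->
  avg m F <= avg m G.
Proof.
elim: m F G => [|m IH] F G FG /=; first exact: FG.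
apply: IH => w wm; rewrite ler_pM2l ?invr_gt0//.
by apply: ler_sum => l _; apply: FG; rewrite /= wm.
Qed.

Lemma ler_norm_avg m F c : (forall w, `|F w| <= c) -> `|avg m F| <= c.
Proof.
move=> Fc; rewrite ler_norml -[c in - c](avg_cst m) -[c in _ && (_ <= c)](avg_cst m).
rewrite -mulN1r -avgZ; apply/andP; split; apply: ler_avg => w _;
by move: (Fc w); rewrite ?mulN1r ler_norml => /andP[].
Qed.

Lemma asum_gauge g u w :
  asum (fun s l => g s l + (u (nx s l) - u s)) w =
  asum g w + (u (state_after w) - u s0).
Proof.
elim: w => [|l w IH] /=; first by rewrite subrr addr0.
by rewrite IH; ring.
Qed.

Lemma asumB g c w : asum (fun s l => g s l - c) w = asum g w - c * (size w)%:R.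
Proof.
elim: w => [|l w IH] /=; first by rewrite mulr0 subr0.
by rewrite IH -addn1 natrD; ring.
Qed.

Definition balanced g := forall s, \sum_l g s l = 0.

(** Balance says that the increments have conditional mean 0, so [asum g] is a martingale. *)
Lemma avg_asum_balanced g m : balanced g -> avg m (asum g) = 0.
Proof.
move=> bg; elim: m => //= m IH; rewrite -[RHS]IH; apply: eq_avg => w.
by rewrite big_split /= sum_cst bg addr0 mulKf.
Qed.

(** Martingale increments are orthogonal: conditionally on the past, the mixed terms of the expanded
    product average to 0. *)
Lemma avg_asumM g h m : balanced g -> balanced h ->
  avg m (fun w => asum g w * asum h w) = avg m (asum (fun s l => g s l * h s l)).
Proof.
move=> bg bh; elim: m => [|m IH] /=; first by rewrite mulr0.
transitivity (avg m (fun w => asum g w * asum h w +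
    K^-1 * \sum_l g (state_after w) l * h (state_after w) l)).
  apply: eq_avg => w; under eq_bigr => l _ do rewrite mulrDl !mulrDr.
  rewrite !big_split /= sum_cst -mulr_sumr -mulr_suml bg bh mulr0 mul0r.
  by rewrite addr0 add0r mulrDr mulKf.
rewrite avgD IH -avgD; apply: eq_avg => w.
by rewrite big_split /= sum_cst mulrDr mulKf.
Qed.

Definition poisson g c u :=
  forall s, \sum_l (g s l - c) + \sum_l (u (nx s l) - u s) = 0.

(** Subtracting [c] and adding the coboundary of [u] makes [g] balanced, and the coboundary
    telescopes along the run. *)
Lemma avg_asum g c u m : poisson g c u ->
  avg m (asum g) = c * m%:R + (u s0 - avg m (fun w => u (state_after w))).
Proof.
move=> gu; have := @avg_asum_balanced
  (fun s l => (g s l - c) + (u (nx s l) - u s)) m.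
rewrite (@eq_in_avg _ _ (fun w => asum g w + u (state_after w) -
  (c * m%:R + u s0))); last by move=> w wm; rewrite asum_gauge asumB wm; ring.
rewrite avgB avgD avg_cst => H.
suff : avg m (asum g) + avg m (fun w => u (state_after w)) -
  (c * m%:R + u s0) = 0 by move=> /eqP; rewrite subr_eq0 => /eqP; lra.
by apply: H => s; rewrite big_split /= gu.
Qed.

Definition step u s : R := K^-1 * \sum_l u (nx s l).

Definition within m c u := forall s, m <= u s <= m + c.

Lemma step_within m c u : within m c u -> within m c (step u).
Proof.
move=> mu s; rewrite /step -(ler_pM2l K_gt0) -[X in _ && X](ler_pM2l K_gt0).
rewrite !(mulrA K) divff// mul1r -!sum_cst.
by apply/andP; split; apply: ler_sum => l _; have /andP[] := mu (nx s l).
Qed.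

Lemma iter_stepN k u s : iter k step (fun s => - u s) s = - iter k step u s.
Proof.
elim: k s => //= k IH s; rewrite /step -mulrN -sumrN; congr (_ * _).
by apply: eq_bigr => l _; rewrite IH.
Qed.

(** The single word [w] has probability [K ^- k] and contributes [u z]; all other words contribute
    at least [m]. *)
Lemma iter_step_ge k m u s z w : (forall s, m <= u s) ->
  size w = k -> foldl nx s w = z ->
  m + K^-1 ^+ k * (u z - m) <= iter k step u s.
Proof.
move=> mu <- {k} <-; elim: w s => [|l w IH] s /=; first by rewrite mul1r addrC subrK.
have mk k t : m <= iter k step u t.
  elim: k t => //= k IHk t; rewrite /step -(ler_pM2l K_gt0) mulrA divff// mul1r.
  by rewrite -sum_cst; apply: ler_sum.
rewrite /step -(ler_pM2l K_gt0) [leRHS]mulrA divff// mul1r exprS -mulrA mulrDr.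
rewrite mulVKf// -[K * m]sum_cst (bigD1 l)//= [leRHS](bigD1 l)//= addrAC.
by apply: lerD; [exact: IH|apply: ler_sum].
Qed.

Lemma normM_le (x y a b : R) : `|x| <= a -> `|y| <= b -> `|x * y| <= a * b.
Proof. by move=> xa yb; rewrite normrM ler_pM. Qed.

Lemma norm_mean_le (f : L -> R) c : (forall l, `|f l| <= c) ->
  `|K^-1 * \sum_l f l| <= c.
Proof.
move=> fc; rewrite normrM ger0_norm ?invr_ge0// -(ler_pM2l K_gt0) mulVKf//.
rewrite -[leRHS]sum_cst; apply: le_trans (ler_norm_sum _ _ _) _.
exact: ler_sum.
Qed.

(** * Correlation of a martingale with the last state *)

Section Martingale.
Variables (g : 'I_n -> L -> R) (c : R).
Hypotheses (gc : forall s l, `|g s l| <= c) (bg : balanced g).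

(** Taking out one letter replaces [u] by [step u] next to the earlier increments and leaves the
    product of the last increment with [u], which costs at most [c * d]. *)
Lemma avg_mart_step u b d k m : within b d u ->
  `|avg (k + m) (fun w => asum g w * u (state_after w)) -
    avg m (fun w => asum g w * iter k step u (state_after w))|
  <= k%:R * (c * d).
Proof.
elim: k u => [|k IH] u bu; first by rewrite add0n subrr normr0 mul0r.
have E : avg (k + m).+1 (fun w => asum g w * u (state_after w)) =
    avg (k + m) (fun w => asum g w * step u (state_after w)) +
    avg (k + m) (fun w => K^-1 * \sum_l g (state_after w) l *
                             (u (nx (state_after w) l) - b)).
  rewrite -avgD [LHS]/=; apply: eq_avg => w; rewrite /step mulrCA -mulrDr.
  (* By balance [u] may be shifted by [b], after which it lies between 0 and [d]. *)
  have gb : \sum_l g (state_after w) l * b = 0 by rewrite -mulr_suml bg mul0r.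
  congr (_ * _).
  apply: (@addIr _ (\sum_l g (state_after w) l * b)).
  rewrite [in LHS]gb addr0 mulr_sumr -!big_split /=.
  by apply: eq_bigr => l _; ring.
rewrite addSn E iterSr addrAC -natr1 mulrDl mul1r.
apply: le_trans (ler_normD _ _) (lerD (IH _ (step_within bu)) _).
apply: ler_norm_avg => w; apply: norm_mean_le => l; apply: normM_le => //.
have /andP[? ?] := bu (nx (state_after w) l).
by rewrite ger0_norm ?subr_ge0// lerBlDl.
Qed.

Variables (N : nat) (z : 'I_n).
Hypothesis N_gt0 : (0 < N)%N.
Hypothesis reachN : forall s, exists2 w, size w = N & foldl nx s w = z.

(** Doeblin's condition: from every state some word of length [N] leads to the same [z].
    [iter_step_ge] for [u] bounds the minimum from below, and for [- u] the maximum from above. *)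
Lemma iter_step_within u b d : within b d u ->
  exists b', within b' ((1 - K^-1 ^+ N) * d) (iter N step u).
Proof.
move=> bu; exists (b + K^-1 ^+ N * (u z - b)) => s; apply/andP.
have [w wN wz] := reachN s; split.
  by apply: iter_step_ge wN wz => t; case/andP: (bu t).
have := @iter_step_ge N (- (b + d)) (fun s => - u s) s z w.
rewrite iter_stepN => H.
have {}H : - (b + d) + K^-1 ^+ N * (- u z - - (b + d)) <= - iter N step u s.
  by apply: H wN wz => t; case/andP: (bu t) => _; rewrite lerN2.
rewrite -lerN2; apply: le_trans H; rewrite le_eqVlt; apply/orP; left.
by apply/eqP; ring.
Qed.

(* P^N contracts oscillations by the factor 1 - K^-N, and replacing u by P^N u
   costs N c d. *)
Lemma avg_mart_bounded u b d m : within b d u ->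
  `|avg m (fun w => asum g w * u (state_after w))| <= N%:R * c * K ^+ N * d.
Proof.
have Kq0 : 0 < K ^+ N by rewrite exprn_gt0.
move=> bu; have c0 : 0 <= c * d.
  have [l _] : exists l : L, true by move: L_gt0 => /card_gt0P[l _]; exists l.
  apply: mulr_ge0; first exact: le_trans (normr_ge0 _) (gc z l).
  by have /andP[/le_trans h1 /h1] := bu z; rewrite lerDl.
have [k le_mk] := ubnP m; elim: k => // k IH in m le_mk u b d bu c0 *.
have [mN|Nm] := ltnP m N.
  (* Fewer than [N] letters: all increments are taken out one by one, down to the empty word with
     sum 0. *)
  have := avg_mart_step m 0 bu; rewrite addn0 /= mul0r subr0 => /le_trans; apply.
  apply: (@le_trans _ _ (N%:R * (c * d))).
    by rewrite ler_wpM2r// ler_nat ltnW.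
  rewrite -!mulrA ler_wpM2l// [leRHS]mulrCA ler_peMl//.
  by rewrite exprn_ege1// ler1n.
have [b' bu'] := iter_step_within bu.
have lam0 : 0 <= 1 - K^-1 ^+ N.
  by rewrite subr_ge0 exprn_ile1// ?invr_ge0// invf_le1// ler1n.
have c0' : 0 <= c * ((1 - K^-1 ^+ N) * d) by rewrite mulrCA mulr_ge0.
have lt_k : (m - N < k)%N by move: le_mk N_gt0 Nm; lia.
have H1 := avg_mart_step N (m - N) bu; rewrite subnKC// in H1.
have H2 := IH _ lt_k _ _ _ bu' c0'.
set A := avg m _ in H1 *; set B := avg (m - N) _ in H1 H2.
rewrite -[A](subrK B); apply: le_trans (ler_normD _ _) _.
(* With [X = N c K^N] the bound reproduces itself: [N c d + (1 - K^-N) X d = X d]. *)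
apply: le_trans (lerD H1 H2) _; rewrite le_eqVlt; apply/orP; left; apply/eqP.
rewrite exprVn; field.
by rewrite expf_neq0.
Qed.

End Martingale.

(** * Characteristic function of a martingale *)

Section CharacteristicFunction.
Variables (g : 'I_n -> L -> R) (v b : 'I_n -> R) (c sigma2 : R).
Hypotheses (c_ge1 : 1 <= c) (gc : forall s l, `|g s l| <= c).
Hypotheses (vc : forall s, `|v s| <= c) (bc : forall s, `|b s| <= c).
Hypotheses (bg : balanced g) (sigma2_ge0 : 0 <= sigma2) (sigma2c : sigma2 <= c).
Hypothesis gv : poisson (fun s l => g s l * g s l) sigma2 v.
Variables (F D : R -> R).
Hypotheses (F1 : forall x, `|F x| <= 1) (D1 : forall x, `|D x| <= 1).
Hypothesis taylor : forall x y,
  `|F (x + y) - F x - y * D x + y ^+ 2 / 2 * F x| <= `|y| ^+ 3.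
Variable t : R.
Hypotheses (t_ge0 : 0 <= t) (t_le1 : t <= 1).
Let x := t ^+ 2 / 2.
Let rho := expR (- (x * sigma2)).

Let c_ge0 : 0 <= c. Proof. exact: le_trans c_ge1. Qed.
Let x_ge0 : 0 <= x. Proof. by rewrite divr_ge0// exprn_ge0. Qed.

Let normx : `|x| <= t ^+ 2 / 2. Proof. by rewrite ger0_norm. Qed.

Let cexp j k : (j <= k)%N -> c ^+ j <= c ^+ k.
Proof. by move=> jk; apply: ler_weXn2l. Qed.

Let texp j k : (j <= k)%N -> t ^+ k <= t ^+ j.
Proof. by move=> jk; apply: ler_wiXn2l. Qed.

Lemma rho_le1 : 0 <= rho <= 1.
Proof. by rewrite expR_ge0 -expR0 ler_expR oppr_le0 mulr_ge0. Qed.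

Lemma rho_approx : `|1 - x * sigma2 - rho| <= (x * sigma2) ^+ 2.
Proof.
rewrite /rho; set y := x * sigma2.
have y0 : 0 <= y by rewrite mulr_ge0.
have H1 : 1 - y <= expR (- y) by exact: expR_ge1Dx.
rewrite distrC ger0_norm ?subr_ge0// lerBlDr.
rewrite expRN; apply: (@le_trans _ _ (1 + y)^-1).
  by rewrite lef_pV2 ?posrE ?expR_gt0 ?expR_ge1Dx ?ltr_pwDl.
have y1 : 0 < 1 + y by rewrite ltr_pwDl.
rewrite -(ler_pM2r y1) mulVf ?gt_eqF//; nra.
Qed.

(** Reading one letter multiplies the corrected value [F a * (1 - x * v s)] by [rho] up to third
    order in [t]. [F] and [D] stand for a function and its derivative. Of the factor 5, 4 is for
    Taylor's formula and 1 for the passage from [1 - x v - x sigma2] to [rho (1 - x v)]. *)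
Lemma char_step a s :
  `|K^-1 * \sum_l F (a + t * g s l) * (1 - x * v (nx s l)) -
    rho * (F a * (1 - x * v s))| <= 5 * c ^+ 4 * t ^+ 3.
Proof.
pose main l := F a * (1 - x * v (nx s l) - x * g s l ^+ 2) + t * g s l * D a.
(* The first order term vanishes by balance, and the Poisson equation turns the mean of
   [v (nx s l) + g s l * g s l] into [v s + sigma2]. *)
have E : K^-1 * \sum_l main l = F a * (1 - x * v s - x * sigma2).
  have Hv : \sum_l (v (nx s l) + g s l * g s l) = K * (v s + sigma2).
    have := gv s; rewrite !sumrB !sum_cst big_split /= mulrDr => H; lra.
  apply: (mulfI K_neq0); rewrite mulVKf//.
  transitivity (\sum_l (F a + (- F a * x) * (v (nx s l) + g s l * g s l) +
      t * D a * g s l)); first by apply: eq_bigr => l _; rewrite /main; ring.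
  by rewrite !big_split /= sum_cst -!mulr_sumr Hv bg; ring.
have c3 : 0 <= t ^+ 3 by rewrite exprn_ge0.
have H1 : `|K^-1 * \sum_l F (a + t * g s l) * (1 - x * v (nx s l)) -
    K^-1 * \sum_l main l| <= 4 * c ^+ 4 * t ^+ 3.
  rewrite -mulrBr -sumrB; apply: norm_mean_le => l.
  set y := t * g s l; set u := v _.
  have -> : F (a + y) * (1 - x * u) - main l =
      (F (a + y) - F a - y * D a + y ^+ 2 / 2 * F a) * (1 - x * u) +
      (y * D a * - (x * u) + (x * (g s l * g s l) * F a) * (x * u)).
    by rewrite /main /y /x -/u; field.
  have yc : `|y| <= t * c by apply: normM_le => //; rewrite ger0_norm.
  have xu : `|x * u| <= t ^+ 2 / 2 * c by apply: normM_le; [exact: normx|exact: vc].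
  have B1 : `|(F (a + y) - F a - y * D a + y ^+ 2 / 2 * F a) * (1 - x * u)| <=
      (t * c) ^+ 3 * (2 * c).
    apply: normM_le.
      by apply: le_trans (taylor _ _) _; rewrite ler_pXn2r ?nnegrE ?mulr_ge0.
    apply: le_trans (ler_normB _ _) _; rewrite normr1.
    have : t ^+ 2 * c <= c by rewrite ler_piMl// exprn_ile1.
    by move: xu c_ge1; lra.
  have B2 : `|y * D a * - (x * u)| <= (t * c) * 1 * (t ^+ 2 / 2 * c).
    by apply: normM_le; [apply: normM_le|rewrite normrN].
  have B3 : `|(x * (g s l * g s l) * F a) * (x * u)| <=
      (t ^+ 2 / 2 * (c * c) * 1) * (t ^+ 2 / 2 * c).
    by do 2![apply: normM_le => //]; apply: normM_le => //; apply: normM_le.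
  apply: le_trans (ler_normD _ _) _.
  apply: le_trans (lerD B1 (le_trans (ler_normD _ _) (lerD B2 B3))) _.
  (* As [1 <= c] and [t <= 1], every error monomial is at most [c ^+ 4 * t ^+ 3]. *)
  have C2 := cexp (isT : 2 <= 4)%N; have C3 := cexp (isT : 3 <= 4)%N.
  have T4 := texp (isT : 3 <= 4)%N.
  have P2 : c ^+ 2 * t ^+ 3 <= c ^+ 4 * t ^+ 3 by rewrite ler_wpM2r.
  have P3 : c ^+ 3 * t ^+ 4 <= c ^+ 4 * t ^+ 3.
    by apply: ler_pM; rewrite ?exprn_ge0.
  have -> : (t * c) ^+ 3 * (2 * c) + (t * c * 1 * (t ^+ 2 / 2 * c) +
     t ^+ 2 / 2 * (c * c) * 1 * (t ^+ 2 / 2 * c)) =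
     2 * (c ^+ 4 * t ^+ 3) + (c ^+ 2 * t ^+ 3) / 2 + (c ^+ 3 * t ^+ 4) / 4.
    by field.
  have : 0 <= c ^+ 4 * t ^+ 3 by rewrite mulr_ge0 ?exprn_ge0.
  lra.
have H2 : `|K^-1 * \sum_l main l - rho * (F a * (1 - x * v s))| <=
    c ^+ 4 * t ^+ 3.
  rewrite E; have -> : F a * (1 - x * v s - x * sigma2) -
      rho * (F a * (1 - x * v s)) =
      F a * ((1 - x * sigma2 - rho) - (x * v s) * (1 - rho)) by ring.
  have s2 : `|sigma2| <= c by rewrite ger0_norm.
  have xs : x * sigma2 <= t ^+ 2 / 2 * c by rewrite ler_wpM2l.
  have r1 : `|1 - rho| <= t ^+ 2 / 2 * c.
    have /andP[_ r1] := rho_le1; rewrite ger0_norm ?subr_ge0//.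
    by have := expR_ge1Dx (- (x * sigma2)); rewrite -/rho; lra.
  have B1 := rho_approx.
  have B2 : `|(x * v s) * (1 - rho)| <= (t ^+ 2 / 2 * c) * (t ^+ 2 / 2 * c).
    by apply: normM_le => //; apply: normM_le.
  rewrite normrM; apply: le_trans (ler_piMl _ (F1 _)) _ => //.
  apply: le_trans (ler_normB _ _) (le_trans (lerD B1 B2) _).
  have xs2 : (x * sigma2) ^+ 2 <= (t ^+ 2 / 2 * c) ^+ 2.
    by rewrite ler_pXn2r ?nnegrE ?mulr_ge0// ?exprn_ge0.
  apply: le_trans (lerD xs2 (lexx _)) _.
  have C2 := cexp (isT : 2 <= 4)%N; have T4 := texp (isT : 3 <= 4)%N.
  have P2 : c ^+ 2 * t ^+ 4 <= c ^+ 4 * t ^+ 3.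
    by apply: ler_pM; rewrite ?exprn_ge0.
  have -> : (t ^+ 2 / 2 * c) ^+ 2 + t ^+ 2 / 2 * c * (t ^+ 2 / 2 * c) =
    (c ^+ 2 * t ^+ 4) / 2 by field.
  have : 0 <= c ^+ 2 * t ^+ 4 by rewrite mulr_ge0 ?exprn_ge0.
  lra.
have -> : 5 * c ^+ 4 * t ^+ 3 = 4 * c ^+ 4 * t ^+ 3 + c ^+ 4 * t ^+ 3 by ring.
rewrite -(subrK (K^-1 * \sum_l main l) (K^-1 * _)) -addrA.
exact: le_trans (ler_normD _ _) (lerD H1 H2).
Qed.

(* The solution v of the Poisson equation for g^2 makes the conditional variance
   constant up to the correction factor 1 - x v, where x = t^2 / 2. *)
Lemma char_corrected m :
  `|avg m (fun w => F (t * asum g w) * (1 - x * v (state_after w))) -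
    rho ^+ m * (F 0 * (1 - x * v s0))| <= m%:R * (5 * c ^+ 4 * t ^+ 3).
Proof.
elim: m => [|m IH] /=; first by rewrite mulr0 mul1r subrr normr0 mul0r.
set G := fun w => F (t * asum g w) * (1 - x * v (state_after w)) in IH *.
rewrite -natr1 mulrDl mul1r [leRHS]addrC.
set B := avg m _; set X := F 0 * _ in IH *.
have -> : B - rho ^+ m.+1 * X = (B - rho * avg m G) + rho * (avg m G - rho ^+ m * X).
  by rewrite exprS; ring.
apply: le_trans (ler_normD _ _) (lerD _ _).
  rewrite /B -avgZ -avgB; apply: ler_norm_avg => w.
  under eq_bigr do rewrite (mulrDr t).
  exact: char_step.
rewrite normrM; apply: le_trans IH.
by have /andP[r0 r1] := rho_le1; rewrite ler_piMl// ger0_norm.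
Qed.

(** Dropping [b] costs [3 c^4 t]; inserting the correction factor, and removing it at [s0], costs
    half of [c^4 t] each. [char_corrected] applies in between. *)
Lemma char_approx m :
  `|avg m (fun w => F (t * (asum g w + b (state_after w)))) -
    rho ^+ m * F 0| <= 5 * c ^+ 4 * (m%:R * t ^+ 3 + t).
Proof.
have C1 k : (k <= 4)%N -> c ^+ k * t <= c ^+ 4 * t.
  by move=> k4; rewrite ler_wpM2r// cexp.
have xv s : `|x * v s| <= c ^+ 4 * t / 2.
  apply: le_trans (normM_le normx (vc s)) _.
  have := C1 1%N isT; have := texp (isT : 1 <= 2)%N; rewrite !expr1.
  have := c_ge0; nra.
set A := avg m _.
pose B := avg m (fun w => F (t * asum g w)).
pose C := avg m (fun w => F (t * asum g w) * (1 - x * v (state_after w))).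
have AB : `|A - B| <= 3 * c ^+ 4 * t.
  rewrite -avgB; apply: ler_norm_avg => w; rewrite mulrDr.
  set y := t * b _; set a := t * asum g w.
  have yc : `|y| <= t * c by apply: normM_le => //; rewrite ger0_norm.
  have -> : F (a + y) - F a = (F (a + y) - F a - y * D a + y ^+ 2 / 2 * F a) +
     (y * D a - y ^+ 2 / 2 * F a) by ring.
  have T1 : `|F (a + y) - F a - y * D a + y ^+ 2 / 2 * F a| <= c ^+ 4 * t.
    apply: le_trans (taylor _ _) _.
    apply: (@le_trans _ _ ((t * c) ^+ 3)).
      by rewrite ler_pXn2r ?nnegrE ?mulr_ge0.
    rewrite exprMn mulrC; apply: ler_pM; rewrite ?exprn_ge0//; first exact: cexp.
    by rewrite -[leRHS]expr1 texp.
  have T2 : `|y * D a| <= c ^+ 4 * t.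
    apply: le_trans (normM_le yc (D1 _)) _; rewrite mulr1 mulrC.
    exact: (C1 1%N).
  have T3 : `|y ^+ 2 / 2 * F a| <= c ^+ 4 * t.
    have y2 : `|y ^+ 2 / 2| <= (t * c) ^+ 2 / 2.
      apply: normM_le; last by rewrite ger0_norm.
      by rewrite normrX ler_pXn2r ?nnegrE ?mulr_ge0.
    apply: le_trans (normM_le y2 (F1 _)) _; rewrite mulr1 exprMn.
    have : t ^+ 2 * c ^+ 2 <= c ^+ 4 * t.
      rewrite mulrC; apply: ler_pM; rewrite ?exprn_ge0//; first exact: cexp.
      by rewrite -[leRHS]expr1 texp.
    have : 0 <= t ^+ 2 * c ^+ 2 by rewrite mulr_ge0 ?exprn_ge0.
    lra.
  apply: le_trans (ler_normD _ _) _.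
  apply: le_trans (lerD T1 (le_trans (ler_normB _ _) (lerD T2 T3))) _.
  lra.
have BC : `|B - C| <= c ^+ 4 * t / 2.
  rewrite -avgB; apply: ler_norm_avg => w.
  have -> (p q : R) : p - p * (1 - q) = p * q by ring.
  rewrite normrM; apply: le_trans (xv (state_after w)); exact: ler_piMl.
have CD := char_corrected m; rewrite -/C in CD.
have DE : `|rho ^+ m * (F 0 * (1 - x * v s0)) - rho ^+ m * F 0| <= c ^+ 4 * t / 2.
  have -> (p q r : R) : r * (p * (1 - q)) - r * p = - (r * p * q) by ring.
  rewrite normrN normrM; apply: le_trans (xv s0); apply: ler_piMl => //.
  rewrite -[leRHS]mulr1; apply: normM_le => //.
  by have /andP[r0 r1] := rho_le1; rewrite ger0_norm ?exprn_ge0// exprn_ile1.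
move: AB BC CD DE; rewrite !ler_norml; set X := rho ^+ m * F 0.
set Y := rho ^+ m * _.
set m3 := m%:R * (5 * c ^+ 4 * t ^+ 3).
have -> : 5 * c ^+ 4 * (m%:R * t ^+ 3 + t) = m3 + 5 * (c ^+ 4 * t).
  by rewrite /m3; ring.
have : 0 <= c ^+ 4 * t by rewrite mulr_ge0 ?exprn_ge0.
rewrite -!mulrA; set ct := c ^+ 4 * t.
lra.
Qed.

End CharacteristicFunction.
End FiniteChain.

(** * The chain of states of a transducer *)

(** The least positive difference [k] of two elements [b] and [b + k] of [A] divides every element
    [n]: otherwise [n %/ k] times the larger one, and [n] plus [n %/ k] times the smaller one, would
    differ by only [n %% k]. So [k] is 1. *)
Lemma numerical_semigroup (A : nat -> Prop) : A 0%N ->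
  (forall m n, A m -> A n -> A (m + n)%N) ->
  (forall d, (forall n, A n -> (d %| n)%N) -> d = 1%N) ->
  exists n0, forall n, (n0 <= n)%N -> A n.
Proof.
move=> A0 AD A1.
have AM q m : A m -> A (q * m)%N.
  by move=> Am; elim: q => // q IH; rewrite mulSn; apply: AD.
pose P k := `[< (0 < k)%N /\ exists2 b, A b & A (b + k)%N >].
have exP : exists k, P k.
  apply/not_existsP => nP; suff : 0%N = 1%N by [].
  apply: A1 => n An; case: n An => // n An.
  by case: (nP n.+1); apply/asboolP; split=> //; exists 0%N.
case: (ex_minnP exP) => k /asboolP[k0 [b Ab Abk]] kmin.
have k1 : k = 1%N.
  apply: A1 => n An; rewrite /dvdn; apply/negP => /negP; rewrite -lt0n => r0.
  have : P (n %% k)%N.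
    apply/asboolP; split=> //; exists ((n %/ k) * (b + k))%N; first exact: AM.
    rewrite (_ : (_ + _)%N = (n %/ k * b + n)%N); first by apply: AD => //; exact: AM.
    by rewrite mulnDr -addnA -divn_eq.
  by move/kmin; rewrite leqNgt ltn_mod k0.
move: Abk; rewrite k1 addn1 => Ab1.
exists (b * b)%N => n bn; case: (posnP b) => [b0|b0].
  by rewrite -[n]muln1; apply: AM; move: Ab1; rewrite b0.
have rq : (n %% b <= n %/ b)%N.
  by apply: (@leq_trans b); [rewrite ltnW ?ltn_mod|rewrite leq_divRL].
(* With quotient [q] and remainder [r] of [n] by [b], [n] is [q - r] times [b] plus [r] times
   [b.+1], where [r < b <= q]. *)
rewrite (_ : n = ((n %/ b - n %% b) * b + (n %% b) * b.+1)%N).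
  by apply: AD; exact: AM.
by rewrite mulnS mulnBl addnCA subnK ?leq_mul2r ?rq ?orbT// addnC -divn_eq.
Qed.

(** A breadth-first tree: outside [x0], choose a letter that shortens the distance [d] to [x0]. *)
Lemma exists_rooted (V L : finType) (nx : V -> L -> V) (l0 : L) (x0 : V) :
  (forall x, exists w, foldl nx x w = x0) ->
  exists phi : {ffun V -> L}, rooted nx phi x0.
Proof.
move=> reach; pose P x k := [exists w : k.-tuple L, foldl nx x w == x0].
have exP x : exists k, P x k.
  have [w wx] := reach x; exists (size w).
  by apply/existsP; exists (in_tuple w); rewrite wx.
pose d x := ex_minn (exP x).
have dE x k : P x k -> (d x <= k)%N by rewrite /d; case: ex_minnP => m _; apply.
have dP x : P x (d x) by rewrite /d; case: ex_minnP.
exists [ffun x => odflt l0 [pick l | d (nx x l) < d x]%N].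
apply/forallP => x; have [n le_xn] := ubnP (d x).
elim: n => // n IH in x le_xn *.
case E: (d x) (dP x) => [|k] /existsP[w /eqP wx].
  by move: wx; rewrite tuple0 /= => ->.
have [l kl] : exists l, (d (nx x l) < d x)%N.
  case/tupleP: w wx => l w /= wx; exists l; rewrite E ltnS.
  by apply: dE; apply/existsP; exists w; apply/eqP.
apply: connect_trans (fconnect1 _ _) (IH _ _); rewrite /fmap ffunE.
case: pickP => [l' kl' /=|/(_ l)]; last by rewrite kl.
by apply: leq_trans kl' _; rewrite -ltnS.
Qed.

Section TransducerChain.
Variables (R : realType) (T : transducer R).
Hypotheses (hcomplete : complete T) (hdet : deterministic T).
Hypotheses (hconn : finally_connected T) (haper : finally_aperiodic T).
Notation next := (next hcomplete).
Notation edge_at := (edge_at hcomplete).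
Notation fnext := (@fnext _ _ hcomplete).
Notation K := (#|{: alphI T}|%:R : R).

Lemma card_alphI : #|{: alphI T}| = #|` alphI T|.
Proof. by rewrite cardfE. Qed.

Lemma alphI_gt0 : (0 < #|{: alphI T}|)%N.
Proof. by rewrite card_alphI; apply: ltn_trans (alphI_gt1 T). Qed.

Lemma exists_final : exists z, z \in final_states T.
Proof. by have [z zP] := hconn; exists z; apply/final_statesP. Qed.

Lemma final_reach z : z \in final_states T ->
  forall s, exists w, foldl next s w = z.
Proof. by move=> /final_statesP fz s; apply: (@reachable_word _ _ hcomplete hdet). Qed.

Lemma val_foldl_fnext (x : fstate T) w :
  val (foldl fnext x w) = foldl next (val x) w.
Proof. by elim: w x => //= l w IH x; rewrite IH. Qed.

Lemma sumD1_one_gt0 : 0 < sumD1 (@one_lab R T).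
Proof.
have K0 : 0 < K by rewrite ltr0n alphI_gt0.
rewrite -(pmulr_rgt0 _ K0) (sumD1_nrooted hcomplete hdet).
have nr0 x : 0 <= nrooted R fnext x by apply: sumr_ge0.
under eq_bigr do rewrite /one_lab sumr_const.
have [z fz] := exists_final; pose x0 : fstate T := exist _ z fz.
have [l _] : exists l : alphI T, true.
  by have /card_gt0P[l _] := alphI_gt0; exists l.
have [phi rphi] : exists phi, rooted fnext phi x0.
  apply: (@exists_rooted _ _ fnext l x0) => x; have [w wz] := final_reach fz (val x).
  by exists w; apply: val_inj; rewrite val_foldl_fnext.
rewrite (bigD1 x0)//= ltr_pwDl//; last first.
  by apply: sumr_ge0 => x _; rewrite mulr_ge0.
rewrite mulr_gt0 ?ltr0n ?alphI_gt0// /nrooted (bigD1 phi)//= rphi.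
by rewrite ltr_pwDl// sumr_ge0.
Qed.

(* The stationary distribution of the chain of states, by the Markov chain tree
   theorem: up to a constant factor, [nrooted x] counts the spanning trees rooted
   at x. *)
Definition stat (s : state T) : R :=
  if insub s is Some x then nrooted R fnext x / sumD1 (@one_lab R T) else 0.

Lemma sum_stat (F : state T -> R) : \sum_s stat s * F s =
  (\sum_(x : fstate T) nrooted R fnext x * F (val x)) / sumD1 (@one_lab R T).
Proof.
rewrite mulr_suml (bigID (mem (final_states T))) /= addrC big1 ?add0r; last first.
  by move=> s sF; rewrite /stat insubN// mul0r.
rewrite big_sub; apply: eq_bigr => x _.
by rewrite /stat valK mulrAC.
Qed.

Lemma sum_stat1 : \sum_s stat s = 1.
Proof.
have S0 := sumD1_one_gt0; have K0 : K != 0 by rewrite pnatr_eq0 -lt0n alphI_gt0.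
have E : \sum_s stat s * 1 = 1 by
  rewrite sum_stat; apply: (mulfI K0); rewrite mulr1 mulrA;
  have := sumD1_nrooted hcomplete hdet (@one_lab R T);
  rewrite /one_lab sumr_const -mulr_suml => H;
  rewrite -[X in X / _](_ : K * sumD1 (@one_lab R T) = _) ?mulfK ?gt_eqF//;
  rewrite H mulrC; congr (_ * _); apply: eq_bigr => x _; rewrite mulr1.
by rewrite -[RHS]E; apply: eq_bigr => s _; rewrite mulr1.
Qed.

Lemma sum_stat_edges (g : edge T -> R) :
  \sum_s stat s * \sum_l g (edge_at s l) = K * sumD1 g / sumD1 (@one_lab R T).
Proof. by rewrite (sumD1_nrooted hcomplete hdet) sum_stat. Qed.

(** Stationarity of [stat], the content of the Markov chain tree theorem: the left side is a
    multiple of [sumD1] of a coboundary, and cycle sums of coboundaries vanish. *)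
Lemma stat_coboundary (u : state T -> R) :
  \sum_s stat s * \sum_l (u (next s l) - u s) = 0.
Proof.
have := sum_stat_edges (fun e => 0 + coboundary u e).
rewrite sumD1_gauge (_ : sumD1 (fun=> 0) = 0); last first.
  by rewrite /sumD1 big1// => D _; rewrite big1// => C _; rewrite /csum big1.
rewrite mulr0 mul0r => E; rewrite -[RHS]E.
by apply: eq_bigr => s _; congr (_ * _); apply: eq_bigr => l _; rewrite add0r.
Qed.

Definition labs (g : edge T -> R) (s : state T) (l : alphI T) := g (edge_at s l).

Lemma sum_stat_mean (r : state T -> R) : (forall s, 0 <= r s) ->
  0 <= \sum_s stat s * r s.
Proof.
move=> r0; rewrite sum_stat; apply: divr_ge0; last exact: ltW sumD1_one_gt0.
by apply: sumr_ge0 => x _; rewrite mulr_ge0// sumr_ge0.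
Qed.

Lemma exists_poisson (g : state T -> alphI T -> R) c :
  \sum_s stat s * \sum_l g s l = K * c -> exists u, poisson next g c u.
Proof.
move=> gc; have [z fz] := exists_final.
apply: (poisson_solution (final_reach fz) sum_stat1 stat_coboundary).
under eq_bigr do rewrite sumrB sumr_const -[c *+ _]mulr_natl mulrBr.
by rewrite sumrB gc -mulr_suml sum_stat1 mul1r subrr.
Qed.

Lemma exists_poisson_labs (g : edge T -> R) :
  exists u, poisson next (labs g) (sumD1 g / sumD1 (@one_lab R T)) u.
Proof. by apply: exists_poisson; rewrite sum_stat_edges mulrA. Qed.

Lemma walk_foldl s p t : walk (final_edges T) s p t ->
  foldl next s (map (@letter R T) p) = t.
Proof.
elim: p s => [|e p IH] s /=; first by move/eqP.
case/and3P; rewrite inE => /and3P[eT _ _] /eqP <- /IH.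
by rewrite (transE hcomplete hdet eT).
Qed.

(** The lengths of closed words at [z] form a semigroup, and aperiodicity makes their gcd 1, so all
    large lengths occur. Words leading to [z] are padded with closed words to a common length. *)
Lemma uniform_reach : exists N, (0 < N)%N /\ exists z,
  forall s, exists2 w, size w = N & foldl next s w = z.
Proof.
have [z fz] := exists_final.
pose A n := exists2 w, size w = n & foldl next z w = z.
have [n0 An] : exists n0, forall n, (n0 <= n)%N -> A n.
  apply: numerical_semigroup; first by exists [::].
    move=> m n [w <- wz] [w' <- w'z].
    by exists (w ++ w'); rewrite ?size_cat// foldl_cat wz.
  move=> d dA; apply/eqP; rewrite -dvdn1; apply/(haper fz) => n [p pz <-].
  by apply: dA; exists (map (@letter R T) p); rewrite ?size_map//; apply: walk_foldl.
have [w wz] := fin_all_exists (final_reach fz).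
pose m := \max_s size (w s).
exists (n0 + m).+1; split=> //; exists z => s.
have ms : (size (w s) <= m)%N by rewrite /m; apply: leq_bigmax.
have [w' sw' w'z] : A ((n0 + m).+1 - size (w s))%N.
  by apply: An; rewrite leq_subRL; lia.
exists (w s ++ w'); last by rewrite foldl_cat wz.
by rewrite size_cat sw' subnKC// ltnW// ltnS (leq_trans ms)// leq_addl.
Qed.

End TransducerChain.

(** * Characteristic function of the normal distribution *)

Section TrigTaylor.
Variable R : realType.
Implicit Types x y : R.

Lemma ge0_of_derive_ge0 (f f' : R -> R) :
  (forall x, is_derive x 1 f (f' x)) -> f 0 = 0 ->
  (forall x, 0 <= x -> 0 <= f' x) -> forall x, 0 <= x -> 0 <= f x.
Proof.
move=> df f0 f'0 x x0.
have cf : {within `[0, x], continuous f}%classic.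
  apply: continuous_subspaceT => z; apply: differentiable_continuous.
  by apply/derivable1_diffP; have [] := df z.
have [c cx E] := MVT_segment x0 (fun z _ => df z) cf.
have -> : f x = f' c * (x - 0) by rewrite -E f0 subr0.
apply: mulr_ge0; last by rewrite subr0.
by apply: f'0; move: cx; rewrite in_itv /= => /andP[].
Qed.

(** Integrating [cos x <= 1] repeatedly from 0 gives Taylor polynomials as alternating bounds of
    sine and cosine. *)
Lemma sub_sin_ge0 x : 0 <= x -> 0 <= x - sin x.
Proof.
apply: (@ge0_of_derive_ge0 (fun x => x - sin x) (fun x => 1 - cos x)).
- by rewrite sin0 subr0.
- by move=> z _; rewrite subr_ge0 cos_le1.
Qed.

Lemma cos_taylor2_ge0 x : 0 <= x -> 0 <= cos x - 1 + x ^+ 2 / 2.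
Proof.
apply: (@ge0_of_derive_ge0 (fun x => cos x - 1 + x ^+ 2 / 2) (fun x => x - sin x)).
- move=> z; apply: trigger_derive.
  by rewrite /GRing.scale /=; field.
- by rewrite cos0 expr0n /= mul0r; ring.
- exact: sub_sin_ge0.
Qed.

Lemma sin_taylor3_ge0 x : 0 <= x -> 0 <= sin x - x + x ^+ 3 / 6.
Proof.
apply: (@ge0_of_derive_ge0 (fun x => sin x - x + x ^+ 3 / 6)
   (fun x => cos x - 1 + x ^+ 2 / 2)).
- move=> z; apply: trigger_derive.
  by rewrite /GRing.scale /=; field.
- by rewrite sin0 expr0n /= mul0r; ring.
- exact: cos_taylor2_ge0.
Qed.

(** A second chain, from [sin x <= 1], ends with a cubic bound for [cos x - 1 + x ^+ 2 / 2], of the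
    same order as the one for sine. *)
Lemma cos_linear_ge0 x : 0 <= x -> 0 <= x - 1 + cos x.
Proof.
apply: (@ge0_of_derive_ge0 (fun x => x - 1 + cos x) (fun x => 1 - sin x)).
- move=> z; apply: trigger_derive.
  by rewrite /GRing.scale /=; ring.
- by rewrite cos0; ring.
- by move=> z _; rewrite subr_ge0 sin_le1.
Qed.

Lemma sin_quadratic_ge0 x : 0 <= x -> 0 <= x ^+ 2 / 2 - x + sin x.
Proof.
apply: (@ge0_of_derive_ge0 (fun x => x ^+ 2 / 2 - x + sin x)
   (fun x => x - 1 + cos x)).
- move=> z; apply: trigger_derive.
  by rewrite /GRing.scale /=; field.
- by rewrite sin0 expr0n /= mul0r; ring.
- exact: cos_linear_ge0.
Qed.

Lemma cos_cubic_ge0 x : 0 <= x -> 0 <= x ^+ 3 / 6 - x ^+ 2 / 2 + 1 - cos x.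
Proof.
apply: (@ge0_of_derive_ge0 (fun x => x ^+ 3 / 6 - x ^+ 2 / 2 + 1 - cos x)
   (fun x => x ^+ 2 / 2 - x + sin x)).
- move=> z; apply: trigger_derive.
  by rewrite /GRing.scale /=; field.
- by rewrite cos0 !expr0n /= !mul0r; ring.
- exact: sin_quadratic_ge0.
Qed.

Lemma cos_taylor2 x : `|cos x - 1 + x ^+ 2 / 2| <= `|x| ^+ 3 / 6.
Proof.
have H y : 0 <= y -> `|cos y - 1 + y ^+ 2 / 2| <= `|y| ^+ 3 / 6.
  move=> y0; rewrite ger0_norm ?cos_taylor2_ge0// ger0_norm//.
  by have := cos_cubic_ge0 y0; lra.
by have [/H//|/ltW] := leP 0 x; rewrite -oppr_ge0 => /H; rewrite cosN normrN sqrrN.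
Qed.

Lemma sin_taylor2 x : `|sin x - x| <= `|x| ^+ 3 / 6.
Proof.
have H y : 0 <= y -> `|sin y - y| <= `|y| ^+ 3 / 6.
  move=> y0; rewrite distrC ger0_norm ?sub_sin_ge0// ger0_norm//.
  by have := sin_taylor3_ge0 y0; lra.
have [/H//|/ltW] := leP 0 x; rewrite -oppr_ge0 => /H.
by rewrite sinN -opprD !normrN.
Qed.

(** By the addition formulas, Taylor's remainder at [x] combines the remainders of cosine and sine
    at 0, with values of sine and cosine at [x] as coefficients. *)
Lemma trig_remainder x y (p q : R) : `|p| <= 1 -> `|q| <= 1 ->
  `|p * (cos y - 1 + y ^+ 2 / 2) + q * (sin y - y)| <= `|y| ^+ 3.
Proof.
move=> p1 q1; apply: le_trans (ler_normD _ _) _; rewrite !normrM.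
have := ler_pM (normr_ge0 _) (normr_ge0 _) p1 (cos_taylor2 y).
have := ler_pM (normr_ge0 _) (normr_ge0 _) q1 (sin_taylor2 y).
have : 0 <= `|y| ^+ 3 by rewrite exprn_ge0.
lra.
Qed.

Lemma cosD_taylor x y :
  `|cos (x + y) - cos x - y * (- sin x) + y ^+ 2 / 2 * cos x| <= `|y| ^+ 3.
Proof.
have := @trig_remainder x y (cos x) (- sin x) (cos_max x).
rewrite normrN => /(_ (sin_max x)); rewrite cosD.
by congr (`|_| <= _); ring.
Qed.

Lemma sinD_taylor x y :
  `|sin (x + y) - sin x - y * cos x + y ^+ 2 / 2 * sin x| <= `|y| ^+ 3.
Proof.
have := @trig_remainder x y (sin x) (cos x) (sin_max x) (cos_max x).
by rewrite sinD; congr (`|_| <= _); ring.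
Qed.

End TrigTaylor.

Section NormalDistribution.
Variable R : realType.
Notation mu := (@lebesgue_measure R).
Local Open Scope classical_set_scope.

Lemma integral_normal_prob (m s : R) (f : R -> \bar R) : measurable_fun [set: R] f ->
  (\int[normal_prob m s]_x `|f x| < +oo)%E ->
  (\int[normal_prob m s]_x f x = \int[mu]_x (f x * (normal_pdf m s x)%:E))%E.
Proof.
move=> mf finf.
rewrite -(Radon_Nikodym_change_of_variables (normal_prob_dominates m s))//=; last first.
  by apply/integrableP; split.
apply: ae_eq_integral => //.
- apply: emeasurable_funM => //; apply: (measurable_int mu).
  by apply: Radon_Nikodym_integrable; exact: normal_prob_dominates.
- apply: emeasurable_funM => //=; apply/measurableT_comp => //=.
  exact: measurable_normal_pdf.
- apply: ae_eqe_mul2l => /=.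
  rewrite Radon_NikodymE//=; first exact: normal_prob_dominates.
  move=> abmu; case: cid => /= h [h1 h2 h3].
  apply: integral_ae_eq => //=.
  + by apply/measurableT_comp => //; exact: measurable_normal_pdf.
  + by move=> E E01 mE; rewrite -h3.
Qed.

End NormalDistribution.

(** * Integrals against the standard normal density *)

Section StandardNormal.
Variable R : realType.
Notation mu := (@lebesgue_measure R).
Notation gamma := (@normal_pdf R 0 1).
Local Open Scope classical_set_scope.
Implicit Types t x : R.

Lemma std_normal_pdfE x : gamma x = normal_peak 1 * expR (- (x ^+ 2 / 2)).
Proof.
rewrite normal_pdfE// /normal_fun subr0 expr1n; congr (_ * expR _).
by rewrite mulNr.
Qed.

Lemma std_normal_pdf_gt0 x : 0 < gamma x.
Proof. by rewrite std_normal_pdfE mulr_gt0 ?expR_gt0 ?normal_peak_gt0. Qed.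

Lemma is_derive_std_normal_pdf x : is_derive x 1 gamma (- x * gamma x).
Proof.
have -> : gamma = (fun x => normal_peak 1 * expR (- (x ^+ 2 / 2))).
  by apply/funext => z; rewrite std_normal_pdfE.
by apply: trigger_derive; rewrite /GRing.scale /=; field.
Qed.

Lemma integrable_std_normal_pdf : mu.-integrable [set: R] (EFin \o gamma).
Proof. exact: integrable_normal_pdf. Qed.

Lemma continuous_std_normal_pdf : continuous gamma.
Proof. exact: continuous_normal_pdf. Qed.

(** [|x| <= 2 exp(x^2 / 4)], and the remaining [exp(- x^2 / 4)] is, up to its peak, the normal
    density of variance 2. This majorant makes first moments integrable. *)
Lemma abs_std_normal_pdf_le : exists C, forall x,
  `|x| * gamma x <= C * normal_pdf 0 (Num.sqrt 2) x.
Proof.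
have s0 : Num.sqrt 2 != 0 :> R by rewrite gt_eqF// sqrtr_gt0.
have p0 : normal_peak (Num.sqrt 2) != 0 :> R by rewrite gt_eqF// normal_peak_gt0.
exists (2 * normal_peak 1 / normal_peak (Num.sqrt 2)) => x.
rewrite std_normal_pdfE normal_pdfE// /normal_fun subr0 sqr_sqrtr//.
have -> (e : R) : 2 * normal_peak 1 / normal_peak (Num.sqrt 2) *
  (normal_peak (Num.sqrt 2) * e) = normal_peak 1 * (2 * e) by field.
rewrite mulrCA ler_pM2l ?normal_peak_gt0//.
have -> : - (x ^+ 2 / 2) = - (x ^+ 2 / 4) + (- (x ^+ 2 / 4)) by field.
have -> : - x ^+ 2 / (2 *+ 2) = - (x ^+ 2 / 4) by rewrite -mulr_natr; field.
rewrite expRD mulrA ler_pM2r ?expR_gt0// expRN ler_pdivrMr ?expR_gt0//.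
have : 1 + x ^+ 2 / 4 <= expR (x ^+ 2 / 4) by exact: expR_ge1Dx.
have : x ^+ 2 = `|x| ^+ 2 by rewrite real_normK ?num_real.
by move=> ->; nra.
Qed.

Lemma integrable_mull d (Y : measurableType d) (nu : {measure set Y -> \bar R})
    (f : Y -> R) (c : R) : nu.-integrable setT (EFin \o f) ->
  nu.-integrable setT (EFin \o (fun y => c * f y)).
Proof.
move=> intf; apply: (eq_integrable measurableT (fun y => c%:E * (EFin \o f) y)%E).
  by move=> y _ /=; rewrite EFinM.
exact: integrableZl.
Qed.

Lemma integrable_bounded_pdf (f : R -> R) M : measurable_fun [set: R] f ->
  (forall x, `|f x| <= M * gamma x) ->
  mu.-integrable [set: R] (EFin \o f).
Proof.
move=> mf fM; apply: (@le_integrable _ _ _ mu setT _ _ (EFin \o (fun x => M * gamma x))) => //.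
- exact/measurable_EFinP.
- by move=> x _ /=; rewrite lee_fin (le_trans (fM x))// ler_norm.
- exact: integrable_mull integrable_std_normal_pdf.
Qed.

Lemma integrable_linear_pdf (f : R -> R) a b : measurable_fun [set: R] f ->
  (forall x, `|f x| <= a * gamma x + b * (`|x| * gamma x)) -> 0 <= b ->
  mu.-integrable [set: R] (EFin \o f).
Proof.
move=> mf fM b0; have [C HC] := abs_std_normal_pdf_le.
pose g x := a * gamma x + (b * C) * normal_pdf 0 (Num.sqrt 2) x.
apply: (@le_integrable _ _ _ mu setT _ _ (EFin \o g)) => //.
- exact/measurable_EFinP.
- move=> x _ /=; rewrite lee_fin (le_trans (fM x))//.
  apply: le_trans (ler_norm _); rewrite /g lerD2l -mulrA.
  by rewrite ler_wpM2l.
- apply: (@integrableD _ _ _ mu setT _ (EFin \o _) (EFin \o _)) => //.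
    exact: integrable_mull integrable_std_normal_pdf.
  apply: integrable_mull; exact: integrable_normal_pdf.
Qed.

Lemma std_normal_pdf_cvg0 : gamma n%:R @[n --> \oo] --> 0.
Proof.
apply: (@squeeze_cvgr _ _ _ _ (cst 0) (fun n => normal_peak 1 * (2 * (n%:R)^-1))).
- near=> n; rewrite ltW ?std_normal_pdf_gt0//= std_normal_pdfE.
  rewrite ler_pM2l ?normal_peak_gt0// expRN.
  have n0 : 1 <= n%:R :> R by rewrite ler1n; near: n; exact: nbhs_infty_gt.
  rewrite -[leRHS]invrK lef_pV2 ?posrE ?expR_gt0 ?invr_gt0 ?mulr_gt0 ?invr_gt0
    ?(lt_le_trans _ n0)//.
  apply: le_trans (expR_ge1Dx _); rewrite invfM invrK.
  by nra.
- exact: cvg_cst.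
- rewrite -[X in _ --> X](mulr0 (normal_peak 1)); apply: cvgMr.
  rewrite -[X in _ --> X](mulr0 2); apply: cvgMr.
  apply/gtr0_cvgV0; last exact: cvgr_idn.
  by near=> n; rewrite ltr0n; near: n; exact: nbhs_infty_gt.
Unshelve. all: end_near. Qed.

Section Characteristic.
Variables F D : R -> R.
Hypothesis dF : forall x, is_derive x 1 F (D x).
Hypothesis dD : forall x, is_derive x 1 D (- F x).
Hypotheses (F1 : forall x, `|F x| <= 1) (D1 : forall x, `|D x| <= 1).

Let derive_cont (f f' : R -> R) : (forall x, is_derive x 1 f (f' x)) -> continuous f.
Proof.
move=> df x; apply: differentiable_continuous.
by apply/derivable1_diffP; have [] := df x.
Qed.

Let cF : continuous F. Proof. exact: derive_cont dF. Qed.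
Let cD : continuous D. Proof. exact: derive_cont dD. Qed.
Let cgamma := continuous_std_normal_pdf.

Let contM (f : R -> R) t : continuous f -> continuous (fun x => f (t * x)).
Proof.
move=> cf x; apply: (continuous_comp (f := fun x => t * x) (g := f)); last exact: cf.
exact: mulrl_continuous.
Qed.

Let mcont (f : R -> R) : continuous f -> measurable_fun [set: R] f.
Proof. exact: continuous_measurable_fun. Qed.

Let H t x := D (t * x) * gamma x.
Let H' t x := - (t * (F (t * x) * gamma x)) - x * D (t * x) * gamma x.

Let cH' t : continuous (H' t).
Proof.
move=> x; apply: cvgB.
  apply: cvgN; apply: cvgMr; apply: cvgM; [exact: contM|exact: cgamma].
apply: cvgM; last exact: cgamma.
by apply: cvgM; [exact: cvg_id|exact: contM].
Qed.

Let is_derive_H t x : is_derive x 1 (H t) (H' t x).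
Proof.
have dDt : is_derive x 1 (fun y => D (t * y)) (t * - F (t * x)).
  have dt : is_derive x 1 (fun y => t * y) t.
    by apply: trigger_derive; rewrite /GRing.scale /= mulr1.
  by have := @is_derive1_comp _ D (fun y => t * y) x _ _ (dD _) dt; rewrite mulrC.
have := @is_deriveM _ _ _ _ _ _ _ _ dDt (is_derive_std_normal_pdf x).
move=> h; apply: (is_derive_eq h); rewrite /H' /GRing.scale /=; ring.
Qed.

Lemma integrable_H' t : mu.-integrable [set: R] (EFin \o H' t).
Proof.
apply: (@integrable_linear_pdf _ `|t| 1); [apply: mcont; exact: cH'| |by []].
move=> x; rewrite /H' mul1r; apply: le_trans (ler_normB _ _) _.
have g0 := std_normal_pdf_gt0 x.
rewrite normrN !normrM (ger0_norm (ltW g0)); apply: lerD.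
  by rewrite ler_wpM2l// ler_piMl// ltW.
by apply: ler_wpM2r; [exact: ltW|rewrite ler_piMr].
Qed.

(** [H'] is the derivative of [H], and the boundary values of [H] at [n] and [- n] are bounded by
    the density at [n], which tends to 0. *)
Lemma integral_H' t : (\int[mu]_x (H' t x)%:E = 0)%E.
Proof.
pose I n : set R := `[- n%:R, n%:R].
pose f_ n : R -> \bar R := (EFin \o H' t) \_ (I n).
have mH : measurable_fun setT (EFin \o H' t) by apply/measurable_EFinP; apply: mcont; exact: cH'.
have mI n : measurable (I n) by exact: measurable_itv.
have mf_ n : measurable_fun setT (f_ n).
  by apply/(measurable_restrictT _ _).1 => //; exact: measurable_funTS.
have iH := integrable_H' t.
have [] := @dominated_convergence _ _ _ mu setT measurableT f_ (EFin \o H' t)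
  (abse \o (EFin \o H' t)) mf_ mH.
- apply: aeW => x _ /=; apply: cvg_near_cst; near=> n.
  rewrite /f_ patchE mem_set// /I /= in_itv /= -ler_norml.
  near: n; exact: nbhs_infty_ger.
- exact: integrable_abse.
- apply: aeW => x n _ /=; rewrite /f_ patchE; case: ifPn => //= _.
  by rewrite normr0 lee_fin.
move=> _ _ cvgI.
apply: (cvg_unique _ cvgI) => //.
have -> : (fun n => \int[mu]_x f_ n x)%E =
    (fun n => (H t n%:R - H t (- n%:R))%:E).
  apply/funext => n; rewrite /f_ -integral_mkcond.
  case: n => [|n]; first by rewrite /I oppr0 set_itv1 integral_set1 subrr.
  rewrite EFinB /I; apply: continuous_FTC2.
  - by rewrite -subr_gt0 opprK ltr_pwDl.
  - by apply: continuous_subspaceT; exact: cH'.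
  - have cH : continuous (H t) by exact: derive_cont (is_derive_H t).
    split.
    + by move=> x _; have [] := is_derive_H t x.
    + exact/cvg_at_right_filter/cH.
    + exact/cvg_at_left_filter/cH.
  - by move=> x _; rewrite derive1E; have [] := is_derive_H t x.
apply: cvg_EFin; first exact: nearW.
have gN x : gamma (- x) = gamma x by rewrite !std_normal_pdfE sqrrN.
apply: norm_cvg0; apply: (@squeeze_cvgr _ _ _ _ (cst 0) (fun n => 2 * gamma n%:R)).
- apply: nearW => n /=; rewrite normr_ge0 /= (le_trans (ler_normB _ _))//.
  rewrite /H gN !normrM (ger0_norm (ltW (std_normal_pdf_gt0 _))).
  rewrite -mulrDl; apply: ler_wpM2r; first exact/ltW/std_normal_pdf_gt0.
  exact: lerD.
- exact: cvg_cst.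
- by rewrite -[X in _ --> X](mulr0 2); apply: cvgMr; exact: std_normal_pdf_cvg0.
Unshelve. all: end_near. Qed.

Let psi t : R := \int[mu]_x (F (t * x) * gamma x).

Let mF t : measurable_fun [set: R] (fun x => F (t * x) * gamma x).
Proof.
apply: mcont; move=> x; apply: cvgM; first exact: contM.
exact: cgamma.
Qed.

Let iF t : mu.-integrable [set: R] (EFin \o (fun x => F (t * x) * gamma x)).
Proof.
apply: (@integrable_bounded_pdf _ 1) => // x; rewrite mul1r normrM.
have g0 := std_normal_pdf_gt0 x.
by rewrite (ger0_norm (ltW g0)) ler_piMl// ltW.
Qed.

Let is_derive_Ft t x :
  is_derive t 1 (fun t => F (t * x) * gamma x) (x * D (t * x) * gamma x).
Proof.
have dt : is_derive t 1 (fun y => y * x) x.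
  by apply: trigger_derive; rewrite /GRing.scale /=; ring.
have dFt := @is_derive1_comp _ F (fun y => y * x) t _ _ (dF _) dt.
have h := @is_deriveM _ _ _ _ _ _ _ _ dFt (is_derive_cst (gamma x) t 1).
by apply: (is_derive_eq h); rewrite /GRing.scale /=; ring.
Qed.

(** Differentiation under the integral sign produces the factor [x]; the integration by parts in
    [integral_H'] trades it for [- t]. *)
Let is_derive_psi t : is_derive t 1 psi (- t * psi t).
Proof.
pose f t x := F (t * x) * gamma x.
pose G x := `|x| * gamma x.
have I : (`]t - 1, t + 1[ : set R) t.
  by rewrite /= in_itv /= ltrBlDr !ltrDl ltr01.
have d1 s x : partial1of2 f s x = x * D (s * x) * gamma x.
  by rewrite /partial1of2 derive1E; have [] := is_derive_Ft s x.
have derf s x : derivable (f ^~ x) s 1 by have [] := is_derive_Ft s x.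
have G0 x : 0 <= G x by rewrite mulr_ge0// ltW// std_normal_pdf_gt0.
have mG : measurable_fun [set: R] G.
  by apply: mcont => x; apply: cvgM; [exact: norm_continuous|exact: cgamma].
have iG : mu.-integrable [set: R] (EFin \o G).
  apply: (@integrable_linear_pdf _ 0 1) => // x.
  by rewrite mul0r add0r mul1r ger0_norm.
have fG s x : `|partial1of2 f s x| <= G x.
  rewrite d1 !normrM (ger0_norm (ltW (std_normal_pdf_gt0 x))).
  apply: ler_wpM2r; first exact/ltW/std_normal_pdf_gt0.
  by rewrite ler_piMr.
have dpsi : derivable psi t 1.
  exact: (@derivable_under_integral _ _ _ mu f setT measurableT t (t - 1) (t + 1)
    I (fun s _ => iF s) (fun s x _ _ => derf s x) G G0 iG (fun s x _ _ => fG s x)).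
apply: DeriveDef => //; rewrite -derive1E.
rewrite (@differentiation_under_integral _ _ _ mu f setT measurableT t (t - 1) (t + 1)
    I (fun s _ => iF s) (fun s x _ _ => derf s x) G G0 iG (fun s x _ _ => fG s x)).
have := integral_H' t.
rewrite /H' => /(congr1 fine).
rewrite -[LHS]/(\int[mu]_x (- (t * (F (t * x) * gamma x)) - x * D (t * x) * gamma x)).
have iD : mu.-integrable [set: R] (EFin \o (fun x => x * D (t * x) * gamma x)).
  apply: (@integrable_linear_pdf _ 0 1) => //.
    apply: mcont => x; apply: cvgM; last exact: cgamma.
    by apply: cvgM; [exact: cvg_id|exact: contM].
  by move=> x; rewrite mul0r add0r mul1r -d1.
under eq_Rintegral do rewrite -mulNr.
rewrite RintegralB//; last exact: integrable_mull (iF t).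
rewrite RintegralZl// -/(psi t) => /eqP; rewrite subr_eq0 => /eqP ->.
by apply: eq_Rintegral => x _; rewrite -/(partial1of2 f t x) d1.
Qed.

Lemma std_normal_char t :
  ('E_(normal_prob 0 1)[fun x => F (t * x)] = (F 0 * expR (- (t ^+ 2 / 2)))%:E)%E.
Proof.
have psi0 : psi 0 = F 0.
  rewrite /psi; under eq_Rintegral do rewrite mul0r.
  rewrite RintegralZl//; last exact: integrable_std_normal_pdf.
  by rewrite /Rintegral integral_normal_pdf mulr1.
have psiE : psi t * expR (t ^+ 2 / 2) = F 0.
  transitivity (psi 0 * expR (0 ^+ 2 / 2)); last first.
    by rewrite psi0 expr0n mul0r expR0 mulr1.
  apply: (@is_derive_0_is_cst _ (fun t => psi t * expR (t ^+ 2 / 2))) => s.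
  have de : is_derive s 1 (fun t => expR (t ^+ 2 / 2)) (s * expR (s ^+ 2 / 2)).
    by apply: trigger_derive; rewrite /GRing.scale /=; field.
  have h := @is_deriveM _ _ _ _ _ _ _ _ (is_derive_psi s) de.
  by apply: (is_derive_eq h); rewrite /GRing.scale /=; ring.
rewrite expRN -psiE mulfK ?gt_eqF ?expR_gt0// unlock.
rewrite (@integral_normal_prob R 0 1 (fun x => (F (t * x))%:E)).
- rewrite /psi /Rintegral fineK; last exact: integrable_fin_num (iF t).
  by apply: eq_integral => x _; rewrite EFinM.
- by apply/measurable_EFinP; apply: mcont; exact: contM.
apply: (@le_lt_trans _ _ (\int[normal_prob 0 1]_x (cst 1%E x))%E); last first.
  rewrite integral_cst// mul1e.
  exact: (le_lt_trans (@probability_le1 _ _ _ (normal_prob 0 1) _ measurableT) (ltry 1)).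
apply: ge0_le_integral => //.
- by apply/measurable_EFinP/measurableT_comp => //; apply: mcont; exact: contM.
- by move=> x _; rewrite lee_fin.
Qed.

End Characteristic.

Lemma std_normal_cos t :
  ('E_(normal_prob 0 1)[fun x => cos (t * x)] = (expR (- (t ^+ 2 / 2)))%:E)%E.
Proof.
have dD x : is_derive x 1 (fun x => - sin x) (- cos x : R).
  by apply: trigger_derive.
rewrite (@std_normal_char (@cos R) (fun x => - sin x) _ dD (@cos_max R)).
  by rewrite cos0 mul1r.
by move=> x; rewrite normrN sin_max.
Qed.

Lemma std_normal_sin t :
  ('E_(normal_prob 0 1)[fun x => sin (t * x)] = 0)%E.
Proof.
rewrite (@std_normal_char (@sin R) (@cos R) _ _ (@sin_max R) (@cos_max R)).
by rewrite sin0 mul0r.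
Qed.

End StandardNormal.

(** * Levy's continuity theorem in the plane *)

Section Bernstein.
Variable R : realType.
Implicit Types (u v c : R) (h g : nat -> R).

(* The mean of h over the binomial distribution with parameters N and u. *)
Fixpoint bern (N : nat) (h : nat -> R) (u : R) : R :=
  if N is N'.+1 then (1 - u) * bern N' h u + u * bern N' (fun j => h j.+1) u
  else h 0%N.

Lemma eq_bern N h g u : h =1 g -> bern N h u = bern N g u.
Proof.
elim: N h g => [|N IH] h g hg /=; first exact: hg.
by rewrite (IH _ _ hg) (IH (fun j => h j.+1) (fun j => g j.+1)).
Qed.

Lemma bernD N h g u : bern N (fun j => h j + g j) u = bern N h u + bern N g u.
Proof. by elim: N h g => //= N IH h g; rewrite !IH; ring. Qed.

Lemma bernZ N c h u : bern N (fun j => c * h j) u = c * bern N h u.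
Proof. by elim: N h => //= N IH h; rewrite !IH; ring. Qed.

Lemma bern_cst N c u : bern N (fun=> c) u = c.
Proof. by elim: N => //= N ->; ring. Qed.

Lemma ler_bern N h g u : 0 <= u <= 1 -> (forall j, (j <= N)%N -> h j <= g j) ->
  bern N h u <= bern N g u.
Proof.
move=> /andP[u0 u1]; elim: N h g => [|N IH] h g hg /=; first exact: hg.
apply: lerD; apply: ler_wpM2l; rewrite ?subr_ge0//; apply: IH => j jN;
by apply: hg; rewrite ?ltnS// leqW.
Qed.

Lemma ler_norm_bern N h c u : 0 <= u <= 1 ->
  (forall j, (j <= N)%N -> `|h j| <= c) -> `|bern N h u| <= c.
Proof.
move=> u01 hc; rewrite ler_norml -[X in _ && (_ <= X)](bern_cst N c u).
rewrite -[X in X <= _](bern_cst N (- c) u).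
by apply/andP; split; apply: ler_bern => // j /hc; rewrite ler_norml => /andP[].
Qed.

(** The shift [c] is general because the induction passes from [j.+1 + c] to [j + (1 + c)]. The
    second summand is the binomial variance. *)
Lemma bern_sqr N c u :
  bern N (fun j => (j%:R + c) ^+ 2) u = (N%:R * u + c) ^+ 2 + N%:R * u * (1 - u).
Proof.
elim: N c => [|N IH] c /=; first by ring.
rewrite (@eq_bern N (fun j => (j.+1%:R + c) ^+ 2)
  (fun j => (j%:R + (1 + c)) ^+ 2)); last by move=> j; rewrite -natr1 addrA.
by rewrite !IH -natr1; ring.
Qed.

Lemma bern_var N u : (0 < N)%N -> 0 <= u <= 1 ->
  bern N (fun j => (j%:R / N%:R - u) ^+ 2) u <= N%:R^-1.
Proof.
move=> N0 /andP[u0 u1]; have N0R : N%:R != 0 :> R by rewrite pnatr_eq0 -lt0n.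
rewrite (eq_bern _ (g := fun j => N%:R ^- 2 * (j%:R + - (N%:R * u)) ^+ 2)).
  rewrite bernZ bern_sqr subrr expr0n add0r.
  have -> : N%:R ^- 2 * (N%:R * u * (1 - u)) = N%:R^-1 * (u * (1 - u)) by field.
  rewrite ler_piMr ?invr_ge0//; nra.
by move=> j; field.
Qed.

(** The hypothesis bounds the oscillation of [G] by a constant plus squared distances; the means of
    the latter are binomial variances, at most [N^-1] after scaling. *)
Lemma bernstein2 (G : R -> R -> R) (e K : R) N : (0 < N)%N -> 0 <= K ->
  (forall u v p q, 0 <= u <= 1 -> 0 <= v <= 1 -> 0 <= p <= 1 -> 0 <= q <= 1 ->
     `|G p q - G u v| <= e + K * ((p - u) ^+ 2 + (q - v) ^+ 2)) ->
  forall u v, 0 <= u <= 1 -> 0 <= v <= 1 ->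
  `|bern N (fun j => bern N (fun k => G (j%:R / N%:R) (k%:R / N%:R)) v) u - G u v|
  <= e + K * (2 / N%:R).
Proof.
move=> N0 K0 GK u v u01 v01.
have j01 j : (j <= N)%N -> 0 <= (j%:R / N%:R : R) <= 1.
  move=> jN; rewrite divr_ge0//= ler_pdivrMr ?ltr0n// mul1r ler_nat//.
have Ecst (x : R) : x = bern N (fun j => bern N (fun k => x) v) u.
  by rewrite !bern_cst.
have bernB M h g w : bern M (fun j => h j - g j) w = bern M h w - bern M g w.
  rewrite -[in RHS]mulN1r -bernZ -bernD; apply: eq_bern => j; by rewrite mulN1r.
rewrite [X in _ - X]Ecst -bernB; under eq_bern do rewrite -bernB.
pose A j k := e + K * ((j%:R / N%:R - u) ^+ 2 + (k%:R / N%:R - v) ^+ 2).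
apply: (@le_trans _ _ (bern N (fun j => bern N (fun k => A j k) v) u)).
  have GA j k : (j <= N)%N -> (k <= N)%N ->
      `|G (j%:R / N%:R) (k%:R / N%:R) - G u v| <= A j k.
    by move=> jN kN; apply: GK => //; exact: j01.
  rewrite ler_norml; apply/andP; split; last first.
    apply: ler_bern => // j jN; apply: ler_bern => // k kN.
    by have := GA _ _ jN kN; rewrite ler_norml => /andP[].
  rewrite -mulN1r -bernZ; apply: ler_bern => // j jN.
  rewrite -bernZ; apply: ler_bern => // k kN; rewrite mulN1r.
  by have := GA _ _ jN kN; rewrite ler_norml => /andP[].
rewrite /A; under eq_bern do rewrite bernD bern_cst bernZ bernD bern_cst.
rewrite bernD bern_cst bernZ bernD bern_cst lerD2l ler_wpM2l// mulrDl mul1r.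
by rewrite lerD// bern_var.
Qed.

End Bernstein.

Lemma heine_cantor (R : realType) (G : R * R -> R) (K : set (R * R)) (e : R) :
  continuous G -> compact K -> 0 < e ->
  exists2 d : R, 0 < d &
    forall z w, K z -> ball z d w -> `|G z - G w| <= e.
Proof.
move=> cG /compact_near_coveringP cK e0.
pose P (d : R) z := forall w, ball z d w -> `|G z - G w| <= e.
have H : \forall d \near at_right (0 : R), forall z, K z -> P d z.
  apply: cK => z Kz.
  have e20 : 0 < e / 2 by rewrite divr_gt0.
  have /cvgrPdist_lt/(_ _ e20) := cG z.
  rewrite -nbhs_ballE => -[r /= r0 rG].
  exists (ball z (r / 2), [set d | d < r / 2]%classic) => /=.
    split; first by apply: nbhsx_ballx; rewrite divr_gt0.
    by apply: nbhs_right_lt; rewrite divr_gt0.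
  move=> [z' d] [/= zz' dr] w z'w.
  have rE : r = r / 2 + r / 2 by rewrite -splitr.
  have H1 : `|G z - G z'| < e / 2.
    by apply: rG; apply: le_ball zz'; rewrite ler_pdivrMr// ler_pMr// ler1n.
  have H2 : `|G z - G w| < e / 2.
    apply: rG; rewrite rE; apply: ball_triangle zz' _.
    by apply: le_ball z'w; exact: ltW.
  have -> : G z' - G w = - (G z - G z') + (G z - G w) by ring.
  apply: le_trans (ler_normD _ _) _; rewrite normrN.
  by move: H1 H2; lra.
have [d [dH d0]] : exists d, (forall z, K z -> P d z) /\ 0 < d.
  near (at_right (0 : R)) => d; exists d; split=> //.
  by near: d; exact: H.
by exists d => // z w Kz; apply: dH.
Unshelve. all: end_near. Qed.

Section Growth.
Variable R : realType.
Local Open Scope classical_set_scope.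
Implicit Types (f g : R * R -> R) (z : R * R).

Definition absum z : R := `|z.1| + `|z.2|.

Definition growth f := continuous f /\
  exists a b, forall z, `|f z| <= a + b * absum z.

Lemma continuous_fst_RR : continuous (fun z => z.1 : R).
Proof. by move=> z; exact: cvg_fst. Qed.

Lemma continuous_snd_RR : continuous (fun z => z.2 : R).
Proof. by move=> z; exact: cvg_snd. Qed.

Lemma growth_bounded f M : continuous f -> (forall z, `|f z| <= M) -> growth f.
Proof. by move=> cf fM; split=> //; exists M, 0 => z; rewrite mul0r addr0. Qed.

Lemma growth_cst (c : R) : growth (fun=> c).
Proof. by apply: (@growth_bounded _ `|c|) => // z; exact: cvg_cst. Qed.

Lemma growthD f g : growth f -> growth g -> growth (fun z => f z + g z).
Proof.
move=> [cf [a [b fab]]] [cg [a' [b' gab]]]; split.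
  by move=> z; apply: cvgD; [exact: cf|exact: cg].
exists (a + a'), (b + b') => z; apply: le_trans (ler_normD _ _) _.
by apply: le_trans (lerD (fab z) (gab z)) _; rewrite mulrDl addrACA.
Qed.

Lemma growthZ (c : R) f : growth f -> growth (fun z => c * f z).
Proof.
move=> [cf [a [b fab]]]; split.
  by move=> z; apply: cvgMr; exact: cf.
exists (`|c| * a), (`|c| * b) => z; rewrite normrM -mulrA -mulrDr.
by rewrite ler_wpM2l.
Qed.

Lemma growth_absum : growth absum.
Proof.
split; last first.
  by exists 0, 1 => z; rewrite add0r mul1r ger0_norm// addr_ge0.
move=> z; apply: cvgD; apply: cvg_norm.
  exact: continuous_fst_RR.
exact: continuous_snd_RR.
Qed.

(** What averages over words and the expectation under the limit law have in common. The bound [C]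
    on the first absolute moment provides tightness; [growth] admits [absum] besides bounded
    functions for this purpose. *)
Definition is_mean (C : R) (E : (R * R -> R) -> R) :=
  [/\ forall f g, growth f -> growth g -> E (fun z => f z + g z) = E f + E g,
      forall c f, growth f -> E (fun z => c * f z) = c * E f,
      forall f g, growth f -> growth g -> (forall z, f z <= g z) -> E f <= E g,
      E (fun=> 1) = 1 & E absum <= C].

Definition phase (s t : R) z := s * z.1 + t * z.2.

Lemma continuous_phase s t : continuous (phase s t).
Proof.
move=> z; apply: cvgD; apply: cvgMr.
  exact: continuous_fst_RR.
exact: continuous_snd_RR.
Qed.

Lemma continuous_cos_phase s t : continuous (fun z => cos (phase s t z)).
Proof.
move=> z; apply: continuous_comp; [exact: continuous_phase|exact: continuous_cos].
Qed.

Lemma continuous_sin_phase s t : continuous (fun z => sin (phase s t z)).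
Proof.
move=> z; apply: continuous_comp; [exact: continuous_phase|exact: continuous_sin].
Qed.

Section Levy.
Variables (C : R) (E_ : nat -> (R * R -> R) -> R) (E : (R * R -> R) -> R).
Hypotheses (E_mean : forall n, is_mean C (E_ n)) (Emean : is_mean C E).
Hypothesis cvg_cosE : forall s t,
  E_ n (fun z => cos (phase s t z)) @[n --> \oo] --> E (fun z => cos (phase s t z)).
Hypothesis cvg_sinE : forall s t,
  E_ n (fun z => sin (phase s t z)) @[n --> \oo] --> E (fun z => sin (phase s t z)).

Let conv f := E_ n f @[n --> \oo] --> E f.

Let convD f g : growth f -> growth g -> conv f -> conv g ->
  conv (fun z => f z + g z).
Proof.
move=> gf gg cf cg; rewrite /conv; have [ED _ _ _ _] := Emean; rewrite ED//.
under eq_fun => n do (have [E_D _ _ _ _] := E_mean n; rewrite E_D//).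
exact: cvgD.
Qed.

Let convZ c f : growth f -> conv f -> conv (fun z => c * f z).
Proof.
move=> gf cf; rewrite /conv; have [_ EZ _ _ _] := Emean; rewrite EZ//.
under eq_fun => n do (have [_ E_Z _ _ _] := E_mean n; rewrite E_Z//).
exact: cvgMr.
Qed.

(* Closed under multiplication by trigonometric polynomials, by the product
   formulas. *)
Definition tame f := [/\ continuous f, exists M, forall z, `|f z| <= M,
  forall s t, conv (fun z => f z * cos (phase s t z)) &
  forall s t, conv (fun z => f z * sin (phase s t z))].

Lemma tame_growth f : tame f -> growth f.
Proof. by case=> cf [M fM] _ _; exact: growth_bounded fM. Qed.

Let growth_trig f (h : R -> R) s t : tame f -> continuous h ->
  (forall x, `|h x| <= 1) -> growth (fun z => f z * h (phase s t z)).
Proof.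
case=> cf [M fM] _ _ ch h1; apply: (@growth_bounded _ M).
  move=> z; apply: cvgM; first exact: cf.
  by apply: continuous_comp; [exact: continuous_phase|exact: ch].
move=> z; rewrite normrM -[M]mulr1 ler_pM//.
Qed.

Let growth_cos f s t : tame f -> growth (fun z => f z * cos (phase s t z)).
Proof. by move=> tf; apply: growth_trig => //; [exact: continuous_cos|exact: cos_max]. Qed.

Let growth_sin f s t : tame f -> growth (fun z => f z * sin (phase s t z)).
Proof. by move=> tf; apply: growth_trig => //; [exact: continuous_sin|exact: sin_max]. Qed.

Lemma tame_conv f : tame f -> conv f.
Proof.
case=> _ _ /(_ 0 0) + _; congr conv; apply/funext => z.
by rewrite /phase !mul0r addr0 cos0 mulr1.
Qed.

Lemma tame_cst c : tame (fun=> c).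
Proof.
split; first by move=> z; exact: cvg_cst.
- by exists `|c|.
- move=> s t; apply: convZ; last exact: cvg_cosE.
  by apply: (@growth_bounded _ 1) => [|z]; [exact: continuous_cos_phase|exact: cos_max].
move=> s t; apply: convZ; last exact: cvg_sinE.
by apply: (@growth_bounded _ 1) => [|z]; [exact: continuous_sin_phase|exact: sin_max].
Qed.

Lemma tameD f g : tame f -> tame g -> tame (fun z => f z + g z).
Proof.
move=> tf tg; have [cf [M fM] f1 f2] := tf; have [cg [M' gM] g1 g2] := tg.
split; first by move=> z; apply: cvgD; [exact: cf|exact: cg].
- exists (M + M') => z; apply: le_trans (ler_normD _ _) _; exact: lerD.
- move=> s t; under eq_fun do rewrite mulrDl.
  by apply: convD => //; exact: growth_cos.
- move=> s t; under eq_fun do rewrite mulrDl.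
  by apply: convD => //; exact: growth_sin.
Qed.

Lemma tameZ c f : tame f -> tame (fun z => c * f z).
Proof.
move=> tf; have [cf [M fM] f1 f2] := tf.
split; first by move=> z; apply: cvgMr; exact: cf.
- by exists (`|c| * M) => z; rewrite normrM ler_wpM2l.
- by move=> s t; under eq_fun do rewrite -mulrA; apply: convZ => //; exact: growth_cos.
- by move=> s t; under eq_fun do rewrite -mulrA; apply: convZ => //; exact: growth_sin.
Qed.

Lemma tame_sin a b f : tame f -> tame (fun z => f z * sin (phase a b z)).
Proof.
move=> tf; have [cf [M fM] f1 f2] := tf.
have phD s t z : phase (s + a) (t + b) z = phase s t z + phase a b z.
  by rewrite /phase; ring.
have phB s t z : phase (s - a) (t - b) z = phase s t z - phase a b z.
  by rewrite /phase; ring.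
split.
- by move=> z; apply: cvgM; [exact: cf|exact: continuous_sin_phase].
- by exists M => z; rewrite normrM -[M]mulr1 ler_pM// sin_max.
- move=> s t; have -> : (fun z => f z * sin (phase a b z) * cos (phase s t z)) =
    (fun z => 2^-1 * (f z * sin (phase (s + a) (t + b) z)) +
       (- 2^-1) * (f z * sin (phase (s - a) (t - b) z))).
    by apply/funext => z; rewrite phD phB; move: (phase s t z) (phase a b z) => p q;
      rewrite sinD sinB; field.
  by apply: convD; try apply: growthZ; try apply: convZ; try exact: growth_sin.
- move=> s t; have -> : (fun z => f z * sin (phase a b z) * sin (phase s t z)) =
    (fun z => 2^-1 * (f z * cos (phase (s - a) (t - b) z)) +
       (- 2^-1) * (f z * cos (phase (s + a) (t + b) z))).
    by apply/funext => z; rewrite phD phB; move: (phase s t z) (phase a b z) => p q;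
      rewrite !cosD cosN sinN; field.
  by apply: convD; try apply: growthZ; try apply: convZ; try exact: growth_cos.
Qed.

Lemma tame_bern N (h : nat -> R * R -> R) a b : (forall j, tame (h j)) ->
  tame (fun z => bern N (fun j => h j z) ((1 + sin (phase a b z)) / 2)).
Proof.
elim: N h => [|N IH] h th /=; first exact: th.
have t0 := IH _ th; have t1 := IH _ (fun j => th j.+1).
set f0 := (fun z => bern N (fun j => h j z) _) in t0.
set f1 := (fun z => bern N (fun j => h j.+1 z) _) in t1.
have -> : (fun z => (1 - (1 + sin (phase a b z)) / 2) * f0 z +
      (1 + sin (phase a b z)) / 2 * f1 z) =
   (fun z => 2^-1 * (f0 z + f1 z) + 2^-1 * ((f1 z + -1 * f0 z) * sin (phase a b z))).
  by apply/funext => z; field.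
apply: tameD; apply: tameZ; first exact: tameD.
by apply: tame_sin; apply: tameD => //; exact: tameZ.
Qed.

Lemma levy_continuity f (M : R) : continuous f -> (forall z, `|f z| <= M) -> conv f.
Proof.
move=> cf fM; have M0 : 0 <= M by exact: le_trans (fM (0, 0)).
have gf : growth f by exact: growth_bounded fM.
(* 7 = 1 + 3 + 3: the convergence for the trigonometric approximation [p], and the distance of [p]
   from [f] under the two means. *)
apply/cvgrPdist_le => e e0; pose e' := e / 7.
have e'0 : 0 < e' by rewrite divr_gt0.
have C0 : 0 <= C.
  have [_ _ Ele E1 EC] := Emean; apply: le_trans EC.
  have [_ EZ _ _ _] := Emean.
  have <- : E (fun=> 0 * 1) = 0 by rewrite EZ ?mul0r//; exact: growth_cst.
  apply: Ele; [exact: growth_cst|exact: growth_absum|].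
  by move=> z; rewrite mul0r addr_ge0.
(* Outside the square of side [2 L] the crude bound [2 M] is at most [2 M / L * absum], whose mean
   is at most [e'] by this choice. *)
pose L := 2 * M * C / e' + 1.
have L0 : 0 < L by rewrite ltr_wpDl// divr_ge0 ?mulr_ge0// ltW.
have LC : 2 * M / L * C <= e'.
  rewrite mulrAC ler_pdivrMr//.
  have -> : e' * L = 2 * M * C + e' by rewrite /L; field; rewrite gt_eqF.
  by rewrite lerDl ltW.
have pi2 : (2^-1 : R) < pi / 2 by rewrite (lt_le_trans _ (pihalf_ge1 R))// invf_lt1// ltr1n.
have half_in (x : R) : `|x| <= 2^-1 -> x \in `[- (pi / 2 : R), pi / 2]%R.
  by rewrite in_itv/= -ler_norml => /le_trans; apply; exact: ltW.
(* As [1 / 2 < pi / 2], sine is invertible on [[-1/2, 1/2]]; as [c < 1], the values of [clamp] below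
   stay in the open interval on which [asin] is continuous. *)
pose c : R := sin 2^-1.
have sin_half (x : R) : `|x| <= 2^-1 -> - c <= sin x <= c.
  move=> xh; rewrite /c -sinN; have := xh; rewrite ler_norml => /andP[x1 x2].
  have [h1 h2] : 2^-1 \in `[- (pi / 2 : R), pi / 2]%R /\
      - 2^-1 \in `[- (pi / 2 : R), pi / 2]%R.
    by split; apply: half_in; rewrite ?normrN ger0_norm// invr_ge0.
  by apply/andP; split; rewrite leNgt ltr_sin ?h1 ?h2 ?(half_in _ xh)// -leNgt.
have c1 : 0 < c < 1.
  have h0 : (0 : R) < 2^-1 by rewrite invr_gt0.
  have i0 : 0 \in `[- (pi / 2 : R), pi / 2]%R.
    by apply: half_in; rewrite normr0 ltW.
  have ih : 2^-1 \in `[- (pi / 2 : R), pi / 2]%R.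
    by apply: half_in; rewrite ger0_norm// ltW.
  have ip : pi / 2 \in `[- (pi / 2 : R), pi / 2]%R.
    by rewrite in_itv/= lexx andbT -subr_ge0 opprK addr_ge0// divr_ge0// pi_ge0.
  apply/andP; split; first by rewrite -[X in X < _]sin0 ltr_sin.
  by rewrite -[X in _ < X]sin_pihalf ltr_sin.
(* [phi] recovers x in [-L, L] from (1 + sin (x / (2 L))) / 2, so on the square
   of side 2 L, f is a continuous function G of two such variables. *)
pose clamp p : R := Num.max (- c) (Num.min c (2 * p - 1)).
pose phi p : R := 2 * L * asin (clamp p).
have clampP p : -1 < clamp p < 1.
  have /andP[c0 c1'] := c1.
  rewrite /clamp lt_max gt_max gt_min c1' andbT.
  have -> : -1 < - c by rewrite ltrN2.
  by move: c0 c1'; rewrite /=; lra.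
have cphi : continuous phi.
  move=> p; apply: cvgMr; apply: (@continuous_comp _ _ _ clamp asin).
    apply: continuous_max; first exact: cvg_cst.
    apply: continuous_min; first exact: cvg_cst.
    by apply: cvgB; [apply: cvgMr; exact: cvg_id|exact: cvg_cst].
  exact: continuous_asin.
have phiK x : `|x| <= L -> phi ((1 + sin (x / (2 * L))) / 2) = x.
  move=> xL; have yh : `|x / (2 * L)| <= 2^-1.
    have i0 : 0 <= (2 * L)^-1 by rewrite invr_ge0 mulr_ge0// ltW.
    rewrite normrM (ger0_norm i0).
    by rewrite ler_pdivrMr ?mulr_gt0// mulKf.
  have /andP[s1 s2] := sin_half _ yh.
  rewrite /phi /clamp mulrC; have -> : 2 * ((1 + sin (x / (2 * L))) / 2) - 1 = sin (x / (2 * L)).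
    by field.
  rewrite min_r// max_r// sinK ?half_in//.
  by rewrite divfK// gt_eqF// mulr_gt0.
pose G z := f (phi z.1, phi z.2).
have cG : continuous G.
  move=> z; apply: (@continuous_comp _ _ _ (fun z => (phi z.1, phi z.2)) f); last exact: cf.
  have h1 : {for z, continuous (fun z => phi z.1)}.
    by apply: (continuous_comp (g := phi)); [exact: continuous_fst_RR|exact: cphi].
  have h2 : {for z, continuous (fun z => phi z.2)}.
    by apply: (continuous_comp (g := phi)); [exact: continuous_snd_RR|exact: cphi].
  exact: cvg_pair h1 h2.
pose K : set (R * R) := `[0, 1] `*` `[0, 1].
have cK : compact K by apply: compact_setX; exact: segment_compact.
have [d d0 dG] := heine_cantor cG cK e'0.
(* If both coordinates differ by less than [d], uniform continuity gives [e']; otherwise [2 M] is at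
   most [k] times the squared distance. *)
pose k := 2 * M / d ^+ 2.
have k0 : 0 <= k by apply: divr_ge0; [exact: mulr_ge0|exact: sqr_ge0].
have GK u v p q : 0 <= u <= 1 -> 0 <= v <= 1 -> 0 <= p <= 1 -> 0 <= q <= 1 ->
    `|G (p, q) - G (u, v)| <= e' + k * ((p - u) ^+ 2 + (q - v) ^+ 2).
  move=> u01 v01 p01 q01.
  have S0 : 0 <= (p - u) ^+ 2 + (q - v) ^+ 2 by rewrite addr_ge0 ?sqr_ge0.
  have [[h1 h2]|far] := pselect (`|p - u| < d /\ `|q - v| < d).
    apply: (@le_trans _ _ e'); last by rewrite lerDl mulr_ge0.
    by apply: dG; [split; rewrite /= in_itv|split].
  apply: (@le_trans _ _ (2 * M)).
    apply: le_trans (ler_normB _ _) _; rewrite mulrDl mul1r.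
    by apply: lerD; exact: fM.
  apply: (@le_trans _ _ (k * ((p - u) ^+ 2 + (q - v) ^+ 2))); last first.
    by rewrite lerDr ltW.
  have d2 : 0 < d ^+ 2 by rewrite exprn_gt0.
  rewrite /k mulrAC ler_pdivlMr// ler_wpM2l ?mulr_ge0//.
  have sq_ge (x : R) : d <= `|x| -> d ^+ 2 <= x ^+ 2.
    by move=> dx; rewrite -[x ^+ 2]real_normK ?num_real// lerXn2r ?nnegrE// ltW.
  have [/sq_ge h|h1] := leP d `|p - u|.
    by apply: le_trans h _; rewrite lerDl sqr_ge0.
  have [/sq_ge h|h2] := leP d `|q - v|; last by case: far.
  by apply: le_trans h _; rewrite lerDr sqr_ge0.
have [N N0 kN] : exists2 N, (0 < N)%N & k * (2 / N%:R) <= e'.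
  exists (Num.truncn (k * 2 / e')).+1 => //.
  rewrite mulrA ler_pdivrMr ?ltr0n// -ler_pdivrMl// mulrC.
  by rewrite ltW// truncnS_gt.
pose a := (2 * L)^-1.
pose U z : R := (1 + sin (phase a 0 z)) / 2.
pose V z : R := (1 + sin (phase 0 a z)) / 2.
pose p z := bern N (fun i => bern N (fun j => G (i%:R / N%:R, j%:R / N%:R)) (V z)) (U z).
have tp : tame p.
  apply: (@tame_bern N (fun i z => bern N (fun j => G (i%:R / N%:R, j%:R / N%:R)) (V z))).
  by move=> i; apply: tame_bern => j; exact: tame_cst.
have sin01 (x : R) : 0 <= (1 + sin x) / 2 <= 1.
  by have := sin_geN1 x; have := sin_le1 x; lra.
have pM z : `|p z| <= M.
  apply: ler_norm_bern => [|i _]; first exact: sin01.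
  by apply: ler_norm_bern => [|j _]; [exact: sin01|exact: fM].
have absum0 z : 0 <= absum z by rewrite addr_ge0.
have pf z : `|p z - f z| <= 2 * e' + 2 * M / L * absum z.
  have [[h1 h2]|far] := pselect (`|z.1| <= L /\ `|z.2| <= L).
    have fG : f z = G (U z, V z).
      rewrite /G /U /V /phase !mul0r addr0 add0r /= ![a * _]mulrC !phiK//.
      by case: (z).
    apply: (@le_trans _ _ (2 * e')); last first.
      by rewrite lerDl mulr_ge0// divr_ge0 ?mulr_ge0// ltW.
    rewrite fG; apply: le_trans.
      by apply: (@bernstein2 _ (fun x y => G (x, y)) e' k N) => //; exact: sin01.
    by move: kN; set X := k * _; lra.
  apply: (@le_trans _ _ (2 * M / L * absum z)); last first.
    by rewrite lerDr mulr_ge0// ltW.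
  apply: (@le_trans _ _ (2 * M)).
    apply: le_trans (ler_normB _ _) _; rewrite mulrDl mul1r.
    by apply: lerD.
  rewrite mulrAC ler_pdivlMr// ler_wpM2l ?mulr_ge0//.
  have [h1|h1] := leP `|z.1| L; last by rewrite /absum (le_trans (ltW h1))// lerDl.
  have [h2|h2] := leP `|z.2| L; first by case: far.
  by rewrite /absum (le_trans (ltW h2))// lerDr.
have mean_close F : is_mean C F -> `|F p - F f| <= 3 * e'.
  move=> [FD FZ Fle F1 FC]; have gp := tame_growth tp.
  have main g h : growth g -> growth h ->
      (forall z, `|g z - h z| <= 2 * e' + 2 * M / L * absum z) ->
      F g - F h <= 3 * e'.
    move=> gg gh gh_le; rewrite lerBlDl.
    apply: (@le_trans _ _ (F (fun z => h z + ((2 * e') * 1 + (2 * M / L) * absum z)))).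
      apply: Fle => // [|z].
        by do 2?apply: growthD => //; apply: growthZ; [exact: growth_cst|exact: growth_absum].
      by rewrite mulr1 -lerBlDl (le_trans (ler_norm _)).
    have g1 : growth (fun=> (2 * e') * 1) by exact: growth_cst.
    have g2 : growth (fun z => 2 * M / L * absum z).
      by apply: growthZ; exact: growth_absum.
    rewrite FD//; last exact: growthD.
    rewrite FD// (FZ _ (fun=> 1)) ?F1; last exact: growth_cst.
    rewrite FZ; last exact: growth_absum.
    rewrite lerD2l mulr1; have : 2 * M / L * F absum <= 2 * M / L * C.
      by rewrite ler_wpM2l// divr_ge0 ?mulr_ge0// ltW.
    by move: LC; lra.
  rewrite ler_norml lerNl opprB !main// => z; rewrite distrC; exact: pf.
have /cvgrPdist_le/(_ _ e'0) := tame_conv tp.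
apply: filterS => n Hn.
have H1 := mean_close _ Emean; have H2 := mean_close _ (E_mean n).
have -> : E f - E_ n f = (E p - E_ n p) - (E p - E f) + (E_ n p - E_ n f) by ring.
apply: le_trans (ler_normD _ _) _.
apply: le_trans (lerD (ler_normB _ _) (lexx _)) _.
apply: le_trans (lerD (lerD Hn H1) H2) _.
by rewrite /e'; lra.
Qed.

End Levy.
End Growth.

(** * Independent normal variables *)

Section Expectation.
Variable R : realType.
Local Open Scope classical_set_scope.

(** Measurability in the plane refers to the product sigma-algebra; an open set is the countable
    union of the open squares with rational centre and radius that it contains. *)
Lemma open_measurable_RR (U : set (R * R)) : open U -> measurable U.
Proof.
move=> oU.
pose B (a b r : rat) : set (R * R) :=
  if `[< ball (ratr a : R, ratr b : R) (ratr r : R) `<=` U >]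
  then ball (ratr a : R) (ratr r : R) `*` ball (ratr b : R) (ratr r : R) else set0.
have -> : U = \bigcup_a \bigcup_b \bigcup_r B a b r.
  apply/seteqP; split => [[x y] Uxy|z [a _ [b _ [r _]]]]; last first.
    by rewrite /B; case: asboolP => // BU [z1 z2]; apply: BU; split.
  have := oU; rewrite openE => /(_ _ Uxy); rewrite /interior -nbhs_ballE.
  move=> [e /= e0 eU]; have e2 : 0 < e / 2 by rewrite divr_gt0.
  have [r] := rat_in_itvoo e2; rewrite in_itv /= => /andP[r0 re].
  have approx t : exists a : rat, ball (ratr a : R) (ratr r : R) t.
    have [a] := @rat_in_itvoo R t (t + ratr r) ltac:(by rewrite ltrDl).
    rewrite in_itv /= => /andP[ta at']; exists a.
    by rewrite /ball /= gtr0_norm ?subr_gt0// ltrBlDl.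
  have [a ax] := approx x; have [b by_] := approx y.
  exists a => //; exists b => //; exists r => //.
  rewrite /B; case: asboolP => [_|[]]; first by split.
  move=> w [/= w1 w2]; apply: eU.
  have -> : e = e / 2 + e / 2 by rewrite -splitr.
  have sub t s c : ball (ratr c : R) (ratr r : R) t -> ball (ratr c : R) (ratr r) s ->
      ball t (e / 2 + e / 2) s.
    move=> ct cs; have re' := ltW re.
    exact: ball_triangle (ball_sym (le_ball re' ct)) (le_ball re' cs).
  by split; [exact: sub ax w1|exact: sub by_ w2].
do 3![apply: bigcupT_measurable_rat => ?].
rewrite /B; case: asboolP => // _.
by apply: measurableX; apply: open_measurable; exact: ball_open.
Qed.

Lemma continuous_measurable_RR (f : R * R -> R) : continuous f ->
  measurable_fun setT f.
Proof.
move=> /continuousP cf; apply: (measurability _ (RGenOpens.measurableE R)).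
move=> _ [_ [a [b ->] <-]]; rewrite setTI; apply: open_measurable_RR.
exact/cf/itv_open.
Qed.

Section Mean.
Variables (d : measure_display) (Om : measurableType d) (Q : probability Om R).

Lemma expectation_Rintegral (X : Om -> R) : Q.-integrable setT (EFin \o X) ->
  'E_Q[X]%E = (\int[Q]_w X w)%:E.
Proof. by move=> iX; rewrite unlock /Rintegral fineK//; exact: integrable_fin_num iX. Qed.

Lemma bounded_integrable (X : Om -> R) M : measurable_fun setT X ->
  (forall w, `|X w| <= M) -> Q.-integrable setT (EFin \o X).
Proof.
move=> mX XM; apply: measurable_bounded_integrable => //.
  by rewrite -ge0_fin_numE//; exact: fin_num_measure.
by exists M; split => [|x Mx w _ /=]; [exact: num_real|rewrite (le_trans (XM w))// ltW].
Qed.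

Variables Y1 Y2 : Om -> R.
Hypotheses (mY1 : measurable_fun setT Y1) (mY2 : measurable_fun setT Y2).
Hypotheses (iY1 : Q.-integrable setT (EFin \o Y1))
           (iY2 : Q.-integrable setT (EFin \o Y2)).

Lemma growth_integrable f : growth f ->
  Q.-integrable setT (EFin \o (fun w => f (Y1 w, Y2 w))).
Proof.
move=> [cf [a [b fab]]].
have mf : measurable_fun setT (fun w => f (Y1 w, Y2 w)).
  apply: (@measurableT_comp _ _ _ _ _ _ f); first exact: continuous_measurable_RR.
  exact: measurable_fun_pair.
have iabs (Y : Om -> R) : Q.-integrable setT (EFin \o Y) ->
    Q.-integrable setT (fun w => (`|Y w|)%:E) by move/integrable_abse.
apply: (@le_integrable _ _ _ Q setT measurableT _
  (fun w => (`|a|%:E + `|b|%:E * (`|Y1 w|%:E + `|Y2 w|%:E))%E)).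
- exact/measurable_EFinP.
- move=> w _ /=; rewrite lee_fin (le_trans (fab _))//.
  apply: le_trans (ler_norm _); rewrite lerD ?ler_norm// ler_wpM2r ?ler_norm//.
  exact: addr_ge0.
- apply: integrableD => //; first exact: finite_measure_integrable_cst.
  apply: integrableZl => //; apply: integrableD => //; exact: iabs.
Qed.

Lemma mean_of_probability :
  is_mean (\int[Q]_w (`|Y1 w| + `|Y2 w|)) (fun f => \int[Q]_w f (Y1 w, Y2 w)).
Proof.
split.
- by move=> f g gf gg; rewrite RintegralD//; exact: growth_integrable.
- by move=> c f gf; rewrite RintegralZl//; exact: growth_integrable.
- by move=> f g gf gg fg; apply: le_Rintegral => //; exact: growth_integrable.
- rewrite Rintegral_cst// mul1r; have := @probability_setT _ _ _ Q.
  by move=> /(congr1 fine).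
- exact: lexx.
Qed.

End Mean.

Section Independence.
Variables (d : measure_display) (Om : measurableType d) (Q : probability Om R).
Variables Y1 Y2 : {RV Q >-> R}.
Hypothesis indep : independent_RV Y1 Y2.

(** By uniqueness of product measures, independence makes the joint law the product of the marginal
    laws, and Fubini's theorem applies. *)
Lemma independent_expectationM (f g : R -> R) (M : R) : measurable_fun setT f ->
  measurable_fun setT g -> (forall x, `|f x| <= M) -> (forall x, `|g x| <= M) ->
  \int[Q]_w (f (Y1 w) * g (Y2 w)) =
  (\int[Q]_w f (Y1 w)) * (\int[Q]_w g (Y2 w)).
Proof.
move=> mf mg fM gM.
pose Y w := (Y1 w, Y2 w).
have mY : measurable_fun setT Y by apply: measurable_fun_pair.
pose Yf : {mfun Om >-> (R * R)%type} := HB.pack Y (isMeasurableFun.Build _ _ _ _ Y mY).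
pose nu1 := distribution Q Y1; pose nu2 := distribution Q Y2.
pose nu := distribution Q Yf.
have nuE X : measurable X -> (nu1 \x nu2)%E X = nu X.
  by apply: product_measure_unique => A B mA mB; rewrite -(indep mA mB).
pose h z := f z.1 * g z.2.
have mh : measurable_fun [set: R * R] h.
  by apply: measurable_funM; apply: measurableT_comp.
have hM z : `|h z| <= M * M by rewrite normrM ler_pM.
have bi d' (Om' : measurableType d') (P : probability Om' R) (X : Om' -> R) c :
    measurable_fun setT X -> (forall w, `|X w| <= c) ->
    P.-integrable setT (EFin \o X) by exact: bounded_integrable.
have iQh : Q.-integrable setT (EFin \o (h \o Y)).
  by apply: (bi _ _ _ _ (M * M)) => [|w]; [exact: measurableT_comp|exact: hM].
have mEh : measurable_fun setT (EFin \o h) by exact/measurable_EFinP.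
have E1 : (\int[Q]_w (h (Y w))%:E = \int[nu]_z (h z)%:E)%E.
  exact/esym/(@integral_distribution _ _ _ _ _ Q Yf (EFin \o h)).
have E2 : (\int[nu]_z (h z)%:E = \int[nu1 \x nu2]_z (h z)%:E)%E.
  by apply: eq_measure_integral => A mA _; exact/esym/nuE.
have ih : (nu1 \x nu2)%E.-integrable setT (EFin \o h).
  apply/integrableP; split=> //.
  apply: (@le_lt_trans _ _ (\int[nu1 \x nu2]_z (M * M)%:E)%E).
    apply: ge0_le_integral => //.
    - by apply/measurable_EFinP/measurableT_comp.
    - by move=> z _; rewrite lee_fin hM.
  have E1T : (nu1 \x nu2)%E setT = 1%E.
    by rewrite nuE//; exact: (@probability_setT _ _ _ nu).
  by rewrite integral_cst// [X in (_ * X)%E]E1T mule1 ltry.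
have i1 : nu1.-integrable setT (EFin \o f) by exact: (bi _ _ nu1 f M).
have i2 : nu2.-integrable setT (EFin \o g) by exact: (bi _ _ nu2 g M).
pose G := (\int[nu2]_y g y)%R.
have EG : (\int[nu2]_y (g y)%:E)%E = G%:E.
  by rewrite /G /Rintegral fineK//; exact: integrable_fin_num i2.
have := integral12_prod_meas1 ih; rewrite /fubini_F.
under eq_integral => x _.
  under eq_integral do rewrite /h /= EFinM.
  rewrite integralZl// EG.
  over.
rewrite integralZr// => E3.
have D1 : (\int[nu1]_x (f x)%:E = \int[Q]_w (f (Y1 w))%:E)%E.
  apply: (@integral_distribution _ _ _ _ _ Q Y1 (EFin \o f)).
    exact/measurable_EFinP.
  by apply: (bi _ _ _ _ M) => [|w]; [exact: measurableT_comp|exact: fM].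
have D2 : (\int[nu2]_x (g x)%:E = \int[Q]_w (g (Y2 w))%:E)%E.
  apply: (@integral_distribution _ _ _ _ _ Q Y2 (EFin \o g)).
    exact/measurable_EFinP.
  by apply: (bi _ _ _ _ M) => [|w]; [exact: measurableT_comp|exact: gM].
have GE : \int[Q]_w g (Y2 w) = G by rewrite /Rintegral -D2 EG.
rewrite GE {1}/Rintegral.
rewrite (_ : (\int[Q]_w (f (Y1 w) * g (Y2 w))%:E)%E = (\int[Q]_w (h (Y w))%:E)%E)//.
rewrite E1 E2 -E3 D1 fineM//.
apply: integrable_fin_num => //.
by apply: (bi _ _ _ (f \o Y1) M) => [|w]; [exact: measurableT_comp|exact: fM].
Qed.

Lemma independent_cosD :
  \int[Q]_w cos (Y1 w + Y2 w) =
  (\int[Q]_w cos (Y1 w)) * (\int[Q]_w cos (Y2 w)) -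
  (\int[Q]_w sin (Y1 w)) * (\int[Q]_w sin (Y2 w)).
Proof.
have mcos : measurable_fun setT (@cos R).
  by apply: continuous_measurable_fun; exact: continuous_cos.
have msin : measurable_fun setT (@sin R).
  by apply: continuous_measurable_fun; exact: continuous_sin.
have mY1 : measurable_fun setT Y1 by [].
have mY2 : measurable_fun setT Y2 by [].
rewrite -(@independent_expectationM _ _ 1 mcos mcos (@cos_max R) (@cos_max R)).
rewrite -(@independent_expectationM _ _ 1 msin msin (@sin_max R) (@sin_max R)).
under eq_Rintegral do rewrite cosD.
rewrite RintegralB//; apply: (@bounded_integrable _ _ _ _ (1 * 1)).
all: by [apply: measurable_funM; exact: measurableT_comp
        |move=> w; rewrite normrM ler_pM ?cos_max ?sin_max].
Qed.

Lemma independent_sinD :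
  \int[Q]_w sin (Y1 w + Y2 w) =
  (\int[Q]_w sin (Y1 w)) * (\int[Q]_w cos (Y2 w)) +
  (\int[Q]_w cos (Y1 w)) * (\int[Q]_w sin (Y2 w)).
Proof.
have mcos : measurable_fun setT (@cos R).
  by apply: continuous_measurable_fun; exact: continuous_cos.
have msin : measurable_fun setT (@sin R).
  by apply: continuous_measurable_fun; exact: continuous_sin.
have mY1 : measurable_fun setT Y1 by [].
have mY2 : measurable_fun setT Y2 by [].
rewrite -(@independent_expectationM _ _ 1 mcos msin (@cos_max R) (@sin_max R)).
rewrite -(@independent_expectationM _ _ 1 msin mcos (@sin_max R) (@cos_max R)).
under eq_Rintegral do rewrite sinD.
rewrite RintegralD//; apply: (@bounded_integrable _ _ _ _ (1 * 1)).
all: by [apply: measurable_funM; exact: measurableT_comp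
        |move=> w; rewrite normrM ler_pM ?cos_max ?sin_max].
Qed.

End Independence.
End Expectation.

(** * A pair of independent centred normal variables *)

Section GaussianPair.
Variable R : realType.
Local Open Scope classical_set_scope.
Notation mu := (@lebesgue_measure R).
Notation G := (normal_prob (0 : R) 1).

(** Unlike [integral_normal_prob], this does not presuppose integrability, and so can serve to prove
    it. *)
Lemma ge0_integral_normal_prob (m s : R) (f : R -> \bar R) :
  measurable_fun [set: R] f -> (forall x, 0 <= f x)%E ->
  (\int[normal_prob m s]_x f x = \int[mu]_x (f x * (normal_pdf m s x)%:E))%E.
Proof.
move=> mf f0; have dom := normal_prob_dominates m s.
rewrite -(Radon_Nikodym_SigmaFinite.change_of_variables dom f0 measurableT mf).
apply: ae_eq_integral => //.
- apply: emeasurable_funM => //; apply: (measurable_int mu).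
  exact: Radon_Nikodym_SigmaFinite.f_integrable.
- apply: emeasurable_funM => //=; apply/measurableT_comp => //=.
  exact: measurable_normal_pdf.
- apply: ae_eqe_mul2l => /=; apply: integral_ae_eq => //=.
  + exact: Radon_Nikodym_SigmaFinite.f_integrable.
  + by apply/measurableT_comp => //; exact: measurable_normal_pdf.
  + by move=> A _ mA; rewrite -Radon_Nikodym_SigmaFinite.f_integral.
Qed.

Lemma integrable_normal_prob_id : G.-integrable [set: R] (EFin \o id).
Proof.
apply/integrableP; split; first exact/measurable_EFinP.
rewrite (@ge0_integral_normal_prob _ _ (fun x => `|x%:E|%E)) => [||x]; last first.
- exact: abse_ge0.
- exact: measurableT_comp.
have : mu.-integrable [set: R] (EFin \o (fun x => `|x| * normal_pdf 0 1 x)).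
  apply: (@integrable_linear_pdf _ _ 0 1) => // [|x].
    apply: measurable_funM; last exact: measurable_normal_pdf.
    by apply: continuous_measurable_fun; exact: norm_continuous.
  by rewrite mul0r add0r mul1r ger0_norm// mulr_ge0// normal_pdf_ge0.
move=> /integrableP[_]; apply: le_lt_trans; rewrite le_eqVlt; apply/orP; left.
apply/eqP; apply: eq_integral => x _ /=.
have H : 0 <= `|x| * normal_pdf 0 1 x by rewrite mulr_ge0// normal_pdf_ge0.
by rewrite (ger0_norm H) EFinM.
Qed.

Notation MR := (measurableTypeR R).

Definition gauss2 : probability (MR * MR)%type R :=
  (G \x G)%E.

(** Scaling a standard normal variable covers the degenerate case [c = 0] too. *)
Definition scaled_fst (c : R) (z : MR * MR) : R := c * z.1.
Definition scaled_snd (c : R) (z : MR * MR) : R := c * z.2.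

Lemma gauss2_setX (A B : set MR) : measurable A -> measurable B ->
  gauss2 (A `*` B) = (G A * G B)%E.
Proof. by move=> mA mB; exact: product_measure1E. Qed.

Lemma measurable_scaled_fst c : measurable_fun setT (scaled_fst c).
Proof.
by apply: measurable_funM => //; exact: measurable_fst.
Qed.

Lemma measurable_scaled_snd c : measurable_fun setT (scaled_snd c).
Proof.
by apply: measurable_funM => //; exact: measurable_snd.
Qed.

HB.instance Definition _ c :=
  isMeasurableFun.Build _ _ _ _ (scaled_fst c) (measurable_scaled_fst c).
HB.instance Definition _ c :=
  isMeasurableFun.Build _ _ _ _ (scaled_snd c) (measurable_scaled_snd c).

Definition gaussX c : {RV gauss2 >-> R} := scaled_fst c.
Definition gaussY c : {RV gauss2 >-> R} := scaled_snd c.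

Lemma gaussXY_independent a b : independent_RV (gaussX a) (gaussY b).
Proof.
move=> A B mA mB.
have mmul c : measurable_fun setT (fun x : MR => c * x : R).
  by apply: measurable_funM.
pose A' : set MR := (fun x => a * x) @^-1` A.
pose B' : set MR := (fun x => b * x) @^-1` B.
have mA' : measurable A' by rewrite -[A']setTI; exact: mmul.
have mB' : measurable B' by rewrite -[B']setTI; exact: mmul.
have -> : gaussX a @^-1` A `&` gaussY b @^-1` B = A' `*` B' by [].
have -> : gaussX a @^-1` A = A' `*` setT by apply/seteqP; split=> z; [|case].
have -> : gaussY b @^-1` B = setT `*` B' by apply/seteqP; split=> z; [|case].
rewrite !gauss2_setX//.
have GT : G setT = 1%E by exact: (@probability_setT _ _ _ G).
by rewrite [G setT]GT mule1 mul1e.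
Qed.

Let G1 : (\int[G]_x 1%:E)%E = 1%E.
Proof.
by rewrite integral_cst// mul1e; exact: (@probability_setT _ _ _ G).
Qed.

Let mscale c : measurable_fun setT (fun x : MR => c * x : R).
Proof. exact: measurable_funM. Qed.

Lemma integral_gaussX (f : R -> R) (M c : R) : measurable_fun [set: R] f ->
  (forall x, `|f x| <= M) ->
  \int[gauss2]_z f (gaussX c z) = \int[G]_x f (c * x).
Proof.
move=> mf fM.
have ih : gauss2.-integrable setT (EFin \o (f \o gaussX c)).
  apply: (@bounded_integrable _ _ _ gauss2 (f \o gaussX c) M) => [|z].
    exact: measurableT_comp.
  exact: fM.
rewrite /Rintegral; congr fine; rewrite -(integral12_prod_meas1 ih) /fubini_F.
apply: eq_integral => x _ /=.
rewrite (eq_integral (fun=> (f (c * x))%:E * 1%:E)%E); last first.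
  by move=> y _; rewrite mule1.
rewrite integralZl ?G1 ?mule1//; exact: finite_measure_integrable_cst.
Qed.

Lemma integral_gaussY (f : R -> R) (M c : R) : measurable_fun [set: R] f ->
  (forall x, `|f x| <= M) ->
  \int[gauss2]_z f (gaussY c z) = \int[G]_x f (c * x).
Proof.
move=> mf fM.
have ih : gauss2.-integrable setT (EFin \o (f \o gaussY c)).
  apply: (@bounded_integrable _ _ _ gauss2 (f \o gaussY c) M) => [|z].
    exact: measurableT_comp.
  exact: fM.
have ig : G.-integrable setT (EFin \o (fun x : MR => f (c * x))).
  apply: (@bounded_integrable _ _ _ G _ M) => [|z]; last exact: fM.
  apply: (measurableT_comp mf). exact: mscale.
rewrite /Rintegral; congr fine; rewrite -(integral12_prod_meas1 ih) /fubini_F.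
transitivity (\int[G]_y ((\int[G]_x f (c * x))%:E * 1%:E))%E.
  apply: eq_integral => y _.
  by rewrite mule1 /Rintegral fineK//; exact: integrable_fin_num ig.
rewrite integralZl ?G1 ?mule1//; last exact: finite_measure_integrable_cst.
by rewrite /Rintegral fineK//; exact: integrable_fin_num ig.
Qed.

Let normal_exp (f : R -> R) (M c r : R) : measurable_fun [set: R] f ->
  (forall x, `|f x| <= M) -> ('E_G[fun x : R => (f (c * x)%R)] = r%:E)%E ->
  \int[G]_x f (c * x) = r.
Proof.
by move=> mf fM; rewrite unlock /Rintegral => ->.
Qed.

Let mcos : measurable_fun setT (@cos R).
Proof. by apply: continuous_measurable_fun; exact: continuous_cos. Qed.
Let msin : measurable_fun setT (@sin R).
Proof. by apply: continuous_measurable_fun; exact: continuous_sin. Qed.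

Lemma gauss2_cos a b : \int[gauss2]_z cos (gaussX a z + gaussY b z) =
  expR (- ((a ^+ 2 + b ^+ 2) / 2)).
Proof.
rewrite (independent_cosD (gaussXY_independent a b)).
rewrite (integral_gaussX _ mcos (@cos_max R)) (integral_gaussY _ mcos (@cos_max R)).
rewrite (integral_gaussX _ msin (@sin_max R)) (integral_gaussY _ msin (@sin_max R)).
rewrite !(normal_exp mcos (@cos_max R) (std_normal_cos _)).
rewrite !(normal_exp msin (@sin_max R) (std_normal_sin _)).
by rewrite mulr0 subr0 -expRD; congr expR; field.
Qed.

Lemma gauss2_sin a b : \int[gauss2]_z sin (gaussX a z + gaussY b z) = 0.
Proof.
rewrite (independent_sinD (gaussXY_independent a b)).
rewrite (integral_gaussX _ msin (@sin_max R)) (integral_gaussY _ msin (@sin_max R)).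
rewrite !(normal_exp msin (@sin_max R) (std_normal_sin _)).
by rewrite mulr0 mul0r addr0.
Qed.

Let norm_scaled_lty c : (\int[G]_x `|c * x|%:E < +oo)%E.
Proof.
have := integrable_mull c integrable_normal_prob_id.
by move=> /integrableP[].
Qed.

Lemma integrable_gaussX c : gauss2.-integrable setT (EFin \o gaussX c).
Proof.
apply/integrable12ltyP; first by apply/measurable_EFinP.
have E (x : R) : (\int[G]_y `|(EFin \o gaussX c) (x, y)| = `|c * x|%:E)%E.
  rewrite (eq_integral (fun=> `|c * x|%:E * 1%:E)%E); last first.
    by move=> y _; rewrite mule1.
  rewrite integralZl ?G1 ?mule1//; exact: finite_measure_integrable_cst.
by under eq_integral do rewrite E; exact: norm_scaled_lty.
Qed.

Lemma integrable_gaussY c : gauss2.-integrable setT (EFin \o gaussY c).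
Proof.
apply/integrable21ltyP; first by apply/measurable_EFinP.
have E (x : R) : (\int[G]_y `|(EFin \o gaussY c) (y, x)| = `|c * x|%:E)%E.
  rewrite (eq_integral (fun=> `|c * x|%:E * 1%:E)%E); last first.
    by move=> y _; rewrite mule1.
  rewrite integralZl ?G1 ?mule1//; exact: finite_measure_integrable_cst.
by under eq_integral do rewrite E; exact: norm_scaled_lty.
Qed.

End GaussianPair.

(** * Runs on uniform words *)

Section UniformWords.
Variables (R : realType) (T : transducer R).
Notation L := (alphI T).
Local Open Scope classical_set_scope.

Lemma measurable_word n (D : set (word T n)) (F : word T n -> R) :
  measurable_fun D F.
Proof. by []. Qed.

Lemma integrable_word n (F : word T n -> R) :
  (unif T n).-integrable setT (EFin \o F).
Proof.
apply: (@bounded_integrable _ _ _ _ F (\sum_(x : word T n) `|F x|)) => [|x].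
  exact: measurable_word.
by rewrite (bigD1 x)//= lerDl sumr_ge0.
Qed.

Lemma Rintegral_unif n (F : word T n -> R) :
  (\int[unif T n]_x F x)%R = (#|{: L}|%:R ^- n) * \sum_(x : word T n) F x.
Proof.
have E : F = (fun y => \sum_(x : word T n) F x * \1_[set x] y).
  apply/funext => y; rewrite (bigD1 y)//= indicE mem_set// mulr1.
  rewrite big1 ?addr0// => x xy; rewrite indicE memNset ?mulr0//.
  by move=> yx; case/eqP: xy.
rewrite /Rintegral {1}E.
under eq_integral do rewrite -sumEFin.
rewrite integral_sum//; last by move=> x; exact: (integrable_word (fun y => F x * \1_[set x] y)).
have Ex x : (\int[unif T n]_y (F x * \1_[set x] y)%:E)%E =
    (F x * (#|` alphI T| ^ n)%:R^-1)%:E.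
  under eq_integral do rewrite EFinM.
  rewrite integralZl//; last exact: (integrable_word \1_[set x]).
  rewrite EFinM; congr (_ * _)%E; rewrite integral_indic// setIT.
  exact: unifE.
under eq_bigr do rewrite Ex.
rewrite sumEFin /= mulr_sumr; apply: eq_bigr => x _.
by rewrite mulrC natrX cardfE.
Qed.

Lemma expectation_unif n (F : word T n -> R) :
  ('E_(unif T n)[F])%E = ((#|{: L}|%:R ^- n) * \sum_(x : word T n) F x)%:E.
Proof.
by rewrite expectation_Rintegral ?Rintegral_unif//; exact: integrable_word.
Qed.

End UniformWords.

Lemma big_tuple_cons (R : nmodType) (L : finType) n (F : n.+1.-tuple L -> R) :
  \sum_(x : n.+1.-tuple L) F x =
  \sum_(x : n.-tuple L) \sum_l F [tuple of l :: x].
Proof.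
rewrite pair_big /=.
rewrite (reindex (fun p : n.-tuple L * L => [tuple of p.2 :: p.1])) //=.
exists (fun x : n.+1.-tuple L => ([tuple of behead x], thead x)) => [[x l] _|x _] /=.
  by congr pair; apply/val_inj.
by rewrite [RHS]tuple_eta.
Qed.

Section WordAverages.
Variables (R : realType) (T : transducer R).
Notation L := (alphI T).
Notation K := (#|{: L}|%:R : R).

Lemma avg_sum_word n (F : seq L -> R) :
  avg n F = K ^- n * \sum_(x : n.-tuple L) F x.
Proof.
elim: n F => [|n IH] F /=.
  rewrite expr0 invr1 mul1r (big_pred1 [tuple]) // => x.
  by apply/esym/eqP; exact: tuple0.
by rewrite IH big_tuple_cons -mulr_sumr exprSr invfM mulrA.
Qed.

Lemma expectation_avg n (F : seq L -> R) :
  ('E_(unif T n)[fun x : word T n => F x])%E = (avg n F)%:E.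
Proof. by rewrite expectation_unif avg_sum_word. Qed.

End WordAverages.

Section Runs.
Variables (R : realType) (T : transducer R) (a : state T -> R).
Hypotheses (hcomplete : complete T) (hdet : deterministic T).
Notation L := (alphI T).
Notation next := (next hcomplete).
Notation edge_at := (edge_at hcomplete).
Notation s0 := (ord0 : state T).
Notation state_after := (state_after next s0).

Fixpoint edge_path (s : state T) (w : seq L) : seq (edge T) :=
  if w is l :: w' then edge_at s l :: edge_path (next s l) w' else [::].

Lemma walk_edge_path s w : walk (trans T) s (edge_path s w) (foldl next s w).
Proof.
elim: w s => [|l w IH] s /=; first exact: eqxx.
by rewrite edge_at_trans eqxx /=; exact: IH.
Qed.

Lemma letter_edge_path s w : map (@letter R T) (edge_path s w) = w.
Proof. by elim: w s => //= l w IH s; rewrite IH. Qed.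

Lemma walk_edge_pathE s p t : walk (trans T) s p t ->
  p = edge_path s (map (@letter R T) p).
Proof.
elim: p s => //= e p IH s /and3P[eT /eqP <- /IH pE].
have eE := transE hcomplete hdet eT.
by rewrite -eE {1}pE; congr (_ :: edge_path _ _); rewrite {1}eE.
Qed.

Lemma edge_path_rcons s w l :
  edge_path s (rcons w l) = rcons (edge_path s w) (edge_at (foldl next s w) l).
Proof. by elim: w s => //= k w IH s; rewrite IH. Qed.

Lemma state_after_foldl w : state_after w = foldl next s0 (rev w).
Proof.
by elim: w => //= l w IH; rewrite rev_cons foldl_rcons -IH.
Qed.

Lemma last_edge_path s w :
  last s (map (@tgt R T) (edge_path s w)) = foldl next s w.
Proof. by elim: w s => //= l w IH s. Qed.

Lemma sum_edge_path (g : edge T -> R) w :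
  \sum_(e <- edge_path s0 (rev w)) g e = asum next s0 (labs hcomplete g) w.
Proof.
elim: w => [|l w IH]; first by rewrite big_nil.
rewrite rev_cons edge_path_rcons -cats1 big_cat big_seq1 IH /=.
by rewrite state_after_foldl.
Qed.

Lemma Output_asum n (x : word T n) :
  Output a x = asum next s0 (labs hcomplete (@outlab R T)) x + a (state_after x).
Proof.
rewrite /Output; case: pickP => [p|]; last first.
  (* The default value of [Output] cannot occur: the edge path of [rev x] is a run. *)
  have sp : size (edge_path s0 (rev x)) == n.
    by rewrite -(size_map (@letter R T)) letter_edge_path size_rev size_tuple.
  move/(_ (Tuple sp)); rewrite /is_run /= letter_edge_path eqxx andbT.
  move=> /existsP[]; exists (foldl next s0 (rev x)).
  exact: walk_edge_path.
case/andP=> /existsP[t wt] /eqP px.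
have pE := walk_edge_pathE wt; rewrite px in pE.
by rewrite pE sum_edge_path last_edge_path state_after_foldl.
Qed.

Lemma Input_asum n (x : word T n) :
  Input x = asum next s0 (fun _ l => val l) x.
Proof.
rewrite /Input; move: (tval x) => w.
by elim: w => [|l w IH]; rewrite ?big_nil// big_cons IH /= addrC.
Qed.

End Runs.

(** * Moments and independence *)

Lemma fin_bound (R : realType) (V : finType) (u : V -> R) :
  exists2 c, 0 <= c & forall s, `|u s| <= c.
Proof.
exists (\sum_s `|u s|); first exact: sumr_ge0.
by move=> s; rewrite (bigD1 s)//= lerDl sumr_ge0.
Qed.

Lemma fin_bound2 (R : realType) (V L : finType) (g : V -> L -> R) :
  exists2 c, 0 <= c & forall s l, `|g s l| <= c.
Proof.
have [c c0 H] := fin_bound (fun p : V * L => g p.1 p.2).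
by exists c => // s l; exact: (H (s, l)).
Qed.

Section AsumLinear.
Variables (R : realType) (L : finType) (n : nat) (nx : 'I_n -> L -> 'I_n).
Variable s0 : 'I_n.

Lemma asum_linear a b (g h : 'I_n -> L -> R) w :
  asum nx s0 (fun s l => a * g s l + b * h s l) w =
  a * asum nx s0 g w + b * asum nx s0 h w.
Proof. by elim: w => [|l w IH] /=; rewrite ?mulr0 ?addr0// IH; ring. Qed.

End AsumLinear.

(** * Asymptotic covariance and Gaussian limits *)

Section Main.
Variables (R : realType) (T : transducer R) (a : state T -> R).
Hypotheses (hcomplete : complete T) (hdet : deterministic T).
Hypotheses (hconn : finally_connected T) (haper : finally_aperiodic T).
Notation L := (alphI T).
Notation K := (#|{: L}|%:R : R).
Notation next := (next hcomplete).
Notation edge_at := (edge_at hcomplete).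
Notation s0 := (ord0 : state T).
Notation stat := (stat hcomplete).
Notation st := (state_after next s0).
Notation asum := (asum next s0).
Notation S := (sumD1 (@one_lab R T)).
Notation avg := (@avg R (alphI T)).
Implicit Types (g h : state T -> L -> R) (p q : edge T -> R) (u v b : state T -> R).

Let L_gt0 := alphI_gt0 T.
Let K_gt0 : 0 < K. Proof. by rewrite ltr0n. Qed.
Let K_neq0 : K != 0. Proof. by rewrite gt_eqF. Qed.

(** For balanced [g] and [h], the covariance of one pair of increments at a stationary state and a
    uniform letter. *)
Definition covar g h : R := K^-1 * \sum_s stat s * \sum_l g s l * h s l.

Definition gauged p u (s : state T) (l : L) : R :=
  p (edge_at s l) + (u (next s l) - u s).

(** Both graph sums ignore coboundaries, so the labels may be replaced by balanced ones, for which
    [prodD_nrooted] evaluates the difference. *)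
Lemma prodD_covar p q u v : balanced (gauged p u) -> balanced (gauged q v) ->
  S^-1 * (prodD1 p q - prodD2 p q) = covar (gauged p u) (gauged q v).
Proof.
move=> bp bq; rewrite -(prodD1_gauge p q u v) -(prodD2_gauge p q u v).
have := @prodD_nrooted _ _ hcomplete hdet (fun e => p e + coboundary u e)
  (fun e => q e + coboundary v e) bp bq.
rewrite /covar sum_stat => E; apply: (mulfI K_neq0); rewrite mulVKf//.
by rewrite mulrCA E mulrC.
Qed.

Lemma covar_poisson g h : exists u, poisson next (fun s l => g s l * h s l) (covar g h) u.
Proof. by apply: exists_poisson => //; rewrite /covar mulVKf. Qed.

Lemma covar_linear x y g h :
  covar (fun s l => x * g s l + y * h s l) (fun s l => x * g s l + y * h s l) =
  x ^+ 2 * covar g g + 2 * x * y * covar g h + y ^+ 2 * covar h h.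
Proof.
rewrite /covar; set A := \sum_s _ * \sum_l g _ _ * g _ _.
set B := \sum_s _ * \sum_l g _ _ * h _ _; set C := \sum_s _ * \sum_l h _ _ * h _ _.
have -> : \sum_s stat s * \sum_l (x * g s l + y * h s l) * (x * g s l + y * h s l) =
    x ^+ 2 * A + 2 * x * y * B + y ^+ 2 * C.
  rewrite !mulr_sumr -!big_split /=; apply: eq_bigr => s _.
  rewrite ![_ * (stat s * _)]mulrCA -!mulrDr; congr (_ * _).
  rewrite !mulr_sumr -!big_split /=; apply: eq_bigr => l _; ring.
by ring.
Qed.

Lemma covar_ge0 g : 0 <= covar g g.
Proof.
rewrite /covar mulr_ge0 ?invr_ge0//; apply: sum_stat_mean => // s.
by apply: sumr_ge0 => l _; rewrite -expr2 sqr_ge0.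
Qed.

Lemma avg_mart_state_bounded g b : balanced g ->
  exists C : R, forall m, `|avg m (fun w => asum g w * b (st w))| <= C.
Proof.
move=> bg; have [c c0 gc] := fin_bound2 g; have [d d0 bd] := fin_bound b.
have [N [N0 [z zN]]] := uniform_reach hcomplete hdet hconn haper.
exists (N%:R * c * K ^+ N * (2 * d)) => m.
suff w : within (- d) (2 * d) b.
  exact: (avg_mart_bounded L_gt0 s0 gc bg N0 zN m w).
by move=> s; have := bd s; rewrite ler_norml => /andP[? ?]; apply/andP; split; lra.
Qed.

Lemma avg_state_bounded b : exists C : R, forall m, `|avg m (fun w => b (st w))| <= C.
Proof.
by have [c _ bc] := fin_bound b; exists c => m; apply: ler_norm_avg => // w.
Qed.

(** The product of the two martingales has mean [covar g h * m] up to a bounded term, by the Poisson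
    equation for [g h]; mixed terms of martingale and state are bounded by
    [avg_mart_state_bounded]. *)
Lemma avg_prod_bounded g h b b' : balanced g -> balanced h ->
  exists2 C : R, 0 <= C & forall m,
    `|avg m (fun w => (asum g w + b (st w)) * (asum h w + b' (st w))) -
      covar g h * m%:R| <= C.
Proof.
move=> bg bh; have [u ug] := covar_poisson g h.
have [C1 H1] := avg_mart_state_bounded b' bg.
have [C2 H2] := avg_mart_state_bounded b bh.
have [C3 H3] := avg_state_bounded (fun s => b s * b' s).
have [C4 H4] := avg_state_bounded u.
have C0 : 0 <= C1 + C2 + C3 + (`|u s0| + C4).
  have P (F : nat -> R) (C : R) (H : forall m, `|F m| <= C) : 0 <= C.
    exact: le_trans (normr_ge0 _) (H 0%N).
  by rewrite !addr_ge0// ?(P _ _ H1) ?(P _ _ H2) ?(P _ _ H3) ?(P _ _ H4).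
exists (C1 + C2 + C3 + (`|u s0| + C4)) => // m.
have -> : avg m (fun w => (asum g w + b (st w)) * (asum h w + b' (st w))) =
    avg m (fun w => asum g w * asum h w) + avg m (fun w => asum g w * b' (st w)) +
    avg m (fun w => asum h w * b (st w)) + avg m (fun w => b (st w) * b' (st w)).
  by rewrite -!avgD; apply: eq_avg => w; ring.
rewrite (@avg_asumM _ _ _ _ L_gt0)// (avg_asum L_gt0 s0 m ug)//.
set A1 := avg m (fun w => asum g w * _); set A2 := avg m (fun w => asum h w * _).
set A3 := avg m (fun w => b _ * _); set A4 := avg m _.
have -> : covar g h * m%:R + (u s0 - A4) + A1 + A2 + A3 - covar g h * m%:R =
  A1 + A2 + A3 + (u s0 - A4) by ring.
apply: le_trans (ler_normD _ _) (lerD _ _); last first.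
  by apply: le_trans (ler_normB _ _) _; rewrite lerD2l; exact: H4.
apply: le_trans (ler_normD _ _) (lerD _ _); last exact: H3.
by apply: le_trans (ler_normD _ _) (lerD (H1 m) (H2 m)).
Qed.

Section Characteristic.
Variables (g : state T -> L -> R) (b : state T -> R).
Hypothesis bg : balanced g.
Variables F D : R -> R.
Hypotheses (F1 : forall x, `|F x| <= 1) (D1 : forall x, `|D x| <= 1).
Hypothesis taylor : forall x y,
  `|F (x + y) - F x - y * D x + y ^+ 2 / 2 * F x| <= `|y| ^+ 3.

(** With [t = 1 / sqrt m], the factor [rho ^+ m] of [char_approx] is exactly the Gaussian value, and
    [m t^3 + t] is [2 t]. *)
Lemma char_cvg :
  (avg m (fun w => F ((Num.sqrt m%:R)^-1 * (asum g w + b (st w)))) @[m --> \oo]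
    --> expR (- (covar g g / 2)) * F 0)%classic.
Proof.
have [v gv] := covar_poisson g g.
have [cg cg0 gc] := fin_bound2 g; have [cv cv0 vc] := fin_bound v.
have [cb cb0 bc] := fin_bound b; have cc0 := covar_ge0 g.
pose c := 1 + cg + cv + cb + covar g g.
have c1 : 1 <= c by rewrite /c; lra.
have lec x y : `|x| <= y -> y <= c -> `|x| <= c by exact: le_trans.
have gc' s l : `|g s l| <= c by apply: lec (gc s l) _; rewrite /c; lra.
have vc' s : `|v s| <= c by apply: lec (vc s) _; rewrite /c; lra.
have bc' s : `|b s| <= c by apply: lec (bc s) _; rewrite /c; lra.
have sc : covar g g <= c by rewrite /c; lra.
apply/cvgrPdist_le => e e0.
near=> m.
have m0 : (0 < m)%N by near: m; exact: nbhs_infty_gt.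
have m0R : 0 < m%:R :> R by rewrite ltr0n.
pose t : R := (Num.sqrt m%:R)^-1.
have t0 : 0 <= t by rewrite invr_ge0 sqrtr_ge0.
have t2 : m%:R * t ^+ 2 = 1.
  by rewrite /t exprVn sqr_sqrtr ?ler0n// divff// gt_eqF.
have t1 : t <= 1.
  suff : t ^+ 2 <= 1 by rewrite expr_le1.
  by rewrite -[leRHS]t2 ler_peMl ?exprn_ge0// ler1n.
have := char_approx L_gt0 s0 c1 gc' vc' bc' bg cc0 sc gv F1 D1 taylor t0 t1 m.
have -> : expR (- (t ^+ 2 / 2 * covar g g)) ^+ m = expR (- (covar g g / 2)).
  rewrite -expRM_natl; congr expR.
  have -> : m%:R * - (t ^+ 2 / 2 * covar g g) = - (m%:R * t ^+ 2) * (covar g g / 2) by field.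
  by rewrite t2; ring.
have -> : m%:R * t ^+ 3 + t = 2 * t by rewrite exprS mulrCA t2; ring.
rewrite distrC => /le_trans; apply.
have -> : 5 * c ^+ 4 * (2 * t) = 10 * c ^+ 4 * t by ring.
have k0 : 0 < 10 * c ^+ 4 by rewrite mulr_gt0// exprn_gt0// (lt_le_trans _ c1).
rewrite -ler_pdivlMl// /t -[leRHS]invrK lef_pV2 ?posrE ?sqrtr_gt0 ?invr_gt0 ?mulr_gt0 ?invr_gt0//.
rewrite -[leLHS]ger0_norm; last by rewrite invr_ge0 mulr_ge0 ?invr_ge0 ?ltW.
rewrite -sqrtr_sqr ler_wsqrtr//.
near: m; exact: nbhs_infty_ger.
Unshelve. all: end_near. Qed.

End Characteristic.

End Main.

Lemma O1_bounded (R : realType) (r : nat -> R) :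
  (exists C : R, forall n, `|r n| <= C) -> (r =O_\oo (fun=> 1 : R))%classic.
Proof.
case=> C rC; apply/eqO_exP; exists (`|C| + 1); first by rewrite ltr_wpDl.
near=> n; rewrite normr1 mulr1; apply: le_trans (rC n) _.
by rewrite (le_trans (ler_norm _))// lerDl.
Unshelve. all: end_near. Qed.

Section Moments.
Variables (R : realType) (T : transducer R).
Local Notation avg := (@avg R (alphI T)).

Lemma covariance_avg n (F G : seq (alphI T) -> R) c d (X Y : word T n -> R) :
  (forall x, X x = F x + c) -> (forall x, Y x = G x + d) ->
  covariance (unif T n) X Y =
  (avg n (fun w => F w * G w) - avg n F * avg n G)%:E.
Proof.
move=> XE YE; have L0 := alphI_gt0 T.
have EE (H : seq (alphI T) -> R) e (Z : word T n -> R) : (forall x, Z x = H x + e) ->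
    ('E_(unif T n)[Z])%E = (avg n H + e)%:E.
  move=> ZE; have -> : Z = (fun x : word T n => H x + e) by apply/funext.
  by rewrite (expectation_avg n (fun w => H w + e)) avgD avg_cst.
rewrite unlock (EE F c X XE) (EE G d Y YE).
rewrite (_ : ((X \- _) * _)%R =
  (fun x : word T n => (F x - avg n F) * (G x - avg n G))); last first.
  by apply/funext => x; rewrite !fctE /= XE YE; ring.
rewrite (expectation_avg n (fun w => (F w - avg n F) * (G w - avg n G))); congr _%:E.
rewrite (@eq_avg _ _ n _ (fun w => F w * G w +
  (- avg n G * F w + (- avg n F * G w + avg n F * avg n G)))); last first.
  by move=> w; ring.
by rewrite !avgD !avgZ avg_cst//; ring.
Qed.

End Moments.

(** * Moments and limit law of input and output *)

Section Assembly.
Variables (R : realType) (T : transducer R) (a : state T -> R).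
Hypotheses (hcomplete : complete T) (hdet : deterministic T).
Hypotheses (hconn : finally_connected T) (haper : finally_aperiodic T).
Notation L := (alphI T).
Notation K := (#|{: L}|%:R : R).
Notation next := (next hcomplete).
Notation s0 := (ord0 : state T).
Notation stat := (stat hcomplete).
Notation st := (state_after next s0).
Notation asum := (asum next s0).
Notation avg := (@avg R (alphI T)).
Notation covar := (covar hcomplete).
Notation gauged := (gauged hcomplete).

Let L_gt0 := alphI_gt0 T.
Let K_gt0 : 0 < K. Proof. by rewrite ltr0n. Qed.
Let K_neq0 : K != 0. Proof. by rewrite gt_eqF. Qed.

Lemma balanced_centered (p : edge T -> R) c u : poisson next (labs hcomplete p) c u ->
  balanced (gauged (fun e => p e - c * one_lab e) u).
Proof.
by move=> pu s; rewrite -[RHS](pu s) -big_split; apply: eq_bigr => l _; rewrite /gauged mulr1.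
Qed.

Lemma asum_centered (p : edge T -> R) c u w :
  asum (gauged (fun e => p e - c * one_lab e) u) w =
  asum (labs hcomplete p) w - c * (size w)%:R + (u (st w) - u s0).
Proof.
rewrite -asumB -asum_gauge /gauged /labs; congr (asum _ _).
by apply/funext => s; apply/funext => l; rewrite mulr1.
Qed.

(** Every state has each letter on exactly one outgoing edge, so the sum of the input labels out of
    a state is the same for all states. *)
Lemma poisson_inlab :
  poisson next (labs hcomplete (@inlab R T)) (const_e1 T) (fun=> 0).
Proof.
have E : \sum_s stat s * \sum_(l : L) val l =
    K * sumD1 (@inlab R T) / sumD1 (@one_lab R T) by rewrite -(sum_stat_edges hcomplete hdet).
move=> s; rewrite subrr [X in _ + X]big1 ?addr0 // sumrB sumr_const -mulr_natl.
by rewrite /const_e1 mulrA -E -mulr_suml sum_stat1// mul1r subrr.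
Qed.

Variable u : state T -> R.
Hypothesis u_poisson : poisson next (labs hcomplete (@outlab R T)) (const_e2 T) u.

Let gI := gauged (@inlab_c R T) (fun=> 0).
Let gO := gauged (@outlab_c R T) u.
(** What remains besides the martingale and the drift: the final output and the boundary terms of
    the coboundary of [u]. *)
Let b (s : state T) := a s - u s + u s0.

Let bI : balanced gI. Proof. exact: balanced_centered poisson_inlab. Qed.
Let bO : balanced gO. Proof. exact: balanced_centered u_poisson. Qed.

Let InputE n (x : word T n) : Input x = asum gI x + const_e1 T * n%:R.
Proof.
rewrite /gI asum_centered size_tuple subrr addr0 subrK (Input_asum hcomplete).
by congr (asum _ _).
Qed.

Let OutputE n (x : word T n) :
  Output a x = asum gO x + b (st x) + const_e2 T * n%:R.
Proof.
rewrite /gO asum_centered size_tuple (Output_asum a hcomplete hdet) /b; ring.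
Qed.

Lemma expectation_Input n : ('E_(unif T n)[@Input R T n])%E = (const_e1 T * n%:R)%:E.
Proof.
have -> : @Input R T n = (fun x : word T n => asum gI x + const_e1 T * n%:R).
  exact/funext/InputE.
rewrite (expectation_avg n (fun w => asum gI w + const_e1 T * n%:R)) avgD avg_cst//.
by rewrite avg_asum_balanced// add0r.
Qed.

Lemma expectation_Output :
  linear_up_to_O1 (fun n => 'E_(unif T n)[@Output R T a n]%E) (const_e2 T).
Proof.
have [C bC] := avg_state_bounded hcomplete b.
exists (fun n => avg n (fun w => b (st w))); first by apply: O1_bounded; exists C.
move=> n; have -> : @Output R T a n =
    (fun x : word T n => asum gO x + b (st x) + const_e2 T * n%:R).
  exact/funext/OutputE.
rewrite (expectation_avg n (fun w => asum gO w + b (st w) + const_e2 T * n%:R)).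
rewrite (avgD n (fun w => asum gO w + b (st w))) (avgD n (asum gO)) avg_cst//.
by rewrite avg_asum_balanced// add0r addrC.
Qed.

Let covarI : const_v1 T = covar gI gI.
Proof. exact (prodD_covar hdet bI bI). Qed.
Let covarO : const_v2 T = covar gO gO.
Proof. exact (prodD_covar hdet bO bO). Qed.
Let covarIO : const_c T = covar gI gO.
Proof. exact (prodD_covar hdet bI bO). Qed.

(** The sum of the squared centred letters is the same for every state, so the Poisson equation for
    the square of [gI] has the zero solution and the formula is exact. *)
Lemma variance_Input n : ('V_(unif T n)[@Input R T n])%E = (const_v1 T * n%:R)%:E.
Proof.
rewrite /variance (covariance_avg (@InputE n) (@InputE n)) avg_asum_balanced// mul0r subr0.
rewrite (@avg_asumM _ _ _ _ L_gt0)//.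
have gIE s l : gI s l = val l - const_e1 T.
  by rewrite /gI /gauged subrr addr0 /inlab_c /one_lab mulr1.
pose M : R := \sum_(l : L) (val l - const_e1 T) ^+ 2.
have sqE s : \sum_l gI s l * gI s l = M by apply: eq_bigr => l _; rewrite gIE.
have P : poisson next (fun s l => gI s l * gI s l) (covar gI gI) (fun=> 0).
  move=> s; rewrite subrr [X in _ + X]big1 ?addr0 // sumrB sumr_const -mulr_natl.
  rewrite /covar mulVKf// sqE (eq_bigr (fun r => stat r * M)) => [|r _]; last first.
    by congr (_ * _); exact: sqE.
  by rewrite -mulr_suml sum_stat1// mul1r subrr.
by rewrite (avg_asum L_gt0 s0 n P) avg_cst// subrr addr0 covarI.
Qed.

Lemma covariance_linear (g h : state T -> L -> R) (b1 b2 : state T -> R)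
    (X Y : forall n, word T n -> R) c1 c2 :
  balanced g -> balanced h ->
  (forall n (x : word T n), X n x = asum g x + b1 (st x) + c1 n) ->
  (forall n (x : word T n), Y n x = asum h x + b2 (st x) + c2 n) ->
  linear_up_to_O1 (fun n => covariance (unif T n) (X n) (Y n)) (covar g h).
Proof.
move=> bg bh XE YE.
have [C _ HC] := avg_prod_bounded hcomplete hdet hconn haper b1 b2 bg bh.
have [C1 H1] := avg_state_bounded hcomplete b1.
have [C2 H2] := avg_state_bounded hcomplete b2.
pose P (w : seq L) : R := (asum g w + b1 (st w)) * (asum h w + b2 (st w)).
pose B (f : state T -> R) n := avg n (fun w => f (st w)).
exists (fun n => avg n P - covar g h * n%:R - B b1 n * B b2 n).
  apply: O1_bounded; exists (C + C1 * C2) => n.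
  apply: le_trans (ler_normB _ _) (lerD (HC n) _).
  by rewrite normrM; apply: ler_pM => //; [exact: H1|exact: H2].
rewrite /= => n; rewrite (@covariance_avg _ _ _ (fun w => asum g w + b1 (st w))
  (fun w => asum h w + b2 (st w)) _ _ _ _ (XE n) (YE n)); congr _%:E.
rewrite (avgD n (asum g)) (avgD n (asum h)) !avg_asum_balanced// !add0r.
by rewrite [RHS]addrA [_ + (_ - _)]addrC subrK.
Qed.

Lemma covariance_Input_Output : linear_up_to_O1
  (fun n => covariance (unif T n) (@Input R T n) (@Output R T a n)) (const_c T).
Proof.
rewrite covarIO; apply: (@covariance_linear gI gO (fun=> 0) b _ _
  (fun n => const_e1 T * n%:R) (fun n => const_e2 T * n%:R)) => // n x.
  by rewrite addr0.
Qed.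

Lemma variance_Output :
  linear_up_to_O1 (fun n => 'V_(unif T n)[@Output R T a n]%E) (const_v2 T).
Proof.
rewrite covarO; exact: (@covariance_linear gO gO b b _ _
  (fun n => const_e2 T * n%:R) (fun n => const_e2 T * n%:R)).
Qed.

Let stdw n (w : seq L) : R * R := ((Num.sqrt n%:R)^-1 * asum gI w,
  (Num.sqrt n%:R)^-1 * (asum gO w + b (st w))).

Let standardizedE n (x : word T n) : standardized a x = stdw n x.
Proof.
by rewrite /standardized InputE OutputE !addrK ![_ / Num.sqrt _]mulrC.
Qed.

Let expectation_standardized n (f : R * R -> R) :
  ('E_(unif T n)[f \o @standardized R T a n])%E = (avg n (f \o stdw n))%:E.
Proof.
rewrite -(expectation_avg n (f \o stdw n)); congr expectation.
by apply/funext => x; rewrite /= standardizedE.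
Qed.

Let E_ n (f : R * R -> R) : R := avg n (f \o stdw n).

(** First absolute moments are bounded by means of [|z| <= 1 + z ^+ 2] and of second moments of
    order [n]. *)
Let E_mean : exists C, forall n, is_mean C (E_ n).
Proof.
have bnd (g : state T -> L -> R) (c : state T -> R) : balanced g -> exists C : R, forall n,
    avg n (fun w => `|(Num.sqrt n%:R)^-1 * (asum g w + c (st w))|) <= C.
  move=> bg; have [C C0 HC] := avg_prod_bounded hcomplete hdet hconn haper c c bg bg.
  have v0 := covar_ge0 hcomplete hdet hconn g.
  exists (1 + (covar g g + C)) => n.
  set th : R := (Num.sqrt n%:R)^-1.
  (* For [n = 0] the factor [th] is [0^-1 = 0]. *)
  have [th1 thn] : th ^+ 2 <= 1 /\ th ^+ 2 * n%:R <= 1.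
    rewrite /th exprVn sqr_sqrtr ?ler0n//; case: n {th} => [|n].
      by rewrite invr0 mul0r ler01.
    by rewrite mulVf// invf_le1 ?ler1n ?ltr0n.
  apply: (@le_trans _ _ (avg n (fun w => 1 + th ^+ 2 *
      ((asum g w + c (st w)) * (asum g w + c (st w)))))).
    apply: ler_avg => // w _; set y := _ + c _.
    rewrite -[_ * (y * y)]/(_ * (y ^+ 2)) -exprMn -real_normK ?num_real//.
    have : 0 <= (`|th * y| - 1 / 2) ^+ 2 by exact: sqr_ge0.
    by nra.
  rewrite avgD avg_cst// avgZ lerD2l.
  move: (HC n); set A := avg n _; rewrite ler_norml => /andP[_ HA].
  have {}HA : A <= covar g g * n%:R + C by lra.
  apply: (@le_trans _ _ (th ^+ 2 * (covar g g * n%:R + C))); first by rewrite ler_wpM2l ?sqr_ge0.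
  rewrite mulrDr mulrCA lerD ?ler_piMl ?ler_piMr//.
have [C1 H1] := bnd gI (fun=> 0) bI; have [C2 H2] := bnd gO b bO.
exists (C1 + C2) => n; split.
- by move=> f g _ _; rewrite /E_ -avgD.
- by move=> c f _; rewrite /E_ -avgZ.
- by move=> f g _ _ fg; apply: ler_avg => // w _; exact: fg.
- by rewrite /E_ avg_cst.
rewrite /E_ [X in X <= _](avgD n (fun w => `|(stdw n w).1|) (fun w => `|(stdw n w).2|)).
apply: lerD; last exact: H2.
by apply: le_trans (H1 n); under [leRHS]eq_avg do rewrite addr0.
Qed.

Let gaussian_variance s t : R := s ^+ 2 * const_v1 T + 2 * s * t * const_c T + t ^+ 2 * const_v2 T.

(** Linear combinations of the two martingales come from balanced labels again, so the joint
    characteristic function reduces to the one-dimensional case. *)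
Let phase_cvg (F D : R -> R) s t :
  (forall x, `|F x| <= 1) -> (forall x, `|D x| <= 1) ->
  (forall x y, `|F (x + y) - F x - y * D x + y ^+ 2 / 2 * F x| <= `|y| ^+ 3) ->
  (E_ n (fun z => F (phase s t z)) @[n --> \oo] -->
    expR (- (gaussian_variance s t / 2)) * F 0)%classic.
Proof.
move=> F1 D1 FD; pose g (q : state T) (l : L) := s * gI q l + t * gO q l.
have bg : balanced g.
  by move=> q; rewrite big_split /= -!mulr_sumr bI bO !mulr0 addr0.
have := @char_cvg _ _ hcomplete hdet hconn _ (fun q => t * b q) bg F D F1 D1 FD.
have -> : covar g g = gaussian_variance s t.
  by rewrite /gaussian_variance covarI covarO covarIO; exact: covar_linear.
rewrite (_ : (fun n => avg n _) = (fun n => E_ n (fun z => F (phase s t z))))//.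
apply/funext => n; apply: eq_avg => w; rewrite asum_linear /phase /stdw /=.
by congr F; ring.
Qed.

Let cos_cvg s t : (E_ n (fun z => cos (phase s t z)) @[n --> \oo] -->
  expR (- (gaussian_variance s t / 2)))%classic.
Proof.
have N1 x : `|- sin x| <= 1 :> R by rewrite normrN; exact: sin_max.
by have := @phase_cvg _ _ s t (@cos_max R) N1 (@cosD_taylor R); rewrite cos0 mulr1.
Qed.

Let sin_cvg s t : (E_ n (fun z => sin (phase s t z)) @[n --> \oo] --> (0 : R))%classic.
Proof.
by have := @phase_cvg _ _ s t (@sin_max R) (@cos_max R) (@sinD_taylor R); rewrite sin0 mulr0.
Qed.

Lemma independent_of_covariance0 : const_c T = 0 -> independent a.
Proof.
move=> c0; have v1_ge0 : 0 <= const_v1 T by rewrite covarI; exact: covar_ge0.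
have v2_ge0 : 0 <= const_v2 T by rewrite covarO; exact: covar_ge0.
pose Y1 := gaussX (Num.sqrt (const_v1 T)); pose Y2 := gaussY (Num.sqrt (const_v2 T)).
exists _, _, (gauss2 R), Y1, Y2; split; first exact: gaussXY_independent.
pose E (f : R * R -> R) := (\int[gauss2 R]_w f (Y1 w, Y2 w))%R.
have [C C_mean] := E_mean.
have mY : is_mean (\int[gauss2 R]_w (`|Y1 w| + `|Y2 w|))%R E.
  by apply: mean_of_probability; [| |exact: integrable_gaussX|exact: integrable_gaussY].
pose C' := Num.max C (\int[gauss2 R]_w (`|Y1 w| + `|Y2 w|))%R.
have meanW (D : R) (E' : (R * R -> R) -> R) : D <= C' -> is_mean D E' -> is_mean C' E'.
  by move=> DC [? ? ? ? D']; split=> //; exact: le_trans DC.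
have phaseE s t w : phase s t (Y1 w, Y2 w) = gaussX (s * Num.sqrt (const_v1 T)) w +
    gaussY (t * Num.sqrt (const_v2 T)) w.
  by rewrite /phase /= /scaled_fst /scaled_snd !mulrA.
have cosE s t : E (fun z => cos (phase s t z)) = expR (- (gaussian_variance s t / 2)).
  rewrite /E; under eq_Rintegral do rewrite phaseE.
  rewrite gauss2_cos !exprMn !sqr_sqrtr// /gaussian_variance c0.
  by congr expR; ring.
have sinE s t : E (fun z => sin (phase s t z)) = 0.
  by rewrite /E; under eq_Rintegral do rewrite phaseE; rewrite gauss2_sin.
move=> f cf [M fM].
have iY : (gauss2 R).-integrable setT (EFin \o (f \o (fun w => (Y1 w, Y2 w)))).
  apply: growth_integrable; [| |exact: integrable_gaussX|exact: integrable_gaussY|] => //.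
  exact: growth_bounded fM.
rewrite (expectation_Rintegral iY); under eq_fun do rewrite expectation_standardized.
apply/cvg_EFin; first by near=> n.
apply: (@levy_continuity R C' E_ E _ _ _ _ f M cf fM).
- by move=> n; apply: meanW (C_mean n); rewrite le_max lexx.
- by apply: meanW mY; rewrite le_max lexx orbT.
- by move=> s t; rewrite cosE; exact: cos_cvg.
- by move=> s t; rewrite sinE; exact: sin_cvg.
Unshelve. all: end_near. Qed.

Lemma covariance0_of_independent : independent a -> const_c T = 0.
Proof.
case=> d [Om [Q [Y1 [Y2 [indep cvgY]]]]].
have meas (h : R -> R) s t : continuous h ->
    measurable_fun setT (fun w => h (phase s t (Y1 w, Y2 w))).
  move=> ch; apply: (@measurableT_comp _ _ _ _ _ _ (fun z => h (phase s t z))).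
    apply: continuous_measurable_RR => z; apply: continuous_comp; last exact: ch.
    exact: continuous_phase.
  exact: measurable_fun_pair.
have lim (h : R -> R) s t l : continuous h -> (forall x, `|h x| <= 1) ->
    (E_ n (fun z => h (phase s t z)) @[n --> \oo] --> l)%classic ->
    (\int[Q]_w h (phase s t (Y1 w, Y2 w)))%R = l.
  move=> ch h1 hl.
  have cf : continuous (fun z => h (phase s t z)).
    by move=> z; apply: continuous_comp; [exact: continuous_phase|exact: ch].
  have bf : exists M : R, forall z, `|h (phase s t z)| <= M by exists 1.
  have := cvgY _ cf bf; rewrite (_ : _ \o _ = fun w => h (phase s t (Y1 w, Y2 w)))//.
  rewrite expectation_Rintegral; last first.
    by apply: bounded_integrable (meas h s t ch) _ => w; exact: h1.
  under eq_fun do rewrite expectation_standardized.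
  move=> /fine_cvgP[_ hY].
  exact: (cvg_unique _ hY hl).
have cosY s t := lim _ s t _ (@continuous_cos R) (@cos_max R) (@cos_cvg s t).
have sinY s t := lim _ s t _ (@continuous_sin R) (@sin_max R) (@sin_cvg s t).
have E1 w : phase 1 0 (Y1 w, Y2 w) = Y1 w by rewrite /phase mul1r mul0r addr0.
have E2 w : phase 0 1 (Y1 w, Y2 w) = Y2 w by rewrite /phase mul1r mul0r add0r.
have E12 w : phase 1 1 (Y1 w, Y2 w) = Y1 w + Y2 w by rewrite /phase !mul1r.
have cos12 : \int[Q]_w cos (Y1 w + Y2 w) = expR (- (gaussian_variance 1 1 / 2)).
  by rewrite -(cosY 1 1); apply: eq_Rintegral => w _; rewrite E12.
have cos1 : \int[Q]_w cos (Y1 w) = expR (- (gaussian_variance 1 0 / 2)).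
  by rewrite -(cosY 1 0); apply: eq_Rintegral => w _; rewrite E1.
have cos2 : \int[Q]_w cos (Y2 w) = expR (- (gaussian_variance 0 1 / 2)).
  by rewrite -(cosY 0 1); apply: eq_Rintegral => w _; rewrite E2.
have sin1 : \int[Q]_w sin (Y1 w) = 0.
  by rewrite -(sinY 1 0); apply: eq_Rintegral => w _; rewrite E1.
(* Up to sign the exponents are [(v1 + 2 c + v2) / 2] and [v1 / 2 + v2 / 2], so injectivity of
   [expR] leaves [c = 0]. *)
have := independent_cosD indep; rewrite cos12 cos1 cos2 sin1 mul0r subr0 -expRD.
by move=> /expR_inj; rewrite /gaussian_variance; lra.
Qed.
End Assembly.

Theorem theorem3p14 (R : realType) (T : transducer R) (a : state T -> R)
    (hcomplete : complete T) (hsubseq : subsequential a)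
    (hconn : finally_connected T) (haper : finally_aperiodic T) :
  (forall n, 'E_(unif T n)[@Input R T n]%E = (const_e1 T * n%:R)%:E) /\
  linear_up_to_O1 (fun n => 'E_(unif T n)[@Output R T a n]%E) (const_e2 T) /\
  (forall n, 'V_(unif T n)[@Input R T n]%E = (const_v1 T * n%:R)%:E) /\
  linear_up_to_O1 (fun n => 'V_(unif T n)[@Output R T a n]%E) (const_v2 T) /\
  linear_up_to_O1
    (fun n => covariance (unif T n) (@Input R T n) (@Output R T a n))
    (const_c T) /\
  (independent a <->
   prodD1 (@inlab_c R T) (@outlab_c R T) =
   prodD2 (@inlab_c R T) (@outlab_c R T)).
Proof.
have [hdet _ _] := hsubseq.
have [u hu] := exists_poisson_labs hcomplete hdet hconn (@outlab R T).
have S0 := sumD1_one_gt0 hcomplete hdet hconn.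
split; first by move=> n; exact: expectation_Input.
split; first exact: expectation_Output hu.
split; first by move=> n; exact: variance_Input.
split; first exact: variance_Output hu.
split; first exact: covariance_Input_Output hu.
split=> [ind|prodE].
  have /eqP := covariance0_of_independent hdet hconn hu ind.
  by rewrite mulf_eq0 invr_eq0 gt_eqF//= subr_eq0 => /eqP.
apply: (independent_of_covariance0 a hdet hconn haper hu).
by rewrite /const_c prodE subrr mulr0.
Qed.
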